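(* Assume conditions (A1)--(A4) of the context. Then the family $\{P_{\alpha,n}\}_{\alpha\in\Theta,n\in\mathbb{N}}$ satisfies Condition (L) of the context, with matrices $\epsilon_n$ and with $$\mathcal{T}_n(\alpha_0)=\mathcal{T}_n=\epsilon_n^\top\sum_{j=1}^{m_n}E_{\alpha_0}[\eta_j\eta_j^\top|\mathcal{A}_{j-1,n}]\,\epsilon_n,\qquad V_n(\alpha_0)=V_n=\epsilon_n^\top\sum_{j=1}^{m_n}\eta_j .$$ If, further, the random matrix $\mathcal{T}$ in (A4) is positive definite almost surely and $\epsilon_n$ is a symmetric, positive definite matrix for every $n\in\mathbb{N}$, then $\{P_{\alpha,n}\}_{\alpha,n}$ satisfies the LAMN property at $\alpha=\alpha_0$.
   Context: Setting. Let $\Theta\subset\mathbb{R}^d$ be open, $\alpha_0\in\Theta$, and let $(m_n)_{n\ge1}$ be positive integers. For each $n$ let $\mathcal{X}_{n,1},\dots,\mathcal{X}_{n,m_n}$ be complete separable metric spaces, $\mathcal{X}_n=\mathcal{X}_{n,1}\times\cdots\times\mathcal{X}_{n,m_n}$, $\mathcal{A}_n=\mathcal{B}(\mathcal{X}_n)$ (Borel $\sigma$-algebra), and let $\{P_{\alpha,n}\}_{\alpha\in\Theta}$ be probability measures on $(\mathcal{X}_n,\mathcal{A}_n)$. Let $X_j:\mathcal{X}_n\to\mathcal{X}_{n,j}$ be the natural projection, $\bar X_j=(X_1,\dots,X_j)$, $\bar{\mathcal{X}}_{n,j}=\mathcal{X}_{n,1}\times\cdots\times\mathcal{X}_{n,j}$,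 $\mathcal{A}_{0,n}=\{\emptyset,\mathcal{X}_n\}$ and $\mathcal{A}_{j,n}=\sigma(\bar X_j)$. Suppose there are $\sigma$-finite measures $\mu_{n,j}$ on $\mathcal{X}_{n,j}$ with $P_{\alpha,n}(X_1\in\cdot)\ll\mu_{n,1}$ and $P_{\alpha,n}(X_j\in\cdot|\bar X_{j-1}=\bar x_{j-1})\ll\mu_{n,j}$ for $2\le j\le m_n$, $\bar x_{j-1}\in\bar{\mathcal{X}}_{n,j-1}$; $p_1(\alpha)$ and $p_j(\alpha)$ ($2\le j\le m_n$) denote the corresponding (conditional) densities, $p_j(\alpha)$ being a function of $(\bar x_{j-1},x_j)$. $E_\alpha$ is expectation under $P_{\alpha,n}$. Functions of $(\bar x_{j-1},x_j)$ are also regarded as random variables by evaluating at $(\bar X_{j-1},X_j)$; an integral of such a function over $x_j$ with respect to $\mu_{n,j}$ is regarded as a random variable by evaluating at $\bar X_{j-1}$. Let $\epsilon_n$ be nondegenerate $d\times d$ matrices with $\|\epsilon_n\|_{\rm op}\to0$, and $\alpha_h=\alpha_0+\epsilon_nh$ for $h\in\mathbb{R}^d$ (for each $h$, only $n$ so large that $\alpha_h\in\Theta$ are considered). $dP_{\alpha',n}/dP_{\alpha,n}$ denotes the Radon--Nikodym derivative of the absolutely continuous part, as usual in likelihood ratios. (A1) There are random vectors $\dot\xi_{nj}(\alpha_0):\bar{\mathcal{X}}_{n,j}\to\mathbb{R}^d$ such that for every $h\in\mathbb{R}^d$, $\sum_{j=1}^{m_n}\int[\xi_{nj}(\alpha_0,h)-\frac12h^\top\epsilon_n^\top\dot\xi_{nj}(\alpha_0)]^2d\mu_{n,j}\to0$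 in $P_{\alpha_0,n}$-probability as $n\to\infty$, where $\xi_{nj}(\alpha_0,h)=\sqrt{p_j(\alpha_h)}-\sqrt{p_j(\alpha_0)}$. Define $\eta_j=\dot\xi_{nj}(\alpha_0)/\sqrt{p_j(\alpha_0)}$ if $p_j(\alpha_0)\ne0$ and $\eta_j=0$ otherwise, and let $\mathcal{T}_n,V_n$ be as in the claim. (A2) There is $n_0\in\mathbb{N}$ such that $E_{\alpha_0}[|\eta_j|^2|\mathcal{A}_{j-1,n}]<\infty$ and $E_{\alpha_0}[\eta_j|\mathcal{A}_{j-1,n}]=0$, $P_{\alpha_0,n}$-a.s., for all $1\le j\le m_n$, $n\ge n_0$. (A3) For every $\epsilon>0$ and $h\in\mathbb{R}^d$, $\sum_{j=1}^{m_n}E_{\alpha_0}[|h^\top\epsilon_n^\top\eta_j|^21_{\{|h^\top\epsilon_n^\top\eta_j|>\epsilon\}}|\mathcal{A}_{j-1,n}]\to0$ in $P_{\alpha_0,n}$-probability. (A4) There is a random symmetric $d\times d$ matrix $\mathcal{T}$, nonnegative definite almost surely, such that $\mathcal{L}((V_n,\mathcal{T}_n)|P_{\alpha_0,n})\to\mathcal{L}(\mathcal{T}^{1/2}W,\mathcal{T})$, where $W\sim N(0,I_d)$ is independent of $\mathcal{T}$. Condition (L). (1) There exist nondegenerate matrices $\epsilon_n$ with $\|\epsilon_n\|_{\rm op}\to0$, $\mathcal{A}_n$-measurable $d$-dimensional vectors $V_n(\alpha_0)$ and $\mathcal{A}_n$-measurable symmetric $d\times d$ matrices $\mathcal{T}_n(\alpha_0)$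 with $P_{\alpha_0,n}(\mathcal{T}_n(\alpha_0)\text{ is nonnegative definite})=1$ for all $n$, such that $\log\frac{dP_{\alpha_0+\epsilon_nh,n}}{dP_{\alpha_0,n}}-h^\top V_n(\alpha_0)+\frac12h^\top\mathcal{T}_n(\alpha_0)h\to0$ in $P_{\alpha_0,n}$-probability for every $h\in\mathbb{R}^d$. (2) There is an almost surely symmetric nonnegative definite random $d\times d$ matrix $\mathcal{T}(\alpha_0)$ with $\mathcal{L}(V_n(\alpha_0),\mathcal{T}_n(\alpha_0)|P_{\alpha_0,n})\to\mathcal{L}(\mathcal{T}^{1/2}(\alpha_0)W,\mathcal{T}(\alpha_0))$, $W$ a $d$-dimensional standard normal vector independent of $\mathcal{T}(\alpha_0)$. LAMN property at $\alpha_0$: Condition (L) holds for some choice of $\epsilon_n,V_n(\alpha_0),\mathcal{T}_n(\alpha_0),\mathcal{T}(\alpha_0)$ in which $\epsilon_n$ is symmetric positive definite and $P_{\alpha_0,n}(\mathcal{T}_n(\alpha_0)\text{ is positive definite})=1$ for every $n$, and $\mathcal{T}(\alpha_0)$ is positive definite almost surely. *)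

(* Defs.v *)
From HB Require Import structures.
From mathcomp Require Import all_boot all_order all_algebra.
From mathcomp Require Import all_classical all_reals all_analysis.
From mathcomp Require Import measurable_realfun.

Set Implicit Arguments.
Unset Strict Implicit.
Unset Printing Implicit Defensive.

Import Order.TTheory GRing.Theory Num.Theory.
Import numFieldNormedType.Exports.

Local Open Scope classical_set_scope.
Local Open Scope ring_scope.

#[short(type="completeMetricType")]
HB.structure Definition CompleteMetric (R : numDomainType) :=
  {T of Metric R T & CompletePseudoMetric R T}.

Definition separable (T : topologicalType) :=
  exists2 D : set T, countable D & dense D.

Notation borel T := (g_sigma_algebraType (@open T)).

Section linear_algebra.
Context {R : realType} {d : nat}.

(* The library's norm on matrices is the sup norm. *)
Definition enorm (x : 'cV[R]_d) : R := Num.sqrt (\sum_i x i 0 ^+ 2).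

Definition op_norm (A : 'M[R]_d) : R :=
  sup [set enorm (A *m x) | x in [set x | enorm x <= 1]].

Definition dotv (x y : 'cV[R]_d) : R := (x^T *m y) 0 0.

Definition symmetric_mx (A : 'M[R]_d) := A^T = A.
Definition nonneg_def (A : 'M[R]_d) := forall x, 0 <= dotv x (A *m x).
Definition pos_def (A : 'M[R]_d) := forall x, x != 0 -> 0 < dotv x (A *m x).

(* A^{1/2}: the unique symmetric nonnegative definite square root of a
   symmetric nonnegative definite A; 0 if A has no such root. *)
Definition sqrt_mx (A : 'M[R]_d) : 'M[R]_d :=
  xget 0 [set S | [/\ symmetric_mx S, nonneg_def S & S *m S = A]].

End linear_algebra.

Section probability.
Context {R : realType}.

(* Conditional expectation given the sigma-algebra G, for functions that need
   not be integrable: for f >= 0 it is a [0, +oo]-valued G-measurable g with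
   \int_A g dP = \int_A f dP for A in G; in general it is
   E[f^+ | G] - E[f^- | G]. [xget] selects one of the a.s. equal versions. *)
Section conditional_expectation.
Context {disp} {S : measurableType disp} (P : probability S R).
Variable G : set (set S).
Local Open Scope ereal_scope.

Definition is_cond_exp_ge0 (f g : S -> \bar R) :=
  [/\ forall w, 0 <= g w,
      forall B : set (\bar R), measurable B -> G (g @^-1` B) &
      forall A, G A -> \int[P]_(w in A) g w = \int[P]_(w in A) f w].

Definition cond_exp_ge0 (f : S -> \bar R) : S -> \bar R :=
  xget (cst 0) [set g | is_cond_exp_ge0 f g].

Definition cond_exp (f : S -> \bar R) (w : S) : \bar R :=
  cond_exp_ge0 f^\+ w - cond_exp_ge0 f^\- w.

End conditional_expectation.

(* L is a density, with respect to P, of the absolutely continuous part of the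
   Lebesgue decomposition of P'. *)
Definition is_likelihood_ratio {disp} {S : measurableType disp}
    (P' P : probability S R) (L : S -> \bar R) :=
  [/\ measurable_fun [set: S] L, forall w, (0 <= L w)%E &
      exists nu : {measure set S -> \bar R},
        (exists N, [/\ measurable N, P N = 0%E & nu (~` N) = 0%E]) /\
        forall A, measurable A ->
          P' A = (\int[P]_(w in A) L w + nu A)%E].

Definition likelihood_ratio {disp} {S : measurableType disp}
    (P' P : probability S R) : S -> \bar R :=
  xget (cst 0%E) [set L | is_likelihood_ratio P' P L].

Section convergence.
Context {disp : nat -> measure_display} {S : forall n, measurableType (disp n)}.
Variable P : forall n, probability (S n) R.

Definition cvg_to0_in_prob (Z : forall n, S n -> \bar R) :=
  forall e : R, 0 < e ->
    (fun n => P n [set w | (e%:E < `|Z n w|)%E]) @ \oo --> 0%E.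

Definition cvg_in_law {E : topologicalType} (Z : forall n, S n -> E)
    {dO} {Omega : measurableType dO} (Q : probability Omega R)
    (Z0 : Omega -> E) :=
  forall f : E -> R, continuous f -> (exists M : R, forall x, `|f x| <= M) ->
    (fun n => \int[P n]_w (f (Z n w))%:E)%E @ \oo -->
      (\int[Q]_w (f (Z0 w))%:E)%E.

End convergence.

Section mixed_normal.
Context {d : nat} {dO} {Omega : measurableType dO} (Q : probability Omega R).

Definition standard_normal (W : Omega -> 'cV[R]_d) :=
  forall A : 'I_d -> set R, (forall i, measurable (A i)) ->
    Q [set w | forall i, A i (W w i 0)] =
    (\prod_(i < d) normal_prob (0 : R) 1 (A i))%E.

Definition independent_rv {E F : ptopologicalType}
    (Y : Omega -> E) (Z : Omega -> F) :=
  forall (A : set (borel E)) (B : set (borel F)), measurable A -> measurable B ->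
    Q (Y @^-1` A `&` Z @^-1` B) = (Q (Y @^-1` A) * Q (Z @^-1` B))%E.

(* W ~ N(0, I_d) is independent of T, and L(V_n, T_n | P_n) converges weakly
   to L(T^{1/2} W, T). *)
Definition mixed_normal_limit
    {disp : nat -> measure_display} {S : forall n, measurableType (disp n)}
    (P : forall n, probability (S n) R)
    (V : forall n, S n -> 'cV[R]_d) (Tn : forall n, S n -> 'M[R]_d)
    (T : Omega -> 'M[R]_d) (W : Omega -> 'cV[R]_d) :=
  [/\ measurable_fun [set: Omega] (T : Omega -> borel 'M[R]_d),
      measurable_fun [set: Omega] (W : Omega -> borel 'cV[R]_d),
      standard_normal W,
      independent_rv W T &
      cvg_in_law P (fun n w => (V n w, Tn n w)) Q
        (fun w => (sqrt_mx (T w) *m W w, T w))].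

End mixed_normal.

Section condition_L.
Context {d : nat}.
Context {disp : nat -> measure_display} {S : forall n, measurableType (disp n)}.
(* Only parameters in an open set Theta containing alpha0 are meaningful. As
   eps n --> 0, alpha0 + eps n *m h lies in Theta for all large n, and the
   condition below does not depend on the values of P outside Theta. *)
Variables (P : forall n, 'cV[R]_d -> probability (S n) R) (alpha0 : 'cV[R]_d).

(* Condition (L), for the given choice of eps_n, V_n, T_n and of the random
   matrix T (defined, together with W, on the probability space (Omega, Q)). *)
Record condition_L (eps : nat -> 'M[R]_d)
    (V : forall n, S n -> 'cV[R]_d) (Tn : forall n, S n -> 'M[R]_d)
    {dO} {Omega : measurableType dO} (Q : probability Omega R)
    (T : Omega -> 'M[R]_d) (W : Omega -> 'cV[R]_d) : Prop := {
  L_nondegenerate : forall n, eps n \in unitmx ;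
  L_eps_to0 : (fun n => op_norm (eps n)) @ \oo --> (0 : R) ;
  L_measurable_V : forall n,
    measurable_fun [set: S n] (V n : S n -> borel 'cV[R]_d) ;
  L_measurable_Tn : forall n,
    measurable_fun [set: S n] (Tn n : S n -> borel 'M[R]_d) ;
  L_symmetric_Tn : forall n w, symmetric_mx (Tn n w) ;
  L_nonneg_Tn : forall n, {ae P n alpha0, forall w, nonneg_def (Tn n w)} ;
  L_expansion : forall h : 'cV[R]_d,
    cvg_to0_in_prob (fun n => P n alpha0) (fun n w =>
      lne (likelihood_ratio (P n (alpha0 + eps n *m h)) (P n alpha0) w)
      - (dotv h (V n w))%:E + (2^-1 * dotv h (Tn n w *m h))%:E)%E ;
  L_limit_mx : {ae Q, forall w, symmetric_mx (T w) /\ nonneg_def (T w)} ;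
  L_limit : mixed_normal_limit Q (fun n => P n alpha0) V Tn T W }.

Definition LAMN : Prop :=
  exists (eps : nat -> 'M[R]_d)
    (V : forall n, S n -> 'cV[R]_d) (Tn : forall n, S n -> 'M[R]_d)
    (dO : measure_display) (Omega : measurableType dO)
    (Q : probability Omega R) (T : Omega -> 'M[R]_d) (W : Omega -> 'cV[R]_d),
  [/\ condition_L eps V Tn Q T W,
      forall n, symmetric_mx (eps n) /\ pos_def (eps n),
      forall n, {ae P n alpha0, forall w, pos_def (Tn n w)} &
      {ae Q, forall w, pos_def (T w)}].

End condition_L.

End probability.

(* The coordinates are numbered from 0, so that the coordinates before
   j : 'I_m form the past of the j-th one. For j = 0 the past is a one-point
   space and the sigma-algebra it generates is trivial; the conditional law and
   density of the 0-th coordinate are then its marginal law and density. *)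
Section product_experiment.
Context {R : realType} {m : nat} (X : 'I_m -> completeMetricType R).

Definition state := borel (prod_topology X).

Definition past_space (j : 'I_m) :=
  borel (prod_topology (fun i : {i : 'I_m | (i < j)%N} => X (val i))).

Definition past (j : 'I_m) : state -> past_space j := fun w i => w (val i).
Arguments past : clear implicits.

(* The product of the first j + 1 coordinate spaces is represented by
   past_space j * X j. As the X i are separable, the product sigma-algebra of
   the two Borel sigma-algebras is the Borel one. *)
Definition past_now (j : 'I_m) (w : state) : past_space j * borel (X j) :=
  (past j w, w j).

Definition past_algebra (j : 'I_m) : set (set state) :=
  g_sigma_algebra_preimage (past j).

Definition is_cond_law (P : probability state R) (j : 'I_m)
    (K : R.-pker (past_space j) ~> (borel (X j))) :=
  forall (A : set (past_space j)) (B : set (borel (X j))),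
    measurable A -> measurable B ->
    P [set w | A (past j w) /\ B (w j)] =
    (\int[P]_(w in past j @^-1` A) K (past j w) B)%E.

Definition is_cond_density (j : 'I_m)
    (mu : {measure set (borel (X j)) -> \bar R})
    (K : R.-pker (past_space j) ~> (borel (X j)))
    (p : past_space j * borel (X j) -> R) :=
  [/\ measurable_fun [set: past_space j * borel (X j)] p,
      forall z, 0 <= p z &
      forall x (B : set (borel (X j))), measurable B ->
        K x B = (\int[mu]_(y in B) (p (x, y))%:E)%E].

Context {d : nat}.

(* eta_j = xidot_j / sqrt p_j where p_j <> 0, and 0 elsewhere. *)
Definition score (j : 'I_m) (p : past_space j * borel (X j) -> R)
    (xidot : past_space j * borel (X j) -> 'cV[R]_d) (w : state) : 'cV[R]_d :=
  if p (past_now j w) == 0 then 0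
  else (Num.sqrt (p (past_now j w)))^-1 *: xidot (past_now j w).

Variable P : probability state R.

Definition cond_sqnorm (j : 'I_m) (eta : state -> 'cV[R]_d) : state -> \bar R :=
  cond_exp P (past_algebra j) (fun w => (enorm (eta w) ^+ 2)%:E).

(* E[eta eta^T | past], set to 0 where E[|eta|^2 | past] is infinite and the
   entries need not make sense (a null event if assumption_A2 holds, n large). *)
Definition cond_second_moment (j : 'I_m) (eta : state -> 'cV[R]_d) (w : state) :
    'M[R]_d :=
  if (cond_sqnorm j eta w < +oo)%E then
    \matrix_(i, k) fine (cond_exp P (past_algebra j)
                           (fun w' => (eta w' i 0 * eta w' k 0)%:E) w)
  else 0.

Definition information (eps : 'M[R]_d) (eta : 'I_m -> state -> 'cV[R]_d)
    (w : state) : 'M[R]_d :=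
  eps^T *m (\sum_(j < m) cond_second_moment j (eta j) w) *m eps.

Definition central_sequence (eps : 'M[R]_d) (eta : 'I_m -> state -> 'cV[R]_d)
    (w : state) : 'cV[R]_d :=
  eps^T *m \sum_(j < m) eta j w.

End product_experiment.

Arguments past {R m X} j w i : rename.
Arguments past_now {R m X} j w : rename.

Section assumptions.
Context {R : realType} {d : nat} {m : nat -> nat}.
Variable X : forall n, 'I_(m n) -> completeMetricType R.

Definition assumption_A1 (P0 : forall n, probability (state (@X n)) R)
    (mu : forall n (j : 'I_(m n)),
      {sigma_finite_measure set (borel (X j)) -> \bar R})
    (p : forall n, 'cV[R]_d ->
      forall j : 'I_(m n), past_space (@X n) j * borel (X j) -> R)
    (alpha0 : 'cV[R]_d) (eps : nat -> 'M[R]_d)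
    (xidot : forall n (j : 'I_(m n)),
      past_space (@X n) j * borel (X j) -> 'cV[R]_d) :=
  forall h : 'cV[R]_d,
    cvg_to0_in_prob P0 (fun n w =>
      \sum_(j < m n) \int[mu n j]_x
        (((Num.sqrt (p n (alpha0 + eps n *m h) j (past j w, x))
           - Num.sqrt (p n alpha0 j (past j w, x)))
          - 2^-1 * dotv h ((eps n)^T *m xidot n j (past j w, x))) ^+ 2)%:E)%E.

Variable P0 : forall n, probability (state (@X n)) R.
Variable eta : forall n, 'I_(m n) -> state (@X n) -> 'cV[R]_d.
Variable eps : nat -> 'M[R]_d.

Definition assumption_A2 :=
  exists n0, forall n, (n0 <= n)%N -> forall j : 'I_(m n),
    {ae P0 n, forall w, (cond_sqnorm (P0 n) j (eta j) w < +oo)%E} /\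
    {ae P0 n, forall w, forall i : 'I_d,
      cond_exp (P0 n) (past_algebra j) (fun w' => (eta j w' i 0)%:E) w = 0%E}.

Definition assumption_A3 :=
  forall (e : R) (h : 'cV[R]_d), 0 < e ->
    cvg_to0_in_prob P0 (fun n w =>
      \sum_(j < m n) cond_exp (P0 n) (past_algebra j) (fun w' =>
        (let y := `|dotv h ((eps n)^T *m eta j w')| in
         if e < y then y ^+ 2 else 0)%:E) w)%E.

Definition assumption_A4 {dO} {Omega : measurableType dO}
    (Q : probability Omega R) (T : Omega -> 'M[R]_d) (W : Omega -> 'cV[R]_d) :=
  [/\ forall w, symmetric_mx (T w),
      {ae Q, forall w, nonneg_def (T w)} &
      mixed_normal_limit Q P0
        (fun n => central_sequence (eps n) (@eta n))
        (fun n => information (P0 n) (eps n) (@eta n)) T W].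

End assumptions.

(* Main.v *)
From HB Require Import structures.
Require Import Defs.
From mathcomp Require Import all_boot all_order all_algebra.
From mathcomp Require Import all_classical all_reals all_analysis.
From mathcomp Require Import measurable_realfun.
From mathcomp Require Import perm ring lra.

Set Implicit Arguments.
Unset Strict Implicit.
Unset Printing Implicit Defensive.

Import Order.TTheory GRing.Theory Num.Theory.
Import numFieldNormedType.Exports.

Local Open Scope classical_set_scope.
Local Open Scope ring_scope.

(** Fix [h], write [q_j] and [p_j] for the conditional densities at
    [alpha0 + eps n *m h] and at [alpha0], and let
    [z_j = sqrt q_j / sqrt p_j - 1] and [y_j = h^T eps^T eta_j / 2], both set
    to 0 where [p_j = 0]. Since conditional densities multiply, the likelihood
    ratio is, almost surely, the product of the [(1 + z_j)^2], so its logarithm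
    is the sum of [2 ln (1 + z_j) = 2 z_j - z_j^2 + O(z_j^3)]. The sum of the
    [2 y_j] is [h^T V_n], the sum of the conditional means of the [2 y_j^2] is
    [h^T T_n h / 2], and what has to be shown is that passing from [z_j] to
    [y_j] leaves exactly these two terms.

    Put [D_j = z_j - y_j]. Assumption [assumption_A1] says that the conditional second
    moments of the [D_j] add up to something small. Two inequalities for
    sequential experiments, obtained by stopping at the first time at which the
    predictable sum becomes large ([lenglart], [martingale_tail]), turn this
    into statements about the [D_j] themselves: the sum of the [D_j^2] is small,
    and the sum of the [D_j] is close to the sum of their conditional means
    [e_j]. These means do not vanish, and they are what doubles the quadratic
    term. As [q_j] integrates to 1, [2 E z_j + E z_j^2] is minus the mass [s_j]
    that [q_j] puts where [p_j = 0]; as [E y_j = 0], this gives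
    [2 e_j = - E y_j^2] up to [s_j] and to [E z_j^2 - E y_j^2]
    ([drift_le]). The mass [s_j] is controlled by using [assumption_A1] at [h] and at
    [- h]: where [p_j = 0], nonnegative roots approximate both a function and
    its opposite, hence are small ([singular_part_le]).

    The Lindeberg condition [assumption_A3], together with the tightness of [T_n] that
    [assumption_A4] provides, shows that the sum of the [y_j^2] is close to the sum of
    their conditional means and that the [z_j] are uniformly small, so that the
    logarithm may be expanded ([log_ratio_expansion],
    [log_likelihood_expansion]).

    Throughout, conditional expectations given the past are computed as
    integrals against the conditional laws, which represent them almost surely
    ([cond_exp_kernel]).

    For the LAMN property, [T_n] may fail to be invertible on a small event.
    Replacing it there by the identity makes it positive definite; convergence
    in law to a matrix with nonzero determinant makes the probability of that
    event tend to 0 ([det_eq0_small]), and this changes neither the expansion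
    nor the limit law ([cvg_in_law_modification]). *)

(** * Borel measurability in separable products and matrix spaces *)

Lemma measurable_fun_generator d (S : measurableType d) (T : pointedType)
    (O : set (set T)) (f : S -> g_sigma_algebraType O) :
  (forall U : set T, O U -> measurable (f @^-1` U)) ->
  measurable_fun [set: S] f.
Proof.
move=> fU.
apply: (@measurability _ _ _ (g_sigma_algebraType O) _ _ O) => // _ [U oU <-].
by rewrite setTI; exact: fU.
Qed.

(** Second countability is what makes coordinatewise measurability enough. The
    coordinates range over separable spaces, so every open set of the target is
    a countable union of boxes of balls with centres in the dense sets and radii
    [1 / k.+1], and the preimage of each box is a finite intersection. *)
Lemma measurable_fun_coords d (S : measurableType d) (R : realType)
    (T : pointedType) (O : set (set T)) (I : finType)
    (X : I -> pseudoMetricType R) (pi : forall i, T -> X i)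
    (f : S -> g_sigma_algebraType O) :
  (forall i, separable (X i)) ->
  (forall U, O U -> forall x, U x -> exists2 r : R, 0 < r &
     forall z, (forall i, ball (pi i x) r (pi i z)) -> U z) ->
  (forall i (V : set (X i)), open V -> measurable [set w | V (pi i (f w))]) ->
  measurable_fun [set: S] f.
Proof.
move=> sepX basis mf; apply: measurable_fun_generator => U oU.
have [D Dc Dd] : exists2 D : forall i, set (X i),
    forall i, countable (D i) & forall i, dense (D i).
  have h i : exists D : set (X i), countable D /\ dense D.
    by have [E] := sepX i; exists E.
  exists (fun i => sval (cid (h i))) => i; by have [] := svalP (cid (h i)).
(* Codes by natural numbers of the points of the dense sets. *)
have [e einj] : exists e : forall i, X i -> nat,
    forall i, {in D i &, injective (e i)}.
  have h i := countable_injP _ (Dc i).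
  exists (fun i => sval (cid (h i))) => i; exact: svalP (cid (h i)).
(* The code [c] stands for the ball with centre coded by [c.1] and radius [1 / c.2.+1]. *)
pose V i (c : nat * nat) := \bigcup_(y in [set y | D i y /\ e i y = c.1])
  (ball y (c.2.+1%:R^-1 : R))°.
have oV i c : open (V i c) by apply: bigcup_open => y _; exact: open_interior.
pose C (c : {ffun I -> nat * nat}) := [set z : T | forall i, V i (c i) (pi i z)].
have -> : f @^-1` U = \bigcup_(c in [set c | C c `<=` U]) (f @^-1` (C c)).
  rewrite -preimage_bigcup; congr (_ @^-1` _); apply/seteqP; split; last first.
    by move=> z [c /=]; apply.
  move=> x Ux; have [r r0 rU] := basis _ oU _ Ux.
  have [k kr] : exists k : nat, (k.+1%:R^-1 : R) < r / 2.
    have r20 : 0 < r / 2 by rewrite divr_gt0.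
    by have [k _ h] := near_infty_natSinv_lt (PosNum r20); exists k; apply: h => /=.
  pose ek : R := k.+1%:R^-1; have ek0 : 0 < ek by rewrite invr_gt0.
  have ek20 : 0 < ek / 2 by rewrite divr_gt0.
  (* A centre at distance less than [ek / 2], so that the ball of radius [ek] around it
     contains the point and lies in the ball of radius [r]. *)
  have h i : exists y, D i y /\ ball y (ek / 2) (pi i x).
    have [y [/interior_subset By Dy]] := Dd i (ball (pi i x) (ek / 2))°
      (ex_intro _ (pi i x) (nbhsx_ballx _ _ ek20)) (@open_interior _ _).
    by exists y; split => //; exact: ball_sym.
  pose y i := sval (cid (h i)).
  have Dy i : D i (y i) by have [] := svalP (cid (h i)).
  have By i : ball (y i) (ek / 2) (pi i x) by have [] := svalP (cid (h i)).
  exists [ffun i => (e i (y i), k)] => /=.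
    move=> z Cz; apply: rU => i; have := Cz i; rewrite ffunE => -[y' [/= Dy' ey']].
    have -> : y' = y i by apply: (einj i) => //; exact: mem_set.
    move/interior_subset => yz.
    apply: (le_ball (ltW _) (ball_triangle (ball_sym (By i)) yz)).
    rewrite -/ek; move: kr ek0; rewrite -/ek => kr ek0; lra.
  move=> i; rewrite ffunE; exists (y i) => //=.
  rewrite /interior -nbhs_ballE; exists (ek / 2) => //= z xz.
  by rewrite -/ek (splitr ek); exact: ball_triangle xz.
rewrite bigcup_mkcond; apply: countable_bigcupT_measurable => // c.
case: ifPn => // _.
have -> : f @^-1` C c = \bigcap_(i in [set: I]) [set w | V i (c i) (pi i (f w))].
  by apply/seteqP; split=> w /= h i => [_|]; apply: h.
by apply: fin_bigcap_measurable => // i _; exact: mf.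
Qed.

Lemma separable_real (R : realType) : separable R.
Proof.
exists (range (@ratr R)); last exact: dense_rat.
apply: (card_le_trans (card_image_le _ _)); exact: countableP.
Qed.

Lemma measurable_continuous_comp d (S : measurableType d)
    (T U : ptopologicalType) (f : S -> borel T) (g : T -> U) :
  continuous g -> measurable_fun [set: S] f ->
  measurable_fun [set: S] ((g \o f) : S -> borel U).
Proof.
move=> cg mf; apply: measurable_fun_generator => V oV.
rewrite -[X in measurable X]setTI; apply: (mf measurableT (g @^-1` V)).
by apply: sub_sigma_algebra; move/continuousP: cg; exact.
Qed.

Lemma measurable_fun_borelR d (S : measurableType d) (R : realType) (f : S -> R) :
  measurable_fun [set: S] (f : S -> borel R) <-> measurable_fun [set: S] f.
Proof.
split=> mf.
  apply: (measurability _ (RGenOpens.measurableE R)) => _ [_ [a [b ->] <-]].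
  apply: (mf measurableT); apply: sub_sigma_algebra => /=.
  exact: interval_open.
apply: measurable_fun_generator => U oU.
by rewrite -[X in measurable X]setTI; apply: mf => //; exact: open_measurable.
Qed.

(** The neighbourhoods that contain a box of balls around [x] form a filter
    finer than each of the coordinate filters, hence finer than that of the
    product topology, which is their supremum. *)
Lemma prod_topology_basis (R : realType) (I : finType)
    (X : I -> pseudoMetricType R) (U : set (prod_topology X)) : open U ->
  forall x, U x -> exists2 r : R, 0 < r &
     forall z : prod_topology X, (forall i, ball (x i) r (z i)) -> U z.
Proof.
move=> oU x Ux.
pose F : set_system (prod_topology X) := [set A | exists2 r : R, 0 < r &
  forall z : prod_topology X, (forall i, ball (x i) r (z i)) -> A z].
have FF : Filter F.
  split.
  - by exists 1.
  - move=> A B [r r0 rA] [s s0 sB]; exists (Num.min r s).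
      by rewrite lt_min r0 s0.
    move=> z xz; split.
      by apply: rA => i; apply: le_ball (xz i); rewrite ge_min lexx.
    by apply: sB => i; apply: le_ball (xz i); rewrite ge_min lexx orbT.
  - by move=> A B AB [r r0 rA]; exists r => // z /rA /AB.
suff : F --> (x : prod_topology X) by apply; exact: open_nbhs_nbhs.
apply/cvg_sup => i A.
rewrite /nbhs /= => -[B [[V oV <-] Vx] BA].
move: Vx => /= Vx.
have : nbhs (x i) V by exact: open_nbhs_nbhs.
rewrite -nbhs_ballE => -[r r0 rV]; exists r => // z xz.
by apply: BA => /=; apply: rV; exact: xz.
Qed.

Lemma measurable_fun_prod_topology d (S : measurableType d) (R : realType)
    (I : finType) (X : I -> completeMetricType R)
    (f : S -> borel (prod_topology X)) :
  (forall i, separable (X i)) ->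
  (forall i, measurable_fun [set: S] (fun w => f w i : borel (X i))) ->
  measurable_fun [set: S] f.
Proof.
move=> sepX mf.
apply: (@measurable_fun_coords _ S R (prod_topology X) _ I X (fun i x => x i)) => //.
  by move=> U oU x Ux; exact: prod_topology_basis.
move=> i V oV; rewrite -[X in measurable X]setTI; apply: (mf i measurableT V).
exact: sub_sigma_algebra.
Qed.

Lemma measurable_proj_topology (R : realType) (I : finType)
    (X : I -> completeMetricType R) (i : I) :
  measurable_fun [set: borel (prod_topology X)]
    (fun x : borel (prod_topology X) => x i : borel (X i)).
Proof.
apply: measurable_fun_generator => U oU; apply: sub_sigma_algebra.
exact: ((@continuousP (prod_topology X) (X i) _).1 (@proj_continuous I X i)).
Qed.

Lemma mx_coord_continuous (R : realType) m n (i : 'I_m) (j : 'I_n) :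
  continuous (fun M : 'M[R]_(m, n) => M i j).
Proof.
move=> M A /= MA.
exists (fun i' j' => [set x | (i', j') = (i, j) -> A x]) => /=.
  move=> i' j'; have [[-> ->]|ne] := eqVneq (i', j') (i, j).
    by apply: filterS MA => x Ax _.
  by apply: filterS filterT => x _ /= /eqP; rewrite (negbTE ne).
by move=> N /(_ i j); exact.
Qed.

Lemma measurable_fun_mx d (S : measurableType d) (R : realType) m n
    (f : S -> borel 'M[R]_(m, n)) :
  measurable_fun [set: S] f <->
  (forall i j, measurable_fun [set: S] (fun w => f w i j : R)).
Proof.
split=> [mf i j|mf].
  by apply/measurable_fun_borelR; apply: (measurable_continuous_comp
    (@mx_coord_continuous R m n i j) mf).
apply: (@measurable_fun_coords _ S R 'M[R]_(m, n) _ ('I_m * 'I_n)%type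
   (fun=> R) (fun p M => M p.1 p.2)).
- by move=> i; exact: separable_real.
- move=> U oU M UM; have : nbhs M U by exact: open_nbhs_nbhs.
  rewrite -nbhs_ballE => -[r r0 rU]; exists r => // N MN; apply: rU.
  by split => // i j; exact: (MN (i, j)).
- move=> [i j] V oV; rewrite -[X in measurable X]setTI; apply: mf => //.
  exact: open_measurable.
Qed.

Lemma measurable_fun_mx_pair d (S : measurableType d) (R : realType) m n p q
    (f : S -> borel 'M[R]_(m, n)) (g : S -> borel 'M[R]_(p, q)) :
  measurable_fun [set: S] f -> measurable_fun [set: S] g ->
  measurable_fun [set: S]
    (fun w => (f w, g w) : borel ('M[R]_(m, n) * 'M[R]_(p, q))%type).
Proof.
move=> /measurable_fun_mx mf /measurable_fun_mx mg.
apply: (@measurable_fun_coords _ S R ('M[R]_(m, n) * 'M[R]_(p, q))%type _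
   ('I_m * 'I_n + 'I_p * 'I_q)%type (fun=> R)
   (fun k M => match k with inl i => M.1 i.1 i.2 | inr i => M.2 i.1 i.2 end)).
- by move=> i; exact: separable_real.
- move=> U oU M UM; have : nbhs M U by exact: open_nbhs_nbhs.
  rewrite -nbhs_ballE => -[r r0 rU]; exists r => // N MN; apply: rU.
  by split; split => // i j; [exact: (MN (inl (i, j)))|exact: (MN (inr (i, j)))].
- move=> [[i j]|[i j]] V oV; rewrite -[X in measurable X]setTI.
    by apply: mf => //; exact: open_measurable.
  by apply: mg => //; exact: open_measurable.
Qed.

Lemma measurable_continuous_mx_pair dS (S : measurableType dS) (R : realType) m n k q
    (v : S -> 'M[R]_(m, n)) (A : S -> 'M[R]_(k, q))
    (f : 'M[R]_(m, n) * 'M[R]_(k, q) -> R) : continuous f ->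
  measurable_fun [set: S] (v : S -> borel 'M[R]_(m, n)) ->
  measurable_fun [set: S] (A : S -> borel 'M[R]_(k, q)) ->
  measurable_fun [set: S] (fun w => f (v w, A w)).
Proof.
move=> cf mv mA; apply/measurable_fun_borelR.
apply: measurable_fun_generator => U oU.
have := measurable_fun_mx_pair mv mA.
move=> /(_ measurableT (f @^-1` U)); rewrite setTI; apply.
by apply: sub_sigma_algebra; move/continuousP : cf; exact.
Qed.

(** * Densities and disintegration *)

Section density.
Context d (Y : measurableType d) (R : realType).
Local Open Scope ereal_scope.

(** The density is almost everywhere equal to the Radon-Nikodym derivative,
    for which the formula is known for sigma-finite measures. *)
Lemma integral_density (nu : {measure set Y -> \bar R})
    (mu : {sigma_finite_measure set Y -> \bar R}) (p : Y -> R) :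
  nu [set: Y] < +oo -> nu `<< mu ->
  measurable_fun [set: Y] p -> (forall y, (0 <= p y)%R) ->
  (forall B, measurable B -> nu B = \int[mu]_(y in B) (p y)%:E) ->
  forall f : Y -> \bar R, measurable_fun [set: Y] f -> (forall y, 0 <= f y) ->
  \int[nu]_y f y = \int[mu]_y (f y * (p y)%:E).
Proof.
move=> nuoo numu mp p0 nuE f mf f0.
pose nu' : {finite_measure set Y -> \bar R} := mfrestr measurableT nuoo.
have nu'E B : nu' B = nu B by rewrite /nu'/= /mfrestr /mrestr setIT.
have -> : \int[nu]_y f y = \int[nu']_y f y.
  by apply: eq_measure_integral => B mB _; exact/esym/nu'E.
have numu' : nu' `<< mu.
  by move=> A /numu nA B h1 h2; exact: (etrans (nu'E B) (nA B h1 h2)).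
rewrite -[LHS](@Radon_Nikodym_SigmaFinite.change_of_variables _ _ _ nu' mu numu' f setT)//.
pose g := Radon_Nikodym_SigmaFinite.f nu' mu.
have gint : mu.-integrable setT g by exact: Radon_Nikodym_SigmaFinite.f_integrable.
have mg := measurable_int mu gint.
have gp : ae_eq mu setT g (EFin \o p).
  apply: integral_ae_eq => //; first exact/measurable_EFinP.
  move=> E _ mE; rewrite -(Radon_Nikodym_SigmaFinite.f_integral numu' mE).
  by rewrite nu'E; exact: nuE.
apply: ge0_ae_eq_integral => //.
- exact: emeasurable_funM.
- by apply: emeasurable_funM => //; exact/measurable_EFinP.
- by move=> y _; rewrite mule_ge0// Radon_Nikodym_SigmaFinite.f_ge0.
- by move=> y _; rewrite mule_ge0// lee_fin.
- by apply: filterS gp => y /(_ Logic.I) h _; rewrite -/g h.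
Qed.

End density.

Section disintegration.
Context dS dU dY (S : measurableType dS) (U : measurableType dU)
  (Y : measurableType dY) (R : realType).
Variables (P : probability S R) (u : S -> U) (y : S -> Y) (K : R.-pker U ~> Y).
Hypotheses (mu : measurable_fun [set: S] u) (my : measurable_fun [set: S] y).
Local Open Scope ereal_scope.

Lemma measurable_integral_kernel (f : U * Y -> \bar R) :
  measurable_fun [set: U * Y] f -> (forall z, 0 <= f z) ->
  measurable_fun [set: U] (fun x => \int[K x]_v f (x, v)).
Proof. by move=> mf f0; exact: measurable_fun_integral_finite_kernel. Qed.

Let mpairl (x : U) : measurable_fun [set: Y] (fun v : Y => (x, v)).
Proof. exact: measurable_pair1. Qed.

(** The point mass at [u z.2] times [K (u z.2)], with a dummy argument: in this
    form the composition of kernels with [l], the constant kernel [P], is the law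
    with mass [A, B |-> int_A K (u w) B dP] on rectangles. *)
Let k (z : unit * S) : {measure set (U * Y) -> \bar R} :=
  measure_function_pushforward__canonical__measure_function_Measure
    (K (u z.2)) (mpairl (u z.2)).

Let mk V : measurable V -> measurable_fun [set: unit * S] (k ^~ V).
Proof.
move=> mV.
have -> : k ^~ V = (fun x => K x (xsection V x)) \o (u \o snd).
  by apply/funext => z; rewrite /k /pushforward/= xsectionE.
apply: measurableT_comp; last exact: measurableT_comp.
by apply: measurable_fun_xsection_finite_kernel; rewrite inE.
Qed.

HB.instance Definition _ := isKernel.Build _ _ _ _ _ k mk.

Let k1 z : k z [set: U * Y] = 1.
Proof. exact: (@prob_kernel _ _ _ _ _ K (u z.2)). Qed.

HB.instance Definition _ := Kernel_isProbability.Build _ _ _ _ _ k k1.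

Let l := kprobability (measurable_cst (P : pprobability S R) (D := [set: unit])).

(** The joint law of [(u, y)] agrees with the composed kernel on rectangles,
    which generate the product sigma-algebra and are stable under
    intersection. *)
Lemma disintegration :
  (forall A B, measurable A -> measurable B ->
    P [set w | A (u w) /\ B (y w)] = \int[P]_(w in u @^-1` A) K (u w) B) ->
  forall f : U * Y -> \bar R,
    measurable_fun [set: U * Y] f -> (forall z, 0 <= f z) ->
  \int[P]_w f (u w, y w) = \int[P]_w \int[K (u w)]_v f (u w, v).
Proof.
move=> PK f mf f0.
have muy : measurable_fun [set: S] (fun w => (u w, y w)).
  exact: measurable_fun_pair.
transitivity (\int[kcomp l k tt]_z f z); last first.
  rewrite integral_kcomp//; apply: eq_integral => w _.
  by rewrite /k ge0_integral_pushforward.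
transitivity (\int[pushforward P (fun w => (u w, y w))]_z f z).
  by rewrite ge0_integral_pushforward.
apply: eq_measure_integral => V mV _.
pose C : set (set (U * Y)) :=
  [set C | exists2 A, measurable A & exists2 B, measurable B & A `*` B = C].
apply: (measure_unique C (fun=> setT)) => //.
- by rewrite measurable_prod_measurableType.
- move=> _ _ [A mA [B mB <-]] [A' mA' [B' mB' <-]].
  exists (A `&` A'); first exact: measurableI.
  by exists (B `&` B'); [exact: measurableI|rewrite setXI].
- by move=> _; exists setT => //; exists setT => //; rewrite setXTT.
- exact: bigcup_const.
- move=> _ [A mA [B mB <-]]; rewrite /= /kcomp/= /pushforward/=.
  transitivity (P [set w | A (u w) /\ B (y w)]) => //.
  rewrite PK// integral_mkcond/=; apply: eq_integral => w _.
  rewrite /k /pushforward/= patchE.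
  case: ifPn => [|]; rewrite ?inE ?notin_setE/= => uA.
    by congr (K _ _); apply/seteqP; split => v //= -[].
  by rewrite (_ : _ @^-1` _ = set0) ?measure0//; apply/seteqP; split => v //= -[].
- by move=> _; rewrite /= /pushforward/= preimage_setT probability_setT ltry.
Qed.

End disintegration.

(** * Conditional expectations as integrals against conditional laws *)

Section conditional_expectation_kernel.
Context dS dU dY (S : measurableType dS) (U : measurableType dU)
  (Y : measurableType dY) (R : realType).
Variables (P : probability S R) (u : S -> U) (y : S -> Y) (K : R.-pker U ~> Y).
Hypotheses (mu : measurable_fun [set: S] u) (my : measurable_fun [set: S] y).
Local Open Scope ereal_scope.

Let G := preimage_set_system [set: S] u (@measurable _ U).

Let GS A : G A -> measurable A.
Proof. by move=> [B mB <-]; exact: mu. Qed.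

Let G_measurable (g : S -> \bar R) :
  (forall B : set (\bar R), measurable B -> G (g @^-1` B)) ->
  measurable_fun [set: g_sigma_algebra_preimageType u] g.
Proof. by move=> mg _ B mB; rewrite setTI; exact: mg. Qed.

Lemma is_cond_exp_measurable (f g : S -> \bar R) : is_cond_exp_ge0 P G f g ->
  measurable_fun [set: S] g.
Proof. by move=> [_ mg _] _ B mB; rewrite setTI; exact/GS/mg. Qed.

(** On the event where [g1 < g2] and [g1 <= n], which belongs to [G], both
    integrals are equal and finite, so the event is null; the bound by [n] is
    there because [f] need not be integrable. *)
Let cond_exp_ge0_le (f g1 g2 : S -> \bar R) :
  is_cond_exp_ge0 P G f g1 -> is_cond_exp_ge0 P G f g2 ->
  {ae P, forall w, g2 w <= g1 w}.
Proof.
move=> c1 c2; have mg1 := is_cond_exp_measurable c1.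
have mg2 := is_cond_exp_measurable c2.
case: c1 c2 => [g10 Gg1 ig1] [g20 Gg2 ig2].
pose A n := [set w | g1 w < g2 w] `&` [set w | g1 w <= n%:R%:E].
have GA n : G (A n).
  have h1 := G_measurable Gg1; have h2 := G_measurable Gg2.
  have := @measurableI _ (g_sigma_algebra_preimageType u)
    [set w | g1 w < g2 w] [set w | g1 w <= n%:R%:E]; apply.
    have := measurable_lte measurableT h1 h2.
    by rewrite setTI.
  have := measurable_lee measurableT h1 (measurable_cst (D := [set: g_sigma_algebra_preimageType u]) (n%:R%:E : \bar R)).
  by rewrite setTI.
have PA0 n : P (A n) = 0.
  have mA := GS (GA n).
  have eqI : \int[P]_(w in A n) g1 w = \int[P]_(w in A n) g2 w.
    by rewrite (ig1 _ (GA n)) (ig2 _ (GA n)).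
  have fin1 : \int[P]_(w in A n) g1 w < +oo.
    apply: (@le_lt_trans _ _ (\int[P]_(w in A n) n%:R%:E)).
      apply: ge0_le_integral => //; first exact: measurable_funTS.
      by move=> w [].
    rewrite integral_cst// lte_mul_pinfty ?lee_fin//.
    by rewrite (le_lt_trans (probability_le1 P mA))// ltry.
  have d0 w : A n w -> 0 <= g2 w - g1 w.
    by move=> [/= lt12 _]; rewrite leeBrDr ?add0e ?ltW// ge0_fin_numE//; exact: lt_le_trans lt12 (leey _).
  have md : measurable_fun (A n) (fun w => g2 w - g1 w).
    by apply: emeasurable_funB; exact: measurable_funTS.
  have I0 : \int[P]_(w in A n) (g2 w - g1 w) = 0.
    have : \int[P]_(w in A n) g2 w =
        \int[P]_(w in A n) g1 w + \int[P]_(w in A n) (g2 w - g1 w).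
      rewrite -ge0_integralD//; last exact: measurable_funTS.
      apply: eq_integral => w /[!inE] -[/= lt12 len].
      rewrite addeC subeK// ge0_fin_numE//; exact: lt_le_trans lt12 (leey _).
    have fin1' : \int[P]_(w in A n) g1 w \is a fin_num.
      by rewrite ge0_fin_numE// integral_ge0.
    rewrite -eqI => /(congr1 (fun x => x - \int[P]_(w in A n) g1 w)).
    by rewrite subee// [X in X - _]addeC addeK.
  have [+ _] := ae_eq_integral_abs P mA md.
  rewrite (eq_integral (fun w => g2 w - g1 w)); last first.
    by move=> w /[!inE] Aw; rewrite gee0_abs// d0.
  move=> /(_ I0) [N [mN N0 subN]].
  apply/eqP; rewrite -measure_le0 -N0; apply: le_measure; rewrite ?inE//.
  move=> w Aw; apply: subN => /= /(_ Aw) h.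
  by case: Aw => /= + _; rewrite -sube_gt0 h ltxx.
apply: (@negligibleS _ _ _ _ (\bigcup_n A n)); last first.
  by apply: negligible_bigcup => n; apply/negligibleP; [exact: GS|exact: PA0].
move=> w /= /negP; rewrite -ltNge => lt12.
  have g1fin : g1 w \is a fin_num by rewrite ge0_fin_numE//; exact: lt_le_trans lt12 (leey _).
  exists (Num.bound (fine (g1 w))) => //; split => //=.
  rewrite -(fineK g1fin) lee_fin ltW//.
  apply: archi_boundP; exact: fine_ge0.
Qed.

Lemma cond_exp_ge0_unique (f g1 g2 : S -> \bar R) :
  is_cond_exp_ge0 P G f g1 -> is_cond_exp_ge0 P G f g2 ->
  {ae P, forall w, g1 w = g2 w}.
Proof.
move=> c1 c2; have := cond_exp_ge0_le c1 c2; have := cond_exp_ge0_le c2 c1.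
by apply: filterS2 => w h1 h2; apply/eqP; rewrite eq_le h1 h2.
Qed.

Hypothesis PK : forall A B, measurable A -> measurable B ->
  P [set w | A (u w) /\ B (y w)] = \int[P]_(w in u @^-1` A) K (u w) B.

(** Disintegrate [f] times the indicator of the event of the past on which the
    integral is taken. *)
Lemma is_cond_exp_kernel (f : U * Y -> \bar R) :
  measurable_fun [set: U * Y] f -> (forall z, 0 <= f z) ->
  is_cond_exp_ge0 P G (fun w => f (u w, y w))
    (fun w => \int[K (u w)]_v f (u w, v)).
Proof.
move=> mf f0; have mKf := measurable_integral_kernel K mf f0.
split.
- by move=> w; exact: integral_ge0.
- move=> B mB; exists ((fun x => \int[K x]_v f (x, v)) @^-1` B).
    by rewrite -[X in measurable X]setTI; exact: mKf.
  by rewrite setTI.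
- move=> _ [A mA <-]; rewrite setTI.
  rewrite integral_mkcond [RHS]integral_mkcond.
  pose fA (z : U * Y) := (\1_A z.1)%:E * f z.
  have mfA : measurable_fun [set: U * Y] fA.
    apply: emeasurable_funM => //; apply/measurable_EFinP.
    by apply: measurableT_comp => //; exact: measurable_indic.
  have fA0 z : 0 <= fA z by rewrite mule_ge0// lee_fin.
  transitivity (\int[P]_w \int[K (u w)]_v fA (u w, v)); last first.
    rewrite -(disintegration mu my PK mfA fA0).
    apply: eq_integral => w _; rewrite patchE /fA/= indicE.
    by rewrite /preimage/= -[w \in _]/(u w \in A); case: ifP => _; rewrite ?mul1e ?mul0e.
  apply: eq_integral => w _; rewrite patchE /fA/= indicE.
  rewrite -[w \in _]/(u w \in A); case: ifP => _.
    by apply: eq_integral => v _; rewrite mul1e.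
  by rewrite integral0_eq// => v _; rewrite mul0e.
Qed.

Lemma cond_exp_kernel (f : U * Y -> \bar R) : measurable_fun [set: U * Y] f ->
  {ae P, forall w, cond_exp P G (fun w => f (u w, y w)) w =
    \int[K (u w)]_v f (u w, v)}.
Proof.
move=> mf.
have ce0 (g : U * Y -> \bar R) : measurable_fun [set: U * Y] g ->
    (forall z, 0 <= g z) ->
    {ae P, forall w, cond_exp_ge0 P G (fun w => g (u w, y w)) w =
      \int[K (u w)]_v g (u w, v)}.
  move=> mg g0; have c := is_cond_exp_kernel mg g0.
  apply: (cond_exp_ge0_unique _ c).
  exact: (xgetPex (cst 0) (ex_intro _ _ c)).
have := ce0 _ (measurable_funepos mf) (fun=> funepos_ge0 _ _).
have := ce0 _ (measurable_funeneg mf) (fun=> funeneg_ge0 _ _).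
apply: filterS2 => w hn hp; rewrite [RHS]integralE.
rewrite /cond_exp; congr (_ - _).
  rewrite (_ : (fun w => _)^\+ = (fun w => f^\+ (u w, y w))); last first.
    by apply/funext => w'; rewrite !funeposE.
  by rewrite hp; apply: eq_integral => v _; rewrite !funeposE.
rewrite (_ : (fun w => _)^\- = (fun w => f^\- (u w, y w))); last first.
  by apply/funext => w'; rewrite !funenegE.
by rewrite hn; apply: eq_integral => v _; rewrite !funenegE.
Qed.

Lemma measurable_cond_exp (f : S -> \bar R) :
  measurable_fun [set: S] (cond_exp P G f).
Proof.
have h (g : S -> \bar R) : measurable_fun [set: S] (cond_exp_ge0 P G g).
  rewrite /cond_exp_ge0; case: xgetP => [h _ ch|_]; last exact: measurable_cst.
  exact: is_cond_exp_measurable ch.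
by apply: emeasurable_funB; exact: h.
Qed.

End conditional_expectation_kernel.

(** * Stopped sums and tail inequalities *)

Section real_square_expansion.
Context d (Y : measurableType d) (R : realType) (k : {measure set Y -> \bar R}).
Hypothesis k1 : k [set: Y] = 1%E.
Local Open Scope ereal_scope.

Lemma integrable_cst_prob (c : R) : k.-integrable [set: Y] (fun=> c%:E).
Proof.
apply/integrableP; split; first exact: measurable_cst.
by rewrite integral_cst// k1 mule1 ltry.
Qed.

Lemma integral_cst_prob (c : \bar R) : \int[k]_y c = c.
Proof. by rewrite integral_cst// k1 mule1. Qed.

Lemma square_integrable (f : Y -> R) : measurable_fun [set: Y] f ->
  \int[k]_y ((f y) ^+ 2)%:E < +oo -> k.-integrable [set: Y] (EFin \o f).
Proof.
move=> mf foo.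
have mf2 : measurable_fun [set: Y] (fun y => (f y ^+ 2)%R).
  exact: measurable_funX.
apply: (@le_integrable _ _ _ k _ measurableT _ (fun y => (1 + f y ^+ 2)%:E)).
- exact/measurable_EFinP.
- move=> y _ /=; rewrite lee_fin [leRHS]ger0_norm ?addr_ge0 ?sqr_ge0//.
  rewrite -(real_normK (num_real (f y))).
  by have := sqr_ge0 (`|f y| - 1)%R; have := sqr_ge0 `|f y|%R; nra.
- rewrite (_ : (fun y => _) = (fun=> 1%:E) \+ (fun y => (f y ^+ 2)%:E))//.
  apply: (integrableD measurableT (integrable_cst_prob 1)).
  apply/integrableP; split; first exact/measurable_EFinP.
  by under eq_integral do rewrite /= ger0_norm ?sqr_ge0//.
Qed.

Lemma integral_fine (f : Y -> R) : k.-integrable [set: Y] (EFin \o f) ->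
  \int[k]_y (f y)%:E = (fine (\int[k]_y (f y)%:E))%:E.
Proof. by move=> fi; rewrite fineK//; exact: integrable_fin_num fi. Qed.

(** The one-step computation behind the variance of a martingale: expand the
    square, [s] being the part that is already known. *)
Lemma integral_sqr_shift (f : Y -> R) (s : R) : measurable_fun [set: Y] f ->
  \int[k]_y ((f y) ^+ 2)%:E < +oo ->
  \int[k]_y ((s + f y) ^+ 2)%:E =
  (s ^+ 2 + 2 * s * fine (\int[k]_y (f y)%:E))%:E + \int[k]_y ((f y) ^+ 2)%:E.
Proof.
move=> mf foo; have fi := square_integrable mf foo.
have f2i : k.-integrable setT (fun y => (f y ^+ 2)%:E).
  apply/integrableP; split; first by apply/measurable_EFinP; exact: measurable_funX.
  by under eq_integral do rewrite /= ger0_norm ?sqr_ge0//.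
have i1 : k.-integrable setT (fun y => (2 * s)%:E * (f y)%:E).
  exact: (integrableZl measurableT (2 * s) fi).
transitivity (\int[k]_y (((s ^+ 2)%:E + (2 * s)%:E * (f y)%:E) + (f y ^+ 2)%:E)).
  by apply: eq_integral => y _; rewrite -EFinM -!EFinD; congr (_%:E); ring.
rewrite integralD//; last exact: (integrableD measurableT (integrable_cst_prob _) i1).
congr (_ + _); rewrite integralD//; last exact: integrable_cst_prob.
by rewrite integral_cst_prob integralZl// integral_fine.
Qed.

End real_square_expansion.

Lemma sum_ord_ltS (V : nmodType) (m : nat) (F : 'I_m -> V) (j : 'I_m) :
  \sum_(i < m | (i < j.+1)%N) F i = \sum_(i < m | (i < j)%N) F i + F j.
Proof.
rewrite (bigD1 j)//= addrC; congr (_ + _); apply: eq_bigl => i.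
by rewrite ltnS ltn_neqAle andbC -val_eqE.
Qed.

Lemma sum_ord_lt_all (V : nmodType) (m : nat) (F : 'I_m -> V) :
  \sum_(i < m | (i < m)%N) F i = \sum_(i < m) F i.
Proof. by apply: eq_bigl => i; rewrite ltn_ord. Qed.

(** As the terms are nonnegative, the partial sums increase, so the retained terms
    are those before the first passage above [b], and they add up to a partial sum
    which is at most [b]. *)
Lemma stopped_sum_le (R : realType) (m : nat) (c : 'I_m -> \bar R) (b : \bar R) :
  (0 <= b)%E -> (forall i, 0 <= c i)%E ->
  (\sum_(j < m) (if \sum_(i < m | (i < j.+1)%N) c i <= b then c j else 0) <= b)%E.
Proof.
move=> b0 c0; pose g (j : 'I_m) := (if \sum_(i < m | (i < j.+1)%N) c i <= b then c j else 0)%E.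
have gc j : (g j <= c j)%E by rewrite /g; case: ifP.
suff h k : (k <= m)%N -> (\sum_(j < m | (j < k)%N) g j <= b)%E.
  by have := h m (leqnn m); rewrite sum_ord_lt_all.
elim: k => [_|k IH km]; first by rewrite big_pred0.
pose j := Ordinal km; rewrite (sum_ord_ltS g j).
rewrite {2}/g; case: ifPn => [|_]; last by rewrite adde0; exact: IH (ltnW km).
apply: le_trans; rewrite (sum_ord_ltS c j); apply: leeD => //.
exact: lee_sum.
Qed.

Section sequential_experiment.
Context dS (S : measurableType dS) (R : realType) (P : probability S R).
Context (m : nat) (dU dY : 'I_m -> measure_display)
  (U : forall j, measurableType (dU j)) (Y : forall j, measurableType (dY j)).
Variables (u : forall j, S -> U j) (y : forall j, S -> Y j).
Variable K : forall j, R.-pker U j ~> Y j.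
Hypotheses (mu : forall j, measurable_fun [set: S] (u j))
  (my : forall j, measurable_fun [set: S] (y j)).
Hypothesis PK : forall j A B, measurable A -> measurable B ->
  P [set w | A (u j w) /\ B (y j w)] = (\int[P]_(w in u j @^-1` A) K j (u j w) B)%E.
Hypothesis adapted : forall i j : 'I_m, (i < j)%N ->
  exists2 r : U j -> U i * Y i, measurable_fun [set: U j] r &
    forall w, r (u j w) = (u i w, y i w).
Arguments mu : clear implicits.
Arguments my : clear implicits.
Arguments PK : clear implicits.
Local Open Scope ereal_scope.

Let muy j : measurable_fun [set: S] (fun w => (u j w, y j w)).
Proof. exact: measurable_fun_pair. Qed.

Arguments muy : clear implicits.

(** What happened strictly before step [j] is a function of the past [u j], so
    that it can be taken out of integrals against [K j (u j w)]. *)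
Lemma past_sum_factor (j : 'I_m) (F : forall i, U i * Y i -> \bar R) :
  (forall i, measurable_fun [set: U i * Y i] (F i)) ->
  exists2 g : U j -> \bar R, measurable_fun [set: U j] g &
    forall w, g (u j w) = \sum_(i < m | (i < j)%N) F i (u i w, y i w).
Proof.
move=> mF.
have h (i : 'I_m) : exists g : U j -> \bar R, measurable_fun [set: U j] g /\
    ((i < j)%N -> forall w, g (u j w) = F i (u i w, y i w)).
  have [ij|_] := boolP (i < j)%N; last by exists (cst 0).
  have [r mr ru] := adapted ij.
  exists (F i \o r); split; first exact: measurableT_comp.
  by move=> _ w /=; rewrite ru.
pose G i := sval (cid (h i)).
exists (fun x => \sum_(i < m) (if (i < j)%N then G i x else 0)).
  apply: emeasurable_sum => i; case: (i < j)%N; last exact: measurable_cst.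
  by have [] := svalP (cid (h i)).
move=> w; rewrite [RHS]big_mkcond; apply: eq_bigr => i _.
case: ifP => // ij.
by case: (svalP (cid (h i))) => _ /(_ ij w).
Qed.

Section stopping.
Variable c : forall j, U j -> \bar R.
Arguments c : clear implicits.
Hypotheses (mc : forall j, measurable_fun [set: U j] (c j))
  (c0 : forall j x, 0 <= c j x).

Arguments mc : clear implicits.
Arguments c0 : clear implicits.

Let compensator_factor j : exists2 a : U j -> \bar R, measurable_fun [set: U j] a &
  forall w, a (u j w) = \sum_(i < m | (i < j.+1)%N) c i (u i w).
Proof.
have [g mg ga] := @past_sum_factor j (fun i z => c i z.1)
  (fun i => measurableT_comp (mc i) measurable_fst).
exists (fun x => g x + c j x); first exact: emeasurable_funD.
by move=> w; rewrite ga (sum_ord_ltS (fun i => c i (u i w))).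
Qed.

(** The sum of the [c i] for [i <= j], written as a function of the past of [j].
    It is known before step [j] is observed, which makes stopping when it
    exceeds a level a predictable operation. *)
Definition running_compensator j : U j -> \bar R := sval (cid2 (compensator_factor j)).

Lemma measurable_running_compensator j :
  measurable_fun [set: U j] (@running_compensator j).
Proof. by rewrite /running_compensator; case: cid2. Qed.

Lemma running_compensatorE j w :
  running_compensator (u j w) = \sum_(i < m | (i < j.+1)%N) c i (u i w).
Proof. by rewrite /running_compensator; case: cid2. Qed.

Lemma running_compensator_le j w :
  running_compensator (u j w) <= \sum_(i < m) c i (u i w).
Proof.
rewrite running_compensatorE big_mkcond; apply: lee_sum => i _.
by case: ifP.
Qed.

Lemma le_running_compensator j w : c j (u j w) <= running_compensator (u j w).
Proof.
rewrite running_compensatorE (sum_ord_ltS (fun i => c i (u i w))).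
by rewrite leeDr// sume_ge0.
Qed.

Lemma integral_stopped_compensator (b : R) : (0 <= b)%R ->
  \int[P]_w (\sum_(j < m) if running_compensator (u j w) <= b%:E
    then c j (u j w) else 0) <= b%:E.
Proof.
move=> b0; apply: (@le_trans _ _ (\int[P]_w b%:E)); last first.
  by rewrite integral_cst_prob//; exact: probability_setT.
apply: ge0_le_integral => //.
- by move=> w _; apply: sume_ge0 => j _; case: ifP.
- apply: emeasurable_sum => j; apply: measurable_fun_ifT => //.
    apply: measurable_fun_lee => //; apply: measurableT_comp => //.
    exact: measurable_running_compensator.
  exact: measurableT_comp.
- move=> w _.
  have := @stopped_sum_le R m (fun j => c j (u j w)) b%:E.
  rewrite lee_fin => /(_ b0 (fun j => c0 j _)); apply: le_trans.
  by apply: lee_sum => j _; rewrite running_compensatorE.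
Qed.

End stopping.
Arguments running_compensator : clear implicits.

(** Keep only the terms for which the running compensator is at most [b]. The
    kept terms and their compensators have the same integral, which is at most
    [b], and Markov's inequality applies; nothing is discarded unless the full
    compensator exceeds [b]. *)
Lemma lenglart (f : forall j, U j * Y j -> \bar R) (a b : R) :
  (forall j, measurable_fun [set: U j * Y j] (f j)) -> (forall j z, 0 <= f j z) ->
  (0 < a)%R -> (0 <= b)%R ->
  P [set w | a%:E < \sum_(j < m) f j (u j w, y j w)] <= (b / a)%:E +
  P [set w | b%:E < \sum_(j < m) \int[K j (u j w)]_v f j (u j w, v)].
Proof.
move=> mf f0 a0 b0.
pose c j x := \int[K j x]_v f j (x, v).
have mc j : measurable_fun [set: U j] (c j) by exact: measurable_integral_kernel.
have c0 j x : 0 <= c j x by exact: integral_ge0.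
pose A j x := running_compensator c mc j x <= b%:E.
have mA j : measurable_fun [set: U j] (A j).
  by apply: measurable_fun_lee => //; exact: measurable_running_compensator.
(* The event [A j] depends on the past of [j] only, so it passes through the kernel. *)
pose g j (z : U j * Y j) := if A j z.1 then f j z else 0.
have mg j : measurable_fun [set: U j * Y j] (g j).
  by apply: measurable_fun_ifT => //; exact: measurableT_comp.
have g0 j z : 0 <= g j z by rewrite /g; case: ifP.
pose E1 := [set w | a%:E <= `|\sum_(j < m) g j (u j w, y j w)|].
pose E2 := [set w | b%:E < \sum_(j < m) c j (u j w)].
have msg : measurable_fun [set: S] (fun w => \sum_(j < m) g j (u j w, y j w)).
  by apply: emeasurable_sum => j; exact: measurableT_comp (mg j) (muy j).
have msc : measurable_fun [set: S] (fun w => \sum_(j < m) c j (u j w)).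
  by apply: emeasurable_sum => j; exact: measurableT_comp.
have msf : measurable_fun [set: S] (fun w => \sum_(j < m) f j (u j w, y j w)).
  by apply: emeasurable_sum => j; exact: measurableT_comp (mf j) (muy j).
have mE1 : measurable E1.
  rewrite -[X in measurable X]setTI; apply: emeasurable_fun_c_infty => //.
  exact: measurableT_comp.
have mE2 : measurable E2.
  by rewrite -[X in measurable X]setTI; apply: emeasurable_fun_o_infty.
have PE1 : P E1 <= (b / a)%:E.
  have := le_integral_abse P measurableT msg a0; rewrite setTI -/E1 => h.
  rewrite -(@lee_pmul2l _ a%:E)// -EFinM mulrC divfK ?gt_eqF//.
  apply: (le_trans h); apply: le_trans (integral_stopped_compensator mc c0 b0).
  rewrite (eq_integral (fun w => \sum_(j < m) g j (u j w, y j w))); last first.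
    by move=> w _; rewrite gee0_abs// sume_ge0.
  rewrite !ge0_integral_sum//=; last 3 first.
  - move=> j; apply: measurable_fun_ifT; last exact: measurable_cst.
      exact: measurableT_comp (mA j) (mu j).
    exact: measurableT_comp (mc j) (mu j).
  - by move=> j w _; case: ifP.
  - by move=> j; exact: measurableT_comp (mg j) (muy j).
  apply: lee_sum => j _.
  rewrite (disintegration (mu j) (my j) (PK j))//.
  apply: ge0_le_integral => //.
  - by move=> w _; exact: integral_ge0.
  - exact: measurableT_comp (measurable_integral_kernel (K j) (mg j) (g0 j)) (mu j).
  - apply: measurable_fun_ifT; last exact: measurable_cst.
      exact: measurableT_comp (mA j) (mu j).
    exact: measurableT_comp (mc j) (mu j).
  - move=> w _; rewrite /g/= /A; case: ifP => // _.
    by rewrite integral0_eq.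
apply: (@le_trans _ _ (P (E1 `|` E2))); last first.
  by apply: (le_trans (measureU2 _ mE1 mE2)); exact: leeD2r.
apply: le_measure; rewrite ?inE.
- by rewrite -[X in measurable X]setTI; apply: emeasurable_fun_o_infty.
- exact: measurableU.
- move=> w /= lea; have [lb|lb] := leP (\sum_(j < m) c j (u j w)) b%:E; last by right.
  left; rewrite /E1/= gee0_abs ?sume_ge0// ltW//.
  rewrite (eq_bigr (fun j => f j (u j w, y j w)))// => j _.
  rewrite /g /A/= (le_trans _ lb)//; exact: running_compensator_le.
Qed.

(** Stop the martingale when the sum of the conditional second moments would
    exceed [b]. The stopped martingale has square-integrable increments that are
    orthogonal to the past, so that its second moment is at most [b]; conclude
    by Chebyshev's inequality. *)
Lemma martingale_tail (f : forall j, U j * Y j -> R) (a b : R) :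
  (forall j, measurable_fun [set: U j * Y j] (f j)) ->
  (0 < a)%R -> (0 <= b)%R ->
  P [set w | (a < `|\sum_(j < m)
      (f j (u j w, y j w) - fine (\int[K j (u j w)]_v (f j (u j w, v))%:E))|)%R]
  <= (b / a ^+ 2)%:E +
  P [set w | b%:E < \sum_(j < m) \int[K j (u j w)]_v (f j (u j w, v) ^+ 2)%:E].
Proof.
move=> mf a0 b0.
pose c j x := \int[K j x]_v (f j (x, v) ^+ 2)%:E.
have mf2 j : measurable_fun [set: U j * Y j] (fun z => (f j z ^+ 2)%:E).
  by apply/measurable_EFinP; exact: measurable_funX.
have f20 j z : 0 <= (f j z ^+ 2)%:E by rewrite lee_fin sqr_ge0.
have mc j : measurable_fun [set: U j] (c j).
  exact: (measurable_integral_kernel (K j) (mf2 j) (f20 j)).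
have c0 j x : 0 <= c j x by exact: integral_ge0.
pose e j x := fine (\int[K j x]_v (f j (x, v))%:E).
have me j : measurable_fun [set: U j] (e j).
  apply: (measurableT_comp (fine_measurable measurableT)) => //.
  have mF : measurable_fun [set: U j * Y j] (EFin \o f j) by exact/measurable_EFinP.
  rewrite (_ : (fun x => _) = fun x =>
    \int[K j x]_v (EFin \o f j)^\+ (x, v) - \int[K j x]_v (EFin \o f j)^\- (x, v)).
    apply: emeasurable_funB.
      exact: (measurable_integral_kernel (K j) (measurable_funepos mF) (fun=> funepos_ge0 _ _)).
    exact: (measurable_integral_kernel (K j) (measurable_funeneg mF) (fun=> funeneg_ge0 _ _)).
  apply/funext => x; rewrite integralE; congr (_ - _); apply: eq_integral => v _.
    by rewrite !funeposE.
  by rewrite !funenegE.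
pose A j x := running_compensator c mc j x <= b%:E.
have mA j : measurable_fun [set: U j] (A j).
  by apply: measurable_fun_lee => //; exact: measurable_running_compensator.
pose g j (z : U j * Y j) : R := if A j z.1 then (f j z - e j z.1)%R else 0%R.
have mg j : measurable_fun [set: U j * Y j] (g j).
  apply: measurable_fun_ifT => //; first exact: measurableT_comp.
  by apply: measurable_funB => //; exact: measurableT_comp.
pose G k w := (\sum_(i < m | (i < k)%N) g i (u i w, y i w))%R.
have mG k : measurable_fun [set: S] (G k).
  rewrite /G; under eq_fun do rewrite big_mkcond/=.
  apply: measurable_sum => i; case: (i < k)%N; last exact: measurable_cst.
  exact: measurableT_comp (mg i) (muy i).
pose C k w := \sum_(i < m | (i < k)%N) (if A i (u i w) then c i (u i w) else 0).
have mC1 i : measurable_fun [set: S] (fun w => if A i (u i w) then c i (u i w) else 0).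
  apply: measurable_fun_ifT; last exact: measurable_cst.
    exact: measurableT_comp (mA i) (mu i).
  exact: measurableT_comp (mc i) (mu i).
have mC k : measurable_fun [set: S] (C k).
  rewrite /C; under eq_fun do rewrite big_mkcond/=.
  by apply: emeasurable_sum => i; case: (i < k)%N => //; exact: measurable_cst.
(* The stopped martingale [G] has second moment at most that of its compensator [C]. *)
have IH k : (k <= m)%N -> \int[P]_w (G k w ^+ 2)%:E <= \int[P]_w C k w.
  elim: k => [_|k IHk km].
    rewrite integral0_eq; last by move=> w _; rewrite /G big_pred0// expr0n.
    by apply: integral_ge0 => w _; rewrite /C big_pred0.
  pose j := Ordinal km.
  have [s ms sG] : exists2 s : U j -> R, measurable_fun [set: U j] s &
      forall w, s (u j w) = G k w.
    have mEg i : measurable_fun [set: U i * Y i] (EFin \o g i) by exact/measurable_EFinP.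
    have [s ms sG] := @past_sum_factor j (fun i => EFin \o g i) mEg.
    exists (fine \o s); first exact: (measurableT_comp (fine_measurable measurableT)).
    by move=> w /=; rewrite sG sumEFin.
  pose F (z : U j * Y j) := ((s z.1 + g j z) ^+ 2)%:E.
  have mF : measurable_fun [set: U j * Y j] F.
    apply/measurable_EFinP; apply: measurable_funX; apply: measurable_funD => //.
    exact: measurableT_comp.
  have F0 z : 0 <= F z by rewrite lee_fin sqr_ge0.
  have -> : \int[P]_w (G k.+1 w ^+ 2)%:E = \int[P]_w F (u j w, y j w).
    by apply: eq_integral => w _; rewrite /G (sum_ord_ltS (fun i => g i (u i w, y i w)) j) -/(G k w) -sG.
  rewrite (disintegration (mu j) (my j) (PK j) mF F0).
  have -> : \int[P]_w C k.+1 w =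
      \int[P]_w C k w + \int[P]_w (if A j (u j w) then c j (u j w) else 0).
    rewrite -ge0_integralD//; last 2 first.
    - by move=> w _; apply: sume_ge0 => i _; case: ifP.
    - by move=> w _; case: ifP.
    apply: eq_integral => w _.
    by rewrite /C (sum_ord_ltS (fun i => if A i (u i w) then c i (u i w) else 0) j).
  apply: le_trans (leeD2r _ (IHk (ltnW km))).
  rewrite -ge0_integralD//; last 3 first.
  - by move=> w _; rewrite lee_fin sqr_ge0.
  - by apply/measurable_EFinP; exact: measurable_funX.
  - by move=> w _; case: ifP.
  apply: ge0_le_integral => //.
  - by move=> w _; exact: integral_ge0.
  - exact: measurableT_comp (measurable_integral_kernel (K j) mF F0) (mu j).
  - apply: emeasurable_funD => //.
    by apply/measurable_EFinP; exact: measurable_funX.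
  - move=> w _; rewrite /F/= sG.
    have K1 : K j (u j w) [set: Y j] = 1 by exact: prob_kernel.
    have [Aw|nAw] := boolP (A j (u j w)); last first.
      under eq_integral do rewrite /g/= (negbTE nAw) addr0.
      by rewrite integral_cst_prob// adde0.
    have mfj : measurable_fun [set: Y j] (fun v => f j (u j w, v)).
      exact: measurableT_comp (mf j) (measurable_pair1 (u j w)).
    (* On [A j] the conditional second moment is finite, so the increment is integrable and
       the cross term vanishes. *)
    have coo : c j (u j w) < +oo.
      apply: (@le_lt_trans _ _ (running_compensator c mc j (u j w))).
        exact: le_running_compensator.
      exact: (le_lt_trans Aw (ltry _)).
    have fi := square_integrable K1 mfj coo.
    under eq_integral do rewrite /g/= Aw.
    pose ej := e j (u j w).
    rewrite (eq_integral (fun v => ((G k w - ej + f j (u j w, v)) ^+ 2)%:E)); last first.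
      by move=> v _; congr ((_ ^+ 2)%:E); rewrite /ej; ring.
    rewrite (integral_sqr_shift K1 _ mfj coo) -/(c j (u j w)).
    rewrite leeD2r// lee_fin -/(e j (u j w)) -/ej.
    by have := sqr_ge0 ej; nra.
pose E1 := [set w | (a ^+ 2)%:E <= `|(G m w ^+ 2)%:E|].
pose E2 := [set w | b%:E < \sum_(j < m) c j (u j w)].
have mG2 : measurable_fun [set: S] (fun w => (G m w ^+ 2)%:E).
  by apply/measurable_EFinP; exact: measurable_funX.
have msc : measurable_fun [set: S] (fun w => \sum_(j < m) c j (u j w)).
  by apply: emeasurable_sum => j; exact: measurableT_comp (mc j) (mu j).
have mE1 : measurable E1.
  rewrite -[X in measurable X]setTI; apply: emeasurable_fun_c_infty => //.
  exact: measurableT_comp.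
have mE2 : measurable E2.
  by rewrite -[X in measurable X]setTI; apply: emeasurable_fun_o_infty.
have a20 : (0 < a ^+ 2)%R by rewrite exprn_gt0.
have PE1 : P E1 <= (b / a ^+ 2)%:E.
  have := le_integral_abse P measurableT mG2 a20; rewrite setTI -/E1 => h.
  rewrite -(@lee_pmul2l _ (a ^+ 2)%:E)// -EFinM mulrC divfK ?gt_eqF//.
  apply: (le_trans h); apply: le_trans (integral_stopped_compensator mc c0 b0).
  rewrite (eq_integral (fun w => (G m w ^+ 2)%:E)); last first.
    by move=> w _; rewrite gee0_abs// lee_fin sqr_ge0.
  apply: (le_trans (IH m (leqnn m))).
  rewrite le_eqVlt; apply/orP; left; apply/eqP; apply: eq_integral => w _.
  by rewrite /C sum_ord_lt_all.
apply: (@le_trans _ _ (P (E1 `|` E2))); last first.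
  by apply: (le_trans (measureU2 _ mE1 mE2)); exact: leeD2r.
apply: le_measure; rewrite ?inE.
- rewrite -[X in measurable X]setTI; apply: measurable_fun_ltr => //.
  apply: measurableT_comp => //; apply: measurable_sum => j.
  apply: measurable_funB; first exact: measurableT_comp (mf j) (muy j).
  exact: measurableT_comp (me j) (mu j).
- exact: measurableU.
- move=> w /= lea; have [lb|lb] := leP (\sum_(j < m) c j (u j w)) b%:E; last by right.
  left; rewrite /E1/= lee_fin ger0_norm ?sqr_ge0//.
  rewrite -[leRHS]real_normK ?num_real// lerXn2r ?nnegrE// ?ltW//.
  rewrite /G sum_ord_lt_all (eq_bigr (fun j => f j (u j w, y j w) - e j (u j w))%R)// => j _.
  rewrite /g /A/= (le_trans _ lb)//; exact: running_compensator_le.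
Qed.

End sequential_experiment.

(** * Square roots of densities in one step *)

Section root_ratio.
Context {Z : Type} {R : realType}.
Variables (p q t : Z -> R).

(** [(1 + root_ratio z) ^+ 2] is the density ratio [q z / p z] where [p z] is
    not 0; the square root is used because [assumption_A1] is a statement about square
    roots of densities. *)
Definition root_ratio z : R :=
  if p z == 0 then 0 else Num.sqrt (q z) / Num.sqrt (p z) - 1.

Definition rel_score z : R := if p z == 0 then 0 else t z / Num.sqrt (p z).

Definition remainder z := root_ratio z - rel_score z.

(** The part of the density [q] that is singular with respect to [p]. *)
Definition singular_part z : R := if p z == 0 then q z else 0.

Hypotheses (p0 : forall z, 0 <= p z) (q0 : forall z, 0 <= q z).

(** Lebesgue decomposition of [q], pointwise. *)
Lemma sqr_root_ratioD1 z :
  (1 + root_ratio z) ^+ 2 * p z + singular_part z = q z.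
Proof.
rewrite /root_ratio /singular_part; case: eqP => [->|/eqP pz]; first by rewrite mulr0 add0r.
have spz : Num.sqrt (p z) != 0 by rewrite gt_eqF// sqrtr_gt0 lt0r pz p0.
rewrite addr0 addrC subrK -[X in _ * X = _](sqr_sqrtr (p0 z)) -exprMn divfK//.
by rewrite sqr_sqrtr.
Qed.

Lemma sqr_remainder_le z : remainder z ^+ 2 * p z <=
  (Num.sqrt (q z) - Num.sqrt (p z) - t z) ^+ 2.
Proof.
rewrite /remainder /root_ratio /rel_score; case: eqP => [->|/eqP pz].
  by rewrite mulr0 sqr_ge0.
have spz : Num.sqrt (p z) != 0 by rewrite gt_eqF// sqrtr_gt0 lt0r pz p0.
rewrite -[X in _ * X <= _](sqr_sqrtr (p0 z)) -exprMn !mulrBl !divfK// mul1r.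
exact: lexx.
Qed.

End root_ratio.

(** Where [p z = 0], let [a] and [b] be the roots of [q z] and [q' z]. Both are
    nonnegative, so [a <= a + b = (a - t z) + (b + t z)], and
    [a ^+ 2 <= 2 (a - t z) ^+ 2 + 2 (b + t z) ^+ 2]. *)
Lemma singular_part_le (Z : Type) (R : realType) (p q q' t : Z -> R) z :
  (forall z, 0 <= p z) -> (forall z, 0 <= q z) ->
  singular_part p q z <=
  2 * (Num.sqrt (q z) - Num.sqrt (p z) - t z) ^+ 2 +
  2 * (Num.sqrt (q' z) - Num.sqrt (p z) + t z) ^+ 2.
Proof.
move=> p0 q0; rewrite /singular_part; case: eqP => [->|_]; last first.
  by rewrite addr_ge0// mulr_ge0// sqr_ge0.
rewrite sqrtr0 !subr0 -{1}(sqr_sqrtr (q0 z)).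
move: (sqrtr_ge0 (q z)) (sqrtr_ge0 (q' z)).
set a := Num.sqrt (q z); set b := Num.sqrt (q' z) => a0 b0.
have := sqr_ge0 (a - t z - (b + t z)); nra.
Qed.

(** Expand around [y] and split the mixed term [2 (x - y) y] by Young's
    inequality with weight [r]. *)
Lemma sqr_diff_le (R : realType) (x y r : R) : 0 < r ->
  `|x ^+ 2 - y ^+ 2| <= (1 + r^-1) * (x - y) ^+ 2 + r * y ^+ 2.
Proof.
move=> r0; have s0 : 0 <= (1 + r^-1) by rewrite addr_ge0// invr_ge0 ltW.
have rV : r * r^-1 = 1 by rewrite divff// gt_eqF.
have rV0 : 0 < r^-1 by rewrite invr_gt0.
have key : 2 * `|(x - y) * y| <= r^-1 * (x - y) ^+ 2 + r * y ^+ 2.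
  rewrite normrM; have := sqr_ge0 (`|x - y| - r * `|y|).
  rewrite -(real_normK (num_real (x - y))) -(real_normK (num_real y)).
  set a := `|x - y|; set b := `|y| => h.
  rewrite -(ler_pM2l r0) mulrDr !mulrA rV mul1r.
  nra.
rewrite (_ : x ^+ 2 - y ^+ 2 = (x - y) ^+ 2 + 2 * ((x - y) * y)); last by ring.
apply: (le_trans (ler_normD _ _)); rewrite [X in X + _]ger0_norm ?sqr_ge0//.
rewrite [X in _ + X]normrM (ger0_norm (ler0n R 2)).
move: key; lra.
Qed.

Section measurability.
Context d (Y : measurableType d) (R : realType).
Implicit Types p q t f : Y -> R.

Lemma measurable_fun_inv f : measurable_fun [set: Y] f ->
  measurable_fun [set: Y] (fun y => (f y)^-1).
Proof.
move=> mf; suff mi : measurable_fun [set: R] (fun x : R => x^-1).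
  exact: measurableT_comp mi mf.
rewrite -(setUv [set (0 : R)]); apply/measurable_funU => //.
  exact: measurableC.
split; first exact: measurable_fun_set1.
apply: open_continuous_measurable_fun.
  by apply: closed_openC; exact: closed_eq.
by move=> x; rewrite inE/= => /eqP x0; exact: inv_continuous.
Qed.

Lemma measurable_fun_sqrt f : measurable_fun [set: Y] f ->
  measurable_fun [set: Y] (fun y => Num.sqrt (f y)).
Proof.
apply: measurableT_comp; apply: continuous_measurable_fun.
exact: sqrt_continuous.
Qed.

Lemma measurable_root_ratio p q : measurable_fun [set: Y] p ->
  measurable_fun [set: Y] q -> measurable_fun [set: Y] (root_ratio p q).
Proof.
move=> mp mq; apply: measurable_fun_ifT; [exact: measurable_fun_eqr|exact: measurable_cst|].
apply: measurable_funB => //; apply: measurable_funM.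
  exact: measurable_fun_sqrt.
by apply: measurable_fun_inv; exact: measurable_fun_sqrt.
Qed.

Lemma measurable_rel_score p t : measurable_fun [set: Y] p ->
  measurable_fun [set: Y] t -> measurable_fun [set: Y] (rel_score p t).
Proof.
move=> mp mt; apply: measurable_fun_ifT; [exact: measurable_fun_eqr|exact: measurable_cst|].
apply: measurable_funM => //.
by apply: measurable_fun_inv; exact: measurable_fun_sqrt.
Qed.

Lemma measurable_remainder p q t : measurable_fun [set: Y] p ->
  measurable_fun [set: Y] q -> measurable_fun [set: Y] t ->
  measurable_fun [set: Y] (remainder p q t).
Proof.
by move=> mp mq mt; apply: measurable_funB; [exact: measurable_root_ratio|exact: measurable_rel_score].
Qed.

Lemma measurable_singular_part p q : measurable_fun [set: Y] p ->
  measurable_fun [set: Y] q -> measurable_fun [set: Y] (singular_part p q).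
Proof.
by move=> mp mq; apply: measurable_fun_ifT; [exact: measurable_fun_eqr| |exact: measurable_cst].
Qed.

End measurability.

Section one_step.
Context d (Y : measurableType d) (R : realType).
Variable mu : {sigma_finite_measure set Y -> \bar R}.
Variables (k : {measure set Y -> \bar R}) (p q q' t : Y -> R).
Local Open Scope ereal_scope.
Hypotheses (mp : measurable_fun [set: Y] p) (mq : measurable_fun [set: Y] q)
  (mq' : measurable_fun [set: Y] q') (mt : measurable_fun [set: Y] t).
Hypotheses (p0 : forall y, (0 <= p y)%R) (q0 : forall y, (0 <= q y)%R).
Hypotheses (k1 : k [set: Y] = 1) (kmu : k `<< mu)
  (kE : forall B, measurable B -> k B = \int[mu]_(y in B) (p y)%:E).
Hypothesis q1 : \int[mu]_y (q y)%:E = 1.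

Let z := root_ratio p q.
Let x := rel_score p t.
Let D := remainder p q t.
Let s := singular_part p q.

Let mz : measurable_fun [set: Y] z. Proof. exact: measurable_root_ratio. Qed.
Let mx : measurable_fun [set: Y] x. Proof. exact: measurable_rel_score. Qed.
Let mD : measurable_fun [set: Y] D. Proof. exact: measurable_remainder. Qed.
Let ms : measurable_fun [set: Y] s. Proof. exact: measurable_singular_part. Qed.

Let koo : k [set: Y] < +oo. Proof. by rewrite k1 ltry. Qed.

Let msq (f : Y -> R) : measurable_fun [set: Y] f ->
  measurable_fun [set: Y] (fun y => (f y ^+ 2)%:E).
Proof. by move=> mf; apply/measurable_EFinP; exact: measurable_funX. Qed.

Let s0 y : (0 <= s y)%R.
Proof. by rewrite /s /singular_part; case: ifP. Qed.

Lemma integral_sqr_remainder_le : \int[k]_y (D y ^+ 2)%:E <=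
  \int[mu]_y ((Num.sqrt (q y) - Num.sqrt (p y) - t y) ^+ 2)%:E.
Proof.
rewrite (integral_density koo kmu mp p0 kE (msq mD)); last first.
  by move=> y; rewrite lee_fin sqr_ge0.
apply: ge0_le_integral => //.
- by move=> y _; rewrite -EFinM lee_fin mulr_ge0 ?sqr_ge0.
- by apply: emeasurable_funM; [exact: msq|exact/measurable_EFinP].
- apply/measurable_EFinP; apply: measurable_funX.
  by apply: measurable_funB => //; apply: measurable_funB; exact: measurable_fun_sqrt.
- by move=> y _; rewrite -EFinM lee_fin sqr_remainder_le.
Qed.

Lemma integral_singular_part_le : \int[mu]_y (s y)%:E <=
  2%:E * \int[mu]_y ((Num.sqrt (q y) - Num.sqrt (p y) - t y) ^+ 2)%:E +
  2%:E * \int[mu]_y ((Num.sqrt (q' y) - Num.sqrt (p y) + t y) ^+ 2)%:E.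
Proof.
have m1 : measurable_fun [set: Y]
    (fun y => ((Num.sqrt (q y) - Num.sqrt (p y) - t y) ^+ 2)%:E).
  by apply: msq; apply: measurable_funB => //; apply: measurable_funB; exact: measurable_fun_sqrt.
have m2 : measurable_fun [set: Y]
    (fun y => ((Num.sqrt (q' y) - Num.sqrt (p y) + t y) ^+ 2)%:E).
  by apply: msq; apply: measurable_funD => //; apply: measurable_funB; exact: measurable_fun_sqrt.
rewrite -!ge0_integralZl//; try by move=> y _; rewrite lee_fin sqr_ge0.
rewrite -ge0_integralD//; try (by apply: measurable_funeM);
  try by move=> y _; rewrite mule_ge0// lee_fin sqr_ge0.
apply: ge0_le_integral => //.
- by move=> y _; rewrite lee_fin.
- exact/measurable_EFinP.
- by apply: emeasurable_funD; exact: measurable_funeM.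
- by move=> y _; rewrite -!EFinM -EFinD lee_fin singular_part_le.
Qed.

(** The total mass of [q] is 1; integrate its Lebesgue decomposition. Expanding
    the square, this says that twice the mean of the root ratio is minus its
    second moment minus the singular mass. *)
Lemma integral_sqr_root_ratioD1 :
  \int[k]_y ((1 + z y) ^+ 2)%:E + \int[mu]_y (s y)%:E = 1.
Proof.
rewrite (integral_density koo kmu mp p0 kE); last 2 first.
- by apply: msq; exact: measurable_funD.
- by move=> y; rewrite lee_fin sqr_ge0.
rewrite -ge0_integralD//.
- rewrite -q1; apply: eq_integral => y _.
  by rewrite -EFinM -EFinD sqr_root_ratioD1.
- by move=> y _; rewrite -EFinM lee_fin mulr_ge0 ?sqr_ge0.
- apply: emeasurable_funM; last exact/measurable_EFinP.
  by apply: msq; exact: measurable_funD.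
- by move=> y _; rewrite lee_fin.
- exact/measurable_EFinP.
Qed.

Let square_integrable_le (f g : Y -> R) (a b : R) :
  measurable_fun [set: Y] f -> measurable_fun [set: Y] g ->
  (forall y, f y ^+ 2 <= a * g y ^+ 2 + b)%R -> (0 <= a)%R -> (0 <= b)%R ->
  \int[k]_y (g y ^+ 2)%:E < +oo -> \int[k]_y (f y ^+ 2)%:E < +oo.
Proof.
move=> mf mg fg a0 b0 goo.
apply: (@le_lt_trans _ _ (\int[k]_y (a%:E * (g y ^+ 2)%:E + b%:E))).
  apply: ge0_le_integral => //.
  - by move=> y _; rewrite lee_fin sqr_ge0.
  - exact: msq.
  - by apply: emeasurable_funD => //; apply: measurable_funeM; exact: msq.
  - by move=> y _; rewrite -EFinM -EFinD lee_fin.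
rewrite ge0_integralD//; last 2 first.
- by move=> y _; rewrite -EFinM lee_fin mulr_ge0 ?sqr_ge0.
- by apply: measurable_funeM; exact: msq.
rewrite ge0_integralZl//; last 2 first.
- exact: msq.
- by move=> y _; rewrite lee_fin sqr_ge0.
rewrite integral_cst_prob//; apply: lte_add_pinfty; last exact: ltry.
by rewrite lte_mul_pinfty.
Qed.

Let sq_integrable (f : Y -> R) : measurable_fun [set: Y] f ->
  \int[k]_y (f y ^+ 2)%:E < +oo -> k.-integrable [set: Y] (fun y => (f y ^+ 2)%:E).
Proof.
move=> mf foo; apply/integrableP; split; first exact: msq.
by under eq_integral do rewrite /= ger0_norm ?sqr_ge0//.
Qed.

(** Since the score [x] is centred, [D] and the root ratio [z] have the same
    mean, so that [2 E D = - E z^2 - s] with [s] the singular mass, and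
    [2 E D + E x^2] is the sum of [E x^2 - E z^2], bounded by [sqr_diff_le], and
    of [- s]. So the mean of [D] is close to [- E x^2 / 2], which doubles the
    term [- x^2] of the expansion of [2 ln (1 + z)]. *)
Lemma drift_le (r : R) : (0 < r)%R ->
  \int[k]_y (x y ^+ 2)%:E < +oo -> \int[k]_y (x y)%:E = 0 ->
  (`|2 * fine (\int[k]_y (D y)%:E) + fine (\int[k]_y (x y ^+ 2)%:E)|)%:E <=
  (1 + r^-1)%:E * \int[k]_y (D y ^+ 2)%:E + r%:E * \int[k]_y (x y ^+ 2)%:E
  + \int[mu]_y (s y)%:E.
Proof.
move=> r0 xoo Ex0.
have I0 (f : Y -> R) : 0 <= \int[k]_y (f y ^+ 2)%:E.
  by apply: integral_ge0 => y _; rewrite lee_fin sqr_ge0.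
have sI0 : 0 <= \int[mu]_y (s y)%:E.
  by apply: integral_ge0 => y _; rewrite lee_fin.
have z1oo : \int[k]_y ((1 + z y) ^+ 2)%:E < +oo.
  apply: (@le_lt_trans _ _ 1); last exact: ltry.
  by rewrite -integral_sqr_root_ratioD1 leeDl.
have zoo : \int[k]_y (z y ^+ 2)%:E < +oo.
  apply: (@square_integrable_le z (fun y => 1 + z y)%R 2 2) => //.
    exact: measurable_funD.
  by move=> y; have := sqr_ge0 (2 + z y)%R; nra.
have Doo : \int[k]_y (D y ^+ 2)%:E < +oo.
  apply: (@le_lt_trans _ _ (\int[k]_y (2%:E * (z y ^+ 2)%:E + 2%:E * (x y ^+ 2)%:E))).
    apply: ge0_le_integral => //.
    - by move=> y _; rewrite lee_fin sqr_ge0.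
    - exact: msq.
    - by apply: emeasurable_funD; apply: measurable_funeM; exact: msq.
    - move=> y _; rewrite -!EFinM -EFinD lee_fin /D /remainder -/(z y) -/(x y).
      by have := sqr_ge0 (z y + x y)%R; nra.
  rewrite ge0_integralD//; try (by move=> y _; rewrite mule_ge0// lee_fin sqr_ge0);
    try (by apply: measurable_funeM; exact: msq).
  rewrite !ge0_integralZl//; try (by move=> y _; rewrite lee_fin sqr_ge0);
    try exact: msq.
  by apply: lte_add_pinfty; rewrite lte_mul_pinfty.
have soo : \int[mu]_y (s y)%:E < +oo.
  apply: (@le_lt_trans _ _ 1); last exact: ltry.
  by rewrite -integral_sqr_root_ratioD1 leeDr.
have zi := square_integrable k1 mz zoo.
have xi := square_integrable k1 mx xoo.
have ED : \int[k]_y (D y)%:E = \int[k]_y (z y)%:E.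
  transitivity (\int[k]_y (z y)%:E - \int[k]_y (x y)%:E); last by rewrite Ex0 sube0.
  by rewrite -integralB.
have z2i := sq_integrable mz zoo.
have x2i := sq_integrable mx xoo.
have fz : \int[k]_y (z y ^+ 2)%:E \is a fin_num by rewrite ge0_fin_numE.
have fx : \int[k]_y (x y ^+ 2)%:E \is a fin_num by rewrite ge0_fin_numE.
have fs : \int[mu]_y (s y)%:E \is a fin_num by rewrite ge0_fin_numE.
have key := integral_sqr_root_ratioD1.
rewrite (integral_sqr_shift k1 1 mz zoo) in key.
have diff : (`|fine (\int[k]_y (z y ^+ 2)%:E) - fine (\int[k]_y (x y ^+ 2)%:E)|)%:E
   <= (1 + r^-1)%:E * \int[k]_y (D y ^+ 2)%:E + r%:E * \int[k]_y (x y ^+ 2)%:E.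
  rewrite -abse_EFin EFinB !fineK// -integralB//.
  apply: (le_trans (le_abse_integral _ _ _)) => //.
    by apply: emeasurable_funB; exact: msq.
  have rV : (0 <= 1 + r^-1)%R by rewrite addr_ge0// invr_ge0 ltW.
  rewrite -!ge0_integralZl//; try (by move=> y _; rewrite lee_fin sqr_ge0);
    try (exact: msq); try exact: ltW.
  rewrite -ge0_integralD//; try (by apply: measurable_funeM; exact: msq);
    try (by move=> y _; rewrite mule_ge0// lee_fin ?sqr_ge0// ltW).
  apply: ge0_le_integral => //.
  - apply: measurableT_comp => //.
    by apply: emeasurable_funB; exact: msq.
  - by apply: emeasurable_funD; apply: measurable_funeM; exact: msq.
  - move=> y _; rewrite -!EFinM -EFinD [X in (X <= _)%E](_ : _ = `|z y ^+ 2 - x y ^+ 2|%:E)%R // lee_fin.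
    exact: sqr_diff_le.
rewrite ED; apply: le_trans (leeD2r _ diff).
rewrite -(fineK fs) -EFinD lee_fin.
move: key; rewrite -{1}(fineK fz) -{1}(fineK fs) -!EFinD => -[].
have : (0 <= fine (\int[mu]_y (s y)%:E))%R by exact: fine_ge0.
set Ez := fine (\int[k]_y (z y)%:E); set Ez2 := fine (\int[k]_y (z y ^+ 2)%:E).
set Ex2 := fine (\int[k]_y (x y ^+ 2)%:E); set es := fine _ => es0 key.
rewrite (_ : 2 * Ez + Ex2 = - (Ez2 - Ex2) - es)%R; last by rewrite expr1n in key; lra.
by rewrite (le_trans (ler_normB _ _))// normrN lerD2l ger0_norm.
Qed.

End one_step.

(** * Likelihood ratios of sequential experiments *)

(** Outside the two null sets that carry the singular parts, both functions
    integrate to [P']. *)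
Lemma likelihood_ratio_unique d (S : measurableType d) (R : realType)
    (P' P : probability S R) (L1 L2 : S -> \bar R) :
  is_likelihood_ratio P' P L1 -> is_likelihood_ratio P' P L2 ->
  {ae P, forall w, L1 w = L2 w}.
Proof.
move=> [mL1 L10 [nu1 [[N1 [mN1 PN1 nuN1]] E1]]].
move=> [mL2 L20 [nu2 [[N2 [mN2 PN2 nuN2]] E2]]].
pose D := ~` (N1 `|` N2).
have mD : measurable D by apply: measurableC; exact: measurableU.
have nu0 (nu : {measure set S -> \bar R}) N E : measurable N -> measurable E ->
    nu (~` N) = 0%E -> E `<=` ~` N -> nu E = 0%E.
  move=> mN mE nuN EN; apply/eqP; rewrite -measure_le0 -nuN.
  by apply: le_measure; rewrite ?inE//; exact: measurableC.
have eqI E : E `<=` D -> measurable E ->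
    (\int[P]_(w in E) L1 w = \int[P]_(w in E) L2 w)%E.
  move=> ED mE; have := E1 E mE; rewrite E2// (nu0 nu1 N1 E)//; last first.
    by move=> w /ED; rewrite /D setCU => -[].
  rewrite (nu0 nu2 N2 E)//; last first.
    by move=> w /ED; rewrite /D setCU => -[].
  by rewrite !adde0 => ->.
have iL1 : P.-integrable D L1.
  apply/integrableP; split; first exact: measurable_funTS.
  rewrite (eq_integral L1); last by move=> w _; rewrite gee0_abs.
  apply: (@le_lt_trans _ _ (P' D)); last by rewrite (le_lt_trans (probability_le1 _ _))// ltry.
  by rewrite E1// leeDl.
have [N [mN PN subN]] := integral_ae_eq mD iL1 (measurable_funTS mL2) eqI.
exists (N `|` (N1 `|` N2)); split.
- by apply: measurableU => //; exact: measurableU.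
- apply/eqP; rewrite -measure_le0; apply: (le_trans (measureU2 _ mN _)).
    exact: measurableU.
  rewrite [X in (X + _)%E]PN add0e; apply: (le_trans (measureU2 _ mN1 mN2)).
  by rewrite [X in (X + _)%E]PN1 [X in (_ + X)%E]PN2 adde0.
- move=> w /= L12; have [Dw|nDw] := pselect (D w).
    by left; apply: subN => /= /(_ Dw).
  by right; apply: contrapT.
Qed.

Section sequential_likelihood_ratio.
Context dS (S : measurableType dS) (R : realType).
Context (m : nat) (dU dY : 'I_m -> measure_display)
  (U : forall j, measurableType (dU j)) (Y : forall j, measurableType (dY j)).
Variables (u : forall j, S -> U j) (y : forall j, S -> Y j).
Hypotheses (mu : forall j, measurable_fun [set: S] (u j))
  (my : forall j, measurable_fun [set: S] (y j)).
Hypothesis adapted : forall i j : 'I_m, (i < j)%N ->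
  exists2 r : U j -> U i * Y i, measurable_fun [set: U j] r &
    forall w, r (u j w) = (u i w, y i w).
Arguments mu : clear implicits.
Arguments my : clear implicits.
Local Open Scope ereal_scope.

Definition is_disintegration (P : probability S R) (K : forall j, R.-pker U j ~> Y j) :=
  forall j A B, measurable A -> measurable B ->
    P [set w | A (u j w) /\ B (y j w)] = \int[P]_(w in u j @^-1` A) K j (u j w) B.

(** [F] depends only on the observations before step [k]. The last clause covers
    [k = m], where all the observations are available and there is no further
    past space. *)
Definition known_at (k : nat) (F : S -> \bar R) :=
  (forall j : 'I_m, k = j -> exists2 f : U j -> \bar R,
     measurable_fun [set: U j] f & forall w, F w = f (u j w)) /\
  (k = m -> measurable_fun [set: S] F).

Hypothesis known_at0 : forall F, known_at 0 F -> exists c, F = cst c.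
Hypothesis known_atS : forall (j : 'I_m) F, known_at j.+1 F ->
  exists2 g : U j * Y j -> \bar R, measurable_fun [set: U j * Y j] g &
    forall w, F w = g (u j w, y j w).

Let muy j : measurable_fun [set: S] (fun w => (u j w, y j w)).
Proof. exact: measurable_fun_pair. Qed.
Arguments muy : clear implicits.

Lemma past_prod_factor (j : 'I_m) (r : forall i, U i * Y i -> R) :
  (forall i, measurable_fun [set: U i * Y i] (r i)) ->
  exists2 g : U j -> R, measurable_fun [set: U j] g &
    forall w, g (u j w) = (\prod_(i < m | (i < j)%N) r i (u i w, y i w))%R.
Proof.
move=> mr.
have h (i : 'I_m) : exists g : U j -> R, measurable_fun [set: U j] g /\
    ((i < j)%N -> forall w, g (u j w) = r i (u i w, y i w)).
  have [ij|_] := boolP (i < j)%N; last by exists (cst 0%R).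
  have [f mf fu] := adapted ij.
  exists (r i \o f); split; first exact: measurableT_comp.
  by move=> _ w /=; rewrite fu.
pose G i := sval (cid (h i)).
exists (fun x => \prod_(i < m) (if (i < j)%N then G i x else 1))%R.
  apply: measurable_prod => i _; case: (i < j)%N; last exact: measurable_cst.
  by have [] := svalP (cid (h i)).
move=> w; rewrite [RHS]big_mkcond; apply: eq_bigr => i _.
case: ifP => // ij.
by case: (svalP (cid (h i))) => _ /(_ ij w).
Qed.

(** Integrate out the last observation, the factors before it being known. *)
Lemma integral_last_factor (P : probability S R) K (r : forall j, U j * Y j -> R)
    (j : 'I_m) (g : U j * Y j -> \bar R) :
  is_disintegration P K ->
  (forall i, measurable_fun [set: U i * Y i] (r i)) ->
  (forall i z, (0 <= r i z)%R) ->
  measurable_fun [set: U j * Y j] g -> (forall z, 0 <= g z) ->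
  \int[P]_w (g (u j w, y j w) * (\prod_(i < m | (i < j.+1)%N) r i (u i w, y i w))%:E) =
  \int[P]_w ((\int[K j (u j w)]_v (g (u j w, v) * (r j (u j w, v))%:E)) *
    (\prod_(i < m | (i < j)%N) r i (u i w, y i w))%:E).
Proof.
move=> PK mr r0 mg g0; have [b mb bE] := past_prod_factor j mr.
have b0 w : (0 <= b (u j w))%R by rewrite bE; apply: prodr_ge0.
pose F z := g z * (r j z)%:E * (`|b z.1|)%:E.
have mgr : measurable_fun [set: U j * Y j] (fun z => g z * (r j z)%:E).
  by apply: emeasurable_funM => //; exact/measurable_EFinP.
have gr0 z : 0 <= g z * (r j z)%:E by rewrite mule_ge0// lee_fin.
have mF : measurable_fun [set: U j * Y j] F.
  apply: emeasurable_funM => //; apply/measurable_EFinP.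
  by apply: measurableT_comp => //; exact: measurableT_comp.
have F0 z : 0 <= F z by rewrite mule_ge0// lee_fin.
transitivity (\int[P]_w F (u j w, y j w)).
  apply: eq_integral => w _; rewrite /F/= ger0_norm// bE -muleA -EFinM; congr (_ * _%:E).
  rewrite (bigD1 j)//=; congr (_ * _)%R; apply: eq_bigl => i.
  by rewrite ltnS ltn_neqAle andbC -val_eqE.
rewrite (disintegration (mu j) (my j) (PK j) mF F0); apply: eq_integral => w _.
rewrite /F/= ge0_integralZr//; first by rewrite ger0_norm// bE.
exact: measurableT_comp mgr (measurable_pair1 (u j w)).
Qed.

Variables (P P' : probability S R) (K K' : forall j, R.-pker U j ~> Y j).
Variable nu : forall j, {sigma_finite_measure set (Y j) -> \bar R}.
Variables p q : forall j, U j * Y j -> R.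
Hypotheses (PK : is_disintegration P K) (PK' : is_disintegration P' K').
Hypotheses (mp : forall j, measurable_fun [set: U j * Y j] (@p j))
  (mq : forall j, measurable_fun [set: U j * Y j] (@q j)).
Hypotheses (p0 : forall j z, (0 <= @p j z)%R) (q0 : forall j z, (0 <= @q j z)%R).
Hypotheses (Knu : forall j x, K j x `<< nu j) (Knu' : forall j x, K' j x `<< nu j).
Hypothesis KE : forall j x B, measurable B ->
  K j x B = \int[nu j]_(v in B) (@p j (x, v))%:E.
Hypothesis KE' : forall j x B, measurable B ->
  K' j x B = \int[nu j]_(v in B) (@q j (x, v))%:E.
Arguments p : clear implicits.
Arguments q : clear implicits.
Arguments KE : clear implicits.
Arguments KE' : clear implicits.
Arguments mp : clear implicits.
Arguments mq : clear implicits.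
Arguments p0 : clear implicits.
Arguments q0 : clear implicits.
Arguments Knu : clear implicits.
Arguments Knu' : clear implicits.

Definition density_ratio j (z : U j * Y j) : R := if p j z == 0%R then 0%R else (q j z / p j z)%R.
Definition density_support j (z : U j * Y j) : R := if p j z == 0%R then 0%R else 1%R.

Let mratio j : measurable_fun [set: U j * Y j] (@density_ratio j).
Proof.
apply: measurable_fun_ifT; [exact: measurable_fun_eqr|exact: measurable_cst|].
by apply: measurable_funM => //; exact: measurable_fun_inv.
Qed.

Let mdensity_support j : measurable_fun [set: U j * Y j] (@density_support j).
Proof.
by apply: measurable_fun_ifT; [exact: measurable_fun_eqr|exact: measurable_cst|exact: measurable_cst].
Qed.

Let ratio0 j z : (0 <= @density_ratio j z)%R.
Proof. by rewrite /density_ratio; case: ifP => // _; rewrite divr_ge0. Qed.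

Let nonzero0 j z : (0 <= @density_support j z)%R.
Proof. by rewrite /density_support; case: ifP. Qed.

(** Change of measure one observation at a time, from the last one to the first:
    integrating out observation [k] with density [q] on the support of [p], or with
    density [p] and weight [q / p], gives the same function of the past. *)
Lemma integral_prod_ratio k F : (k <= m)%N -> known_at k F -> (forall w, 0 <= F w) ->
  \int[P']_w (F w * (\prod_(i < m | (i < k)%N) density_support (u i w, y i w))%:E) =
  \int[P]_w (F w * (\prod_(i < m | (i < k)%N) density_ratio (u i w, y i w))%:E).
Proof.
elim: k F => [|k IH] F km kF F0.
  have [c Fc] := known_at0 kF; rewrite Fc.
  transitivity c.
    rewrite (eq_integral (fun=> c)) ?integral_cst_prob//; first exact: probability_setT.
    by move=> w _; rewrite big_pred0//= mule1.
  rewrite (eq_integral (fun=> c)) ?integral_cst_prob//; first exact: probability_setT.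
  by move=> w _; rewrite big_pred0//= mule1.
pose j := Ordinal km.
have [g' mg' Fg'] := @known_atS j F kF.
(* [g'] is only known to be nonnegative on the range of the observations. *)
pose g z := maxe (g' z) 0.
have mg : measurable_fun [set: U j * Y j] g by exact: measurable_maxe.
have g0 z : 0 <= g z by rewrite le_max lexx orbT.
have Fg w : F w = g (u j w, y j w) by rewrite /g -Fg'; apply/esym/max_idPl.
under eq_integral do rewrite Fg.
under [RHS]eq_integral do rewrite Fg.
rewrite (integral_last_factor PK' mdensity_support nonzero0 mg g0).
rewrite (integral_last_factor PK mratio ratio0 mg g0).
have psiE x : \int[K' j x]_v (g (x, v) * (density_support (x, v))%:E) =
              \int[K j x]_v (g (x, v) * (density_ratio (x, v))%:E).
  have mpx f : measurable_fun [set: U j * Y j] f -> measurable_fun [set: Y j] (fun v => f (x, v) : R).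
    by move=> mf; exact: measurableT_comp mf (measurable_pair1 x).
  have mgx : measurable_fun [set: Y j] (fun v => g (x, v)).
    exact: measurableT_comp mg (measurable_pair1 x).
  have oo (K0 : forall j, R.-pker U j ~> Y j) : K0 j x setT < +oo by rewrite prob_kernel ltry.
  rewrite (integral_density (oo K') (Knu' j x) (mpx _ (mq j)) (fun v => q0 j (x, v)) (KE' j x)); last 2 first.
  - by apply: emeasurable_funM => //; apply/measurable_EFinP; exact: mpx (mdensity_support (j := j)).
  - by move=> v; rewrite mule_ge0// lee_fin.
  rewrite (integral_density (oo K) (Knu j x) (mpx _ (mp j)) (fun v => p0 j (x, v)) (KE j x)); last 2 first.
  - by apply: emeasurable_funM => //; apply/measurable_EFinP; exact: mpx (mratio (j := j)).
  - by move=> v; rewrite mule_ge0// lee_fin.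
  apply: eq_integral => v _; rewrite -!muleA -!EFinM; congr (_ * _%:E).
  rewrite /density_support /density_ratio; case: eqP => [|/eqP pz]; first by rewrite !mul0r.
  by rewrite mul1r divfK.
pose psi x := \int[K' j x]_v (g (x, v) * (density_support (x, v))%:E).
have mgr : measurable_fun [set: U j * Y j] (fun z => g z * (density_support z)%:E).
  by apply: emeasurable_funM => //; exact/measurable_EFinP.
have gr0 z : 0 <= g z * (density_support z)%:E by rewrite mule_ge0// lee_fin.
have mpsi : measurable_fun [set: U j] psi.
  exact: (measurable_integral_kernel (K' j) mgr gr0).
rewrite (IH (fun w => psi (u j w)) (ltnW km)); last 2 first.
- split=> [i ki|km']; last by exfalso; have := km; rewrite km' ltnn.
  have -> : i = j by apply: val_inj; rewrite /= -ki.
  by exists psi.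
- by move=> w; apply: integral_ge0 => v _; rewrite mule_ge0// lee_fin.
by apply: eq_integral => w _; rewrite /psi psiE.
Qed.

Definition sequential_ratio w : R := (\prod_(i < m) density_ratio (u i w, y i w))%R.

Let N := [set w | exists j, p j (u j w, y j w) = 0%R].

Let mNj j : measurable [set w | p j (u j w, y j w) = 0%R].
Proof.
have := measurableT_comp (mp j) (muy j).
by move=> /(_ measurableT [set 0%R] (measurable_set1 0%R)); rewrite setTI.
Qed.

Let mN : measurable N.
Proof.
rewrite (_ : N = \bigcup_(j in [set: 'I_m]) [set w | p j (u j w, y j w) = 0%R]).
  by apply: fin_bigcup_measurable.
by apply/seteqP; split=> w [j]; [exists j|move=> _; exists j].
Qed.

Lemma density_neq0_ae : {ae P, forall w, forall j, p j (u j w, y j w) != 0%R}.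
Proof.
apply: filter_forall => j.
pose f (z : U j * Y j) : \bar R := (\1_[set z | p j z = 0%R] z)%:E.
have mpj : measurable [set z | p j z = 0%R].
  by have := mp j measurableT [set 0%R] (measurable_set1 0%R); rewrite setTI.
have mf : measurable_fun [set: U j * Y j] f.
  by apply/measurable_EFinP; exact: measurable_indic.
have f0 z : 0 <= f z by rewrite lee_fin.
exists [set w | p j (u j w, y j w) = 0%R]; split => //; last first.
  by move=> w /= /negP/negPn/eqP.
transitivity (\int[P]_w f (u j w, y j w)).
  rewrite -[LHS](congr1 P (setIT _)) -integral_indic//.
rewrite (disintegration (mu j) (my j) (PK (j := j)) mf f0).
rewrite integral0_eq// => w _.
rewrite (integral_density _ (Knu j (u j w)) _ (fun v => p0 j (u j w, v)) (KE j (u j w)))//.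
- rewrite integral0_eq// => v _.
  have [->|pv] := eqVneq (p j (u j w, v)) 0%R; first by rewrite mule0.
  by rewrite /f indicE memNset ?mul0e//=; exact/eqP.
- by rewrite prob_kernel ltry.
- exact: measurableT_comp (mp j) (measurable_pair1 _).
- exact: measurableT_comp mf (measurable_pair1 _).
Qed.

Let PN : P N = 0.
Proof.
apply/negligibleP => //; apply: negligibleS density_neq0_ae.
by move=> w [j pj] /= /(_ j); rewrite pj eqxx.
Qed.

Lemma measurable_sequential_ratio : measurable_fun [set: S] sequential_ratio.
Proof.
apply: measurable_prod => j _; exact: measurableT_comp (mratio (j := j)) (muy j).
Qed.

(** The singular part is the restriction of [P'] to the event where some
    conditional density [p j] vanishes, which is null under [P]; off this event
    [integral_prod_ratio] with [k = m] is the required change of measure. *)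
Lemma sequential_ratio_is_likelihood_ratio :
  is_likelihood_ratio P' P (fun w => (sequential_ratio w)%:E).
Proof.
split.
- by apply/measurable_EFinP; exact: measurable_sequential_ratio.
- by move=> w; rewrite lee_fin prodr_ge0.
(* The measure carried by the zeros of the conditional densities. *)
exists (mrestr P' mN); split.
  by exists N; split => //; rewrite /= /mrestr setICl measure0.
move=> A mA; rewrite /= /mrestr (measureDI P' mA mN); congr (_ + _).
have kA : known_at m (EFin \o (\1_A : S -> R)).
  split=> [j mj|_]; first by have := ltn_ord j; rewrite -mj ltnn.
  by apply/measurable_EFinP; exact: measurable_indic.
have A0 w : 0 <= (EFin \o (\1_A : S -> R)) w by rewrite lee_fin.
have key := integral_prod_ratio (leqnn m) kA A0.
transitivity (\int[P']_w ((EFin \o (\1_A : S -> R)) w *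
    (\prod_(i < m | (i < m)%N) density_support (u i w, y i w))%:E)).
  transitivity (\int[P']_w (\1_(A `\` N) w)%:E).
    by rewrite integral_indic ?setIT//; exact: measurableD.
  apply: eq_integral => w _; rewrite /= -EFinM; congr (_%:E).
  rewrite setDE indicI; congr (_ * _)%R.
  rewrite (eq_bigl predT); last by move=> i; rewrite ltn_ord.
  rewrite indicE; have [/set_mem nN|] := boolP (w \in ~` N).
    rewrite big1// => i _; rewrite /density_support.
    by case: eqP => // pi; exfalso; apply: nN; exists i.
  rewrite notin_setE/= => /contrapT[i pi].
  by rewrite (bigD1 i)//= /density_support pi eqxx mul0r.
rewrite key [RHS]integral_mkcond; apply: eq_integral => w _.
rewrite patchE /= indicE; case: (w \in A); last by rewrite mul0e.
rewrite mul1e; congr (_%:E); rewrite /sequential_ratio.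
by apply: eq_bigl => i; rewrite ltn_ord.
Qed.

End sequential_likelihood_ratio.

(** * Past and present in a product experiment *)

Section product_space.
Context {R : realType} {m : nat} (X : 'I_m -> completeMetricType R).
Hypothesis sepX : forall j, separable (X j).

Lemma measurable_coord (j : 'I_m) :
  measurable_fun [set: state X] (fun w : state X => w j : borel (X j)).
Proof. exact: measurable_proj_topology. Qed.

Lemma measurable_past (j : 'I_m) :
  measurable_fun [set: state X] (@past R m X j).
Proof.
apply: (@measurable_fun_prod_topology _ _ R {i : 'I_m | (i < j)%N} (fun i => X (val i))).
  by move=> i; exact: sepX.
by move=> i; exact: measurable_coord.
Qed.

Lemma past_adapted (i j : 'I_m) : (i < j)%N ->
  exists2 r : past_space X j -> past_space X i * borel (X i),
    measurable_fun [set: past_space X j] r &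
    forall w : state X, r (past j w) = (past i w, w i).
Proof.
move=> ij.
pose r1 (x : past_space X j) : past_space X i :=
  fun k : {k : 'I_m | (k < i)%N} => x (exist _ (val k) (ltn_trans (valP k) ij)).
pose r2 (x : past_space X j) : borel (X i) := x (exist _ i ij).
exists (fun x => (r1 x, r2 x)) => //; apply: measurable_fun_pair.
  apply: (@measurable_fun_prod_topology _ (past_space X j) R {k : 'I_m | (k < i)%N}
    (fun i => X (val i)) r1 (fun k => sepX (val k))) => k.
  exact: (@measurable_proj_topology R {k : 'I_m | (k < j)%N} (fun k => X (val k))
    (exist _ (val k) (ltn_trans (valP k) ij))).
exact: (@measurable_proj_topology R {k : 'I_m | (k < j)%N} (fun k => X (val k)) (exist _ i ij)).
Qed.

(** Completes the observations up to and including [j] by an arbitrary point.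
    Functions of these observations only are recovered by composition with it,
    which is how they become functions on [past_space X j * borel (X j)]. *)
Definition extend (j : 'I_m) (z : past_space X j * borel (X j)) : state X := fun i =>
  match @idP (i < j)%N with
  | ReflectT h => z.1 (exist _ i h)
  | ReflectF _ => match @eqP _ j i with
    | ReflectT e => ecast k (X k) e z.2
    | ReflectF _ => point
    end
  end.

Lemma extendE (j i : 'I_m) (w : state X) : (i < j.+1)%N ->
  extend (past j w, w j) i = w i.
Proof.
rewrite /extend ltnS leq_eqVlt => ij.
case: {-}_ / idP => // nij; case: {-}_ / eqP => [e|]; first by case: _ / e.
by move: ij; rewrite (negbTE (introN idP nij)) orbF => /eqP e []; apply/val_inj.
Qed.

Lemma measurable_extend (j : 'I_m) :
  measurable_fun [set: past_space X j * borel (X j)] (@extend j).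
Proof.
apply: (@measurable_fun_prod_topology _ _ R 'I_m X) => // i; rewrite /extend.
case: {-}_ / idP => [h|_].
  have mproj := @measurable_proj_topology R {k : 'I_m | (k < j)%N}
    (fun k => X (val k)) (exist _ i h).
  exact: (measurableT_comp mproj measurable_fst).
case: {-}_ / eqP => [e|_]; last exact: measurable_cst.
by case: _ / e; exact: measurable_snd.
Qed.

Let coord (j : 'I_m) (w : state X) : borel (X j) := w j.

Lemma known_at0_cst (F : state X -> \bar R) : known_at (@past R m X) 0 F -> exists c, F = cst c.
Proof.
move=> [F1 F2]; exists (F point); apply/funext => w /=.
have [m0|m0] := posnP m.
  congr (F _); apply: functional_extensionality_dep => i; exfalso.
  by have := ltn_ord i; rewrite {2}m0.
have [f mf Ff] := F1 (Ordinal m0) erefl.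
rewrite !Ff; congr (f _); apply: functional_extensionality_dep => -[i hi].
by exfalso; move: hi; rewrite ltn0.
Qed.

Lemma known_atS_factor (j : 'I_m) (F : state X -> \bar R) : known_at (@past R m X) j.+1 F ->
  exists2 g : past_space X j * borel (X j) -> \bar R,
    measurable_fun [set: past_space X j * borel (X j)] g &
    forall w, F w = g (past j w, coord j w).
Proof.
move=> [F1 F2]; have := ltn_ord j; rewrite leq_eqVlt => /orP[/eqP jm|jm].
  exists (F \o @extend j).
    by apply: measurableT_comp; [exact: F2|exact: measurable_extend].
  move=> w /=; congr (F _); apply: functional_extensionality_dep => i.
  by rewrite extendE// jm.
have [f mf Ff] := F1 (Ordinal jm) erefl.
exists (f \o past (Ordinal jm) \o @extend j).
  apply: measurableT_comp; last exact: measurable_extend.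
  by apply: measurableT_comp => //; exact: measurable_past.
move=> w /=; rewrite Ff; congr (f _); apply: functional_extensionality_dep => -[i hi].
by rewrite /past/= extendE.
Qed.

End product_space.

Section product_experiment_lemmas.
Context {R : realType} {m : nat} (X : 'I_m -> completeMetricType R).
Hypothesis sepX : forall j, separable (X j).
Variables (P : probability (state X) R)
  (K : forall j, R.-pker (past_space X j) ~> (borel (X j))).
Hypothesis PK : forall j, is_cond_law P (K j).
Arguments PK : clear implicits.
Local Open Scope ereal_scope.

Let coord (j : 'I_m) (w : state X) : borel (X j) := w j.
Let mcoord (j : 'I_m) : measurable_fun [set: state X] (coord j).
Proof. exact: measurable_coord. Qed.

Arguments mcoord : clear implicits.

Lemma measurable_past_now (j : 'I_m) :
  measurable_fun [set: state X] (@past_now R m X j).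
Proof. by apply: measurable_fun_pair; [exact: measurable_past|exact: mcoord]. Qed.

Lemma lenglart_past (f : forall j, past_space X j * borel (X j) -> \bar R) (a b : R) :
  (forall j, measurable_fun setT (f j)) -> (forall j z, 0 <= f j z) ->
  (0 < a)%R -> (0 <= b)%R ->
  P [set w | a%:E < \sum_(j < m) f j (past_now j w)] <= (b / a)%:E +
  P [set w | b%:E < \sum_(j < m) \int[K j (past j w)]_v f j (past j w, v)].
Proof.
move=> mf f0 a0 b0.
exact: (@lenglart _ (state X) R P m _ _ (past_space X) (fun j => borel (X j))
  (@past R m X) coord K (@measurable_past R m X sepX) mcoord PK (past_adapted sepX)).
Qed.

Lemma martingale_tail_past (f : forall j, past_space X j * borel (X j) -> R) (a b : R) :
  (forall j, measurable_fun setT (f j)) -> (0 < a)%R -> (0 <= b)%R ->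
  P [set w | (a < `|\sum_(j < m) (f j (past_now j w) -
      fine (\int[K j (past j w)]_v (f j (past j w, v))%:E))|)%R]
  <= (b / a ^+ 2)%:E +
  P [set w | b%:E < \sum_(j < m) \int[K j (past j w)]_v (f j (past j w, v) ^+ 2)%:E].
Proof.
move=> mf a0 b0.
exact: (@martingale_tail _ (state X) R P m _ _ (past_space X) (fun j => borel (X j))
  (@past R m X) coord K (@measurable_past R m X sepX) mcoord PK (past_adapted sepX)).
Qed.

Lemma cond_exp_past (j : 'I_m) (f : past_space X j * borel (X j) -> \bar R) :
  measurable_fun setT f ->
  {ae P, forall w, cond_exp P (past_algebra j) (fun w => f (past_now j w)) w =
    \int[K j (past j w)]_v f (past j w, v)}.
Proof.
move=> mf.
have h := (@cond_exp_kernel _ _ _ (state X) (past_space X j) (borel (X j)) R P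
  (@past R m X j) (coord j) (K j) (@measurable_past R m X sepX j) (mcoord j) (PK j) f mf).
exact: h.
Qed.

Lemma measurable_cond_exp_past (j : 'I_m) (f : state X -> \bar R) :
  measurable_fun setT (cond_exp P (past_algebra j) f).
Proof.
exact: (@measurable_cond_exp _ _ (state X) (past_space X j) R P
  (@past R m X j) (@measurable_past R m X sepX j)).
Qed.

Lemma measurable_integral_past (j : 'I_m) (f : past_space X j * borel (X j) -> \bar R) :
  measurable_fun setT f -> (forall z, 0 <= f z) ->
  measurable_fun [set: state X] (fun w => \int[K j (past j w)]_v f (past j w, v)).
Proof.
move=> mf f0.
exact: measurableT_comp (measurable_integral_kernel (K j) mf f0) (@measurable_past R m X sepX j).
Qed.

End product_experiment_lemmas.

Section product_likelihood_ratio.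
Context {R : realType} {m : nat} (X : 'I_m -> completeMetricType R).
Hypothesis sepX : forall j, separable (X j).
Variables (P P' : probability (state X) R)
  (K K' : forall j, R.-pker (past_space X j) ~> (borel (X j))).
Variable nu : forall j, {sigma_finite_measure set (borel (X j)) -> \bar R}.
Variables p q : forall j, past_space X j * borel (X j) -> R.
Arguments p : clear implicits.
Arguments q : clear implicits.
Hypotheses (PK : forall j, is_cond_law P (K j)) (PK' : forall j, is_cond_law P' (K' j)).
Hypotheses (Knu : forall j x, K j x `<< nu j) (Knu' : forall j x, K' j x `<< nu j).
Hypotheses (Kp : forall j, is_cond_density (nu j) (K j) (p j))
  (Kq : forall j, is_cond_density (nu j) (K' j) (q j)).
Arguments Kp : clear implicits.
Arguments Kq : clear implicits.
Local Open Scope ereal_scope.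

Lemma likelihood_ratio_prod :
  is_likelihood_ratio P' P (likelihood_ratio P' P) /\
  {ae P, forall w, (forall j, p j (past_now j w) != 0%R) /\
    likelihood_ratio P' P w =
    (\prod_(j < m) (1 + root_ratio (p j) (q j) (past_now j w)) ^+ 2)%:E}.
Proof.
have mp j : measurable_fun setT (p j) by have [] := Kp j.
have mq j : measurable_fun setT (q j) by have [] := Kq j.
have p0 j z : (0 <= p j z)%R by have [] := Kp j.
have q0 j z : (0 <= q j z)%R by have [] := Kq j.
have KE j x B : measurable B -> K j x B = \int[nu j]_(v in B) (p j (x, v))%:E.
  by have [_ _] := Kp j; exact.
have KE' j x B : measurable B -> K' j x B = \int[nu j]_(v in B) (q j (x, v))%:E.
  by have [_ _] := Kq j; exact.
pose coord (j : 'I_m) (w : state X) : borel (X j) := w j.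
have mcoord (j : 'I_m) : measurable_fun [set: state X] (coord j) by exact: measurable_coord.
have isL := @sequential_ratio_is_likelihood_ratio _ (state X) R m _ _
  (past_space X) (fun j => borel (X j)) (@past R m X) coord (@measurable_past R m X sepX)
  mcoord (past_adapted sepX) (@known_at0_cst R m X) (@known_atS_factor R m X sepX)
  P P' K K' nu p q PK PK' mp mq p0 q0 Knu Knu' KE KE'.
have isLR : is_likelihood_ratio P' P (likelihood_ratio P' P).
  exact: (xgetPex (cst 0) (ex_intro _ _ isL)).
split => //.
have pne := @density_neq0_ae _ (state X) R m _ _
  (past_space X) (fun j => borel (X j)) (@past R m X) coord (@measurable_past R m X sepX)
  mcoord P K nu p PK mp p0 Knu KE.
have LE := likelihood_ratio_unique isLR isL.
apply: filterS2 pne LE => w pw ->; split => //.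
congr (_%:E); rewrite /sequential_ratio; apply: eq_bigr => j _.
have pj : p j (past_now j w) != 0%R by exact: pw.
rewrite /density_ratio /root_ratio -/(past_now j w) (negbTE pj).
by rewrite addrC subrK expr_div_n !sqr_sqrtr ?p0 ?q0.
Qed.

End product_likelihood_ratio.

(** * Expansion of the logarithm *)

(** Mean value theorem for [ln y - y + (y - 1) ^+ 2 / 2], whose derivative is
    [(y - 1) ^+ 2 / y], on the interval between 1 and [1 + x], where [y] is at
    least [1 / 2]. *)
Lemma ln_taylor2 (R : realType) (x : R) : `|x| <= 2^-1 ->
  `|ln (1 + x) - x + x ^+ 2 / 2| <= 2 * `|x| ^+ 3.
Proof.
move=> xh; have /andP[x1 x2] : - 2^-1 <= x <= 2^-1 by rewrite -ler_norml.
pose g (y : R) := ln y - y + (y - 1) ^+ 2 / 2.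
pose dg (y : R) := y^-1 - 1 + (y - 1).
have g1 : g 1 = -1 by rewrite /g ln1; lra.
have dE (y : R) : 0 < y -> is_derive y 1 g (dg y).
  move=> y0; have ? := is_derive1_ln y0.
  rewrite /g; apply: is_derive_eq.
  by rewrite /dg !scaler0 /GRing.scale/=; lra.
have bound (c : R) : 2^-1 <= c -> `|c - 1| <= `|x| -> `|dg c| <= 2 * `|x| ^+ 2.
  move=> c12 cx; have c0 : 0 < c by lra.
  have -> : dg c = (c - 1) ^+ 2 / c.
    by rewrite /dg; field; rewrite gt_eqF.
  rewrite normrM normrX normfV (gtr0_norm c0) ler_pdivrMr//.
  have : `|c - 1| ^+ 2 <= `|x| ^+ 2 by rewrite lerXn2r ?nnegrE.
  have := sqr_ge0 `|x|; set a := _ ^+ 2; set b := _ ^+ 2 => a0 ba; nra.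
have fin (c : R) : 2^-1 <= c -> `|c - 1| <= `|x| -> g (1 + x) - g 1 = dg c * x ->
    `|ln (1 + x) - x + x ^+ 2 / 2| <= 2 * `|x| ^+ 3.
  move=> c12 cx; rewrite g1 opprK /g => E.
  have -> : ln (1 + x) - x + x ^+ 2 / 2 = dg c * x.
    by rewrite -E; field.
  by rewrite normrM exprSr mulrA ler_wpM2r//; exact: bound.
have cont a b : 0 < a -> {within `[a, b], continuous g}.
  move=> a0; apply: derivable_within_continuous => y.
  rewrite in_itv/= => /andP[ay _].
  by have [] := dE y (lt_le_trans a0 ay).
have [x0|x0] := leP 0 x.
  have h1 : 1 <= 1 + x by lra.
  have dh y : y \in `]1, 1 + x[ -> is_derive y 1 g (dg y).
    by rewrite in_itv/= => /andP[y1 _]; apply: dE; lra.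
  have [c + E] := MVT_segment h1 dh (cont _ _ ltr01).
  rewrite in_itv/= => /andP[c1 c2]; apply: (fin c).
  - lra.
  - by rewrite !ger0_norm; lra.
  - by rewrite E; congr (_ * _); lra.
have h1 : 1 + x <= 1 by lra.
have x10 : 0 < 1 + x by lra.
have dh y : y \in `]1 + x, 1[ -> is_derive y 1 g (dg y).
  by rewrite in_itv/= => /andP[y1 _]; apply: dE; lra.
have [c + E] := MVT_segment h1 dh (cont _ _ x10).
rewrite in_itv/= => /andP[c1 c2]; apply: (fin c).
- lra.
- by rewrite (ltr0_norm x0) ler0_norm; lra.
- by rewrite -(opprK (g (1 + x) - g 1)) opprB E; lra.
Qed.

(** The deterministic core of the expansion. With [D = z - y], the quantity to
    bound is the sum of the Taylor remainders, of [2 (D - e)], of [2 e + v], and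
    of the differences [y^2 - z^2] and [v - y^2], and each of these five sums
    is controlled separately. Here [r] is the weight of
    [sqr_diff_le]: it is fixed first, according to [M], and then [b] is taken
    small. *)
Lemma log_ratio_expansion (R : realType) (m : nat) (z y e v : 'I_m -> R)
    (b M r : R) : 0 < b -> b <= 2^-1 -> b <= 1 -> 0 <= M -> 0 < r ->
  `|\sum_j (z j - y j - e j)| <= b -> \sum_j (z j - y j) ^+ 2 <= b ->
  `|\sum_j y j ^+ 2 - \sum_j v j| <= b -> \sum_j `|2 * e j + v j| <= b + r * M ->
  (forall j, `|z j| <= b) -> \sum_j v j <= M ->
  `|\sum_j 2 * ln (1 + z j) - 2 * \sum_j y j + 2 * \sum_j v j| <=
  b * (7 + r^-1 + r + 4 * (2 * M + 4)) + 2 * r * M.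
Proof.
move=> b0 b12 b1 M0 r0 Hde Hd2 Hy2 He Hz Hv.
set D2 := \sum_j (z j - y j) ^+ 2 in Hd2.
set Y2 := \sum_j y j ^+ 2 in Hy2.
set V := \sum_j v j in Hy2 Hv *.
pose Z2 := \sum_j z j ^+ 2.
pose rem := \sum_j (2 * (ln (1 + z j) - z j + z j ^+ 2 / 2)).
have Y2M : Y2 <= M + b by move: Hy2; rewrite ler_norml => /andP[_]; lra.
have D20 : 0 <= D2 by apply: sumr_ge0 => j _; exact: sqr_ge0.
have Y20 : 0 <= Y2 by apply: sumr_ge0 => j _; exact: sqr_ge0.
have Z2le : Z2 <= 2 * D2 + 2 * Y2.
  rewrite /Z2 /D2 /Y2 !mulr_sumr -big_split/=; apply: ler_sum => j _.
  by have := sqr_ge0 (z j - 2 * y j); nra.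
have remle : `|rem| <= 4 * b * Z2.
  apply: (le_trans (ler_norm_sum _ _ _)); rewrite /Z2 mulr_sumr; apply: ler_sum => j _.
  rewrite normrM (ger0_norm (ler0n R 2)).
  have := ln_taylor2 (le_trans (Hz j) b12).
  have : `|z j| ^+ 3 <= b * z j ^+ 2.
    by rewrite exprS real_normK ?num_real// ler_wpM2r ?sqr_ge0.
  lra.
have ZYle : `|Z2 - Y2| <= (1 + r^-1) * D2 + r * Y2.
  rewrite /Z2 /Y2 /D2 -sumrB !mulr_sumr -big_split/=.
  apply: (le_trans (ler_norm_sum _ _ _)); apply: ler_sum => j _.
  exact: sqr_diff_le.
have Hev : `|\sum_j (2 * e j + v j)| <= b + r * M.
  exact: le_trans (ler_norm_sum _ _ _) He.
have -> : \sum_j 2 * ln (1 + z j) - 2 * \sum_j y j + 2 * V =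
  rem + 2 * \sum_j (z j - y j - e j) + \sum_j (2 * e j + v j)
  - (Z2 - Y2) - (Y2 - V).
  rewrite /rem /Z2 /Y2 /V !mulr_sumr -!sumrB -!big_split/= -!sumrB.
  by apply: eq_bigr => j _; field.
apply: (le_trans (ler_normB _ _)).
have h1 : `|rem + 2 * \sum_j (z j - y j - e j) + \sum_j (2 * e j + v j) - (Z2 - Y2)|
   <= 4 * b * Z2 + 2 * b + (b + r * M) + ((1 + r^-1) * D2 + r * Y2).
  apply: (le_trans (ler_normB _ _)); apply: lerD => //.
  apply: (le_trans (ler_normD _ _)); apply: lerD => //.
  apply: (le_trans (ler_normD _ _)); apply: lerD => //.
  by rewrite normrM (ger0_norm (ler0n R 2)) ler_wpM2l.
have rV0 : 0 < r^-1 by rewrite invr_gt0.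
have h2 : (1 + r^-1) * D2 <= (1 + r^-1) * b by rewrite ler_wpM2l// addr_ge0// ltW.
have h3 : r * Y2 <= r * (M + b) by rewrite ler_wpM2l// ltW.
have h4 : b * Z2 <= b * (2 * M + 4) by rewrite ler_wpM2l ?ltW//; lra.
lra.
Qed.

Lemma ln_prod_sqr (R : realType) (m : nat) (z : 'I_m -> R) :
  (forall j, 0 < 1 + z j) ->
  0 < \prod_j (1 + z j) ^+ 2 /\
  ln (\prod_j (1 + z j) ^+ 2) = \sum_j 2 * ln (1 + z j).
Proof.
move=> z0; apply: (big_ind2 (fun a b => 0 < a /\ ln a = b)).
- by rewrite ln1.
- by move=> a b c d [a0 <-] [c0 <-]; rewrite mulr_gt0// lnM ?posrE.
- move=> j _; rewrite exprn_gt0// lnXn//; split => //.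
  by rewrite mulr_natl.
Qed.

(** * Events of probability tending to one *)

Section with_high_probability.
Context {R : realType} {disp : nat -> measure_display}
  {S : forall n, measurableType (disp n)}.
Variable P : forall n, probability (S n) R.
Local Open Scope ereal_scope.

(** The complement of [E] is only required to be contained in a small measurable
    event, so that measurability of [E] itself never has to be checked. *)
Definition exceptional_le n (d : R) (E : set (S n)) :=
  exists A, [/\ measurable A, ~` E `<=` A & P n A <= d%:E].

Definition whp (E : forall n, set (S n)) := forall d : R, (0 < d)%R ->
  \forall n \near \oo, exceptional_le d (E n).

Lemma exceptional_leI n (d1 d2 : R) (E F G : set (S n)) :
  (forall w, E w -> F w -> G w) -> exceptional_le d1 E -> exceptional_le d2 F ->
  exceptional_le (d1 + d2) G.
Proof.
move=> EFG [A [mA EA PA]] [B [mB FB PB]]; exists (A `|` B); split.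
- exact: measurableU.
- move=> w nG; have [Ew|nE] := pselect (E w); last by left; exact: EA.
  by right; apply: FB => Fw; apply: nG; exact: EFG.
- by rewrite (le_trans (measureU2 _ mA mB))// EFinD leeD.
Qed.

Lemma exceptional_le_ae n (E : set (S n)) : {ae P n, forall w, E w} ->
  forall d, (0 < d)%R -> exceptional_le d E.
Proof.
move=> [A [mA PA EA]] d d0; exists A; split => //.
by rewrite [X in X <= _]PA lee_fin ltW.
Qed.

Lemma exceptional_le_measurable n (d : R) (E F : set (S n)) :
  measurable F -> F `<=` ~` E -> exceptional_le d E -> P n F <= d%:E.
Proof.
move=> mF FE [A [mA EA PA]]; apply: le_trans PA.
by apply: le_measure; rewrite ?inE// => w /FE /EA.
Qed.

Lemma whp_ae (E : forall n, set (S n)) :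
  (\forall n \near \oo, {ae P n, forall w, E n w}) -> whp E.
Proof. by move=> aE d d0; apply: filterS aE => n /exceptional_le_ae; exact. Qed.

Lemma whpI (E F G : forall n, set (S n)) :
  (\forall n \near \oo, forall w, E n w -> F n w -> G n w) ->
  whp E -> whp F -> whp G.
Proof.
move=> EFG hE hF d d0; have d20 : (0 < d / 2)%R by rewrite divr_gt0.
move: EFG (hE _ d20) (hF _ d20); apply: filterS3 => n EFG eE eF.
by rewrite (splitr d); exact: exceptional_leI eE eF.
Qed.

Lemma whpS (E G : forall n, set (S n)) :
  (\forall n \near \oo, forall w, E n w -> G n w) -> whp E -> whp G.
Proof.
move=> EG hE; apply: (whpI _ hE hE).
by apply: filterS EG => n EG w Ew _; exact: EG.
Qed.

Lemma whp_and (E F : forall n, set (S n)) :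
  whp E -> whp F -> whp (fun n => E n `&` F n).
Proof. by apply: whpI; apply: nearW => n w Ew Fw. Qed.

Lemma cvg_prob0P (F : forall n, set (S n)) :
  (fun n => P n (F n)) @ \oo --> 0 <->
  (forall d : R, (0 < d)%R -> \forall n \near \oo, P n (F n) <= d%:E).
Proof.
split=> [cF d d0|h].
  move: cF => /fine_cvgP[finF /cvgrPdist_le/(_ _ d0)].
  move: finF; apply: filterS2 => n finF /=; rewrite sub0r normrN => h.
  rewrite -(fineK finF) lee_fin; apply: le_trans h; exact: ler_norm.
apply/fine_cvgP; split.
  apply: filterS (h _ ltr01) => n Pn; rewrite ge0_fin_numE//.
  by apply: le_lt_trans Pn (ltry _).
apply/cvgrPdist_le => d d0; apply: filterS (h _ d0) => n Pn /=.
have finF : P n (F n) \is a fin_num by rewrite ge0_fin_numE//; exact: le_lt_trans Pn (ltry _).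
by rewrite sub0r normrN ger0_norm ?fine_ge0// -lee_fin fineK.
Qed.

Lemma whp_of_cvg (Z : forall n, S n -> \bar R) :
  (\forall n \near \oo, measurable_fun [set: S n] (Z n)) ->
  cvg_to0_in_prob P Z ->
  forall e : R, (0 < e)%R -> whp (fun n => [set w | `|Z n w| <= e%:E]).
Proof.
move=> mZ cZ e e0 d d0; have /cvg_prob0P/(_ _ d0) := cZ e e0.
move: mZ; apply: filterS2 => n mZ Pn; exists [set w | e%:E < `|Z n w|]; split => //.
  rewrite -[X in measurable X]setTI; apply: emeasurable_fun_o_infty => //.
  exact: measurableT_comp.
by move=> w /= /negP; rewrite -ltNge.
Qed.

Lemma cvg_of_whp (Z : forall n, S n -> \bar R) :
  (\forall n \near \oo, measurable_fun [set: S n] (Z n)) ->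
  (forall e : R, (0 < e)%R -> whp (fun n => [set w | `|Z n w| <= e%:E])) ->
  cvg_to0_in_prob P Z.
Proof.
move=> mZ hZ e e0; apply/cvg_prob0P => d d0.
move: mZ (hZ _ e0 _ d0); apply: filterS2 => n mZ; apply: exceptional_le_measurable.
  rewrite -[X in measurable X]setTI; apply: emeasurable_fun_o_infty => //.
  exact: measurableT_comp.
by move=> w /= h; apply/negP; rewrite -ltNge.
Qed.

(** The form in which the tail inequalities are used: a bound of [b * k] up to the
    probability that the compensator [c] exceeds [b], with [b] arbitrary. *)
Lemma whp_domination (k : R) (c : forall n, S n -> \bar R)
    (E : forall n, set (S n)) : (0 < k)%R ->
  (\forall n \near \oo, [/\ measurable (E n), measurable_fun [set: S n] (c n) &
    forall b : R, (0 < b)%R ->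
      P n (~` E n) <= (b * k)%:E + P n [set w | b%:E < c n w]]) ->
  (forall b : R, (0 < b)%R -> whp (fun n => [set w | c n w <= b%:E])) ->
  whp E.
Proof.
move=> k0 hE hc d d0; pose b := (d / 2 / k)%R.
have b0 : (0 < b)%R by rewrite !divr_gt0.
have d20 : (0 < d / 2)%R by rewrite divr_gt0.
move: hE (hc b b0 _ d20); apply: filterS2 => n [mE mc PE] ec.
exists (~` E n); split => //; first exact: measurableC.
rewrite (splitr d) EFinD; apply: (le_trans (PE b b0)).
rewrite /b divfK ?gt_eqF//; apply: leeD => //.
apply: exceptional_le_measurable ec.
  by rewrite -[X in measurable X]setTI; apply: emeasurable_fun_o_infty.
by move=> w /= h; apply/negP; rewrite -ltNge.
Qed.

Definition tight (T : forall n, S n -> \bar R) := forall d : R, (0 < d)%R ->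
  exists2 M : R, (0 < M)%R &
    \forall n \near \oo, exceptional_le d [set w | T n w <= M%:E].

(** To show that an event is likely one may assume a tight sequence bounded, with
    constants depending on the bound. *)
Lemma whp_tight (T : forall n, S n -> \bar R) (E : forall n, set (S n)) :
  tight T ->
  (forall M : R, (0 < M)%R -> whp (fun n => [set w | T n w <= M%:E -> E n w])) ->
  whp E.
Proof.
move=> tT h d d0; have d20 : (0 < d / 2)%R by rewrite divr_gt0.
have [M M0 tM] := tT _ d20.
move: tM (h M M0 _ d20); apply: filterS2 => n e1 e2.
rewrite (splitr d); apply: exceptional_leI e1 e2 => w Tw; exact.
Qed.

End with_high_probability.

Lemma tight_ae_le (R : realType) (disp : nat -> measure_display)
    (S : forall n, measurableType (disp n)) (P : forall n, probability (S n) R)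
    (T T' : forall n, S n -> \bar R) :
  (\forall n \near \oo, {ae P n, forall w, T' n w <= T n w}%E) ->
  tight P T -> tight P T'.
Proof.
move=> TT tT e e0; have e20 : 0 < e / 2 by rewrite divr_gt0.
have [M M0 tM] := tT _ e20; exists M => //.
move: TT tM; apply: filterS2 => n TT tM; rewrite (splitr e).
apply: exceptional_leI tM (exceptional_le_ae TT e20) => w /= TM T'T.
exact: le_trans TM.
Qed.

(** * Expansion of the log-likelihood *)

Section expansion.
Context {R : realType} {m : nat -> nat}.
Variable X : forall n, 'I_(m n) -> completeMetricType R.
Hypothesis sepX : forall n j, separable (X (n := n) j).
Variables P0 P1 : forall n, probability (state (@X n)) R.
Variable mu : forall n (j : 'I_(m n)), {sigma_finite_measure set (borel (X j)) -> \bar R}.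
Variables K0 K1 : forall n (j : 'I_(m n)),
  R.-pker (past_space (@X n) j) ~> (borel (X j)).
Variables p0 p1 p2 t : forall n (j : 'I_(m n)),
  past_space (@X n) j * borel (X j) -> R.
Arguments mu : clear implicits.
Arguments K0 : clear implicits.
Arguments K1 : clear implicits.
Arguments p0 : clear implicits.
Arguments p1 : clear implicits.
Arguments p2 : clear implicits.
Arguments t : clear implicits.
Local Open Scope ereal_scope.

Hypothesis law0 : forall n j, is_cond_law (P0 n) (K0 n j).
Hypothesis dom0 : forall n j x, K0 n j x `<< mu n j.
Hypothesis dens0 : forall n j, is_cond_density (mu n j) (K0 n j) (p0 n j).
Hypothesis valid1 : \forall n \near \oo,
  [/\ forall j, is_cond_law (P1 n) (K1 n j),
      forall j x, K1 n j x `<< mu n j,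
      forall j, is_cond_density (mu n j) (K1 n j) (p1 n j) &
      forall j, measurable_fun setT (p2 n j)].
Hypothesis mt : forall n j, measurable_fun setT (t n j).
Arguments law0 : clear implicits.
Arguments dom0 : clear implicits.
Arguments dens0 : clear implicits.
Arguments mt : clear implicits.

Let y n j := rel_score (p0 n j) (t n j).
Let D n j := remainder (p0 n j) (p1 n j) (t n j).
Arguments y : clear implicits.
Arguments D : clear implicits.

Hypothesis A1p : cvg_to0_in_prob P0 (fun n w => \sum_(j < m n) \int[mu n j]_x
  (((Num.sqrt (p1 n j (past j w, x)) - Num.sqrt (p0 n j (past j w, x)))
    - t n j (past j w, x)) ^+ 2)%:E).
Hypothesis A1m : cvg_to0_in_prob P0 (fun n w => \sum_(j < m n) \int[mu n j]_x
  (((Num.sqrt (p2 n j (past j w, x)) - Num.sqrt (p0 n j (past j w, x)))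
    + t n j (past j w, x)) ^+ 2)%:E).
Hypothesis A2 : \forall n \near \oo, forall j, {ae P0 n, forall w,
  \int[K0 n j (past j w)]_v (y n j (past j w, v) ^+ 2)%:E < +oo /\
  \int[K0 n j (past j w)]_v (y n j (past j w, v))%:E = 0}.
Hypothesis A3 : forall e b : R, (0 < e)%R -> (0 < b)%R ->
  whp P0 (fun n => [set w | \sum_(j < m n) \int[K0 n j (past j w)]_v
    (if (e < `|y n j (past j w, v)|)%R then y n j (past j w, v) ^+ 2 else 0)%:E <= b%:E]).
Hypothesis A4 : tight P0 (fun n w => \sum_(j < m n)
  \int[K0 n j (past j w)]_v (y n j (past j w, v) ^+ 2)%:E).

Let mp0 n j : measurable_fun setT (p0 n j). Proof. by have [] := dens0 n j. Qed.
Let p00 n j z : (0 <= p0 n j z)%R. Proof. by have [_ + _] := dens0 n j; exact. Qed.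
Arguments mp0 : clear implicits.
Arguments p00 : clear implicits.
Let my n j : measurable_fun setT (y n j).
Proof. by apply: measurable_rel_score; [exact: mp0|exact: mt]. Qed.
Arguments my : clear implicits.

Let mpast n j : measurable_fun setT (@past R (m n) (@X n) j).
Proof. by apply: measurable_past; exact: sepX. Qed.
Arguments mpast : clear implicits.

Let mpast_now n j : measurable_fun setT (@past_now R (m n) (@X n) j).
Proof. by apply: measurable_past_now; exact: sepX. Qed.
Arguments mpast_now : clear implicits.

Let msq n j (f : past_space (@X n) j * borel (X j) -> R) :
  measurable_fun setT f -> measurable_fun setT (fun z => (f z ^+ 2)%:E).
Proof. by move=> mf; apply/measurable_EFinP; exact: measurable_funX. Qed.

Let measurable_mu_integral n j (f : past_space (@X n) j * borel (X j) -> R) :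
  measurable_fun setT f -> (forall z, (0 <= f z)%R) ->
  measurable_fun setT (fun w => \int[mu n j]_x (f (past j w, x))%:E).
Proof.
move=> mf f0.
have mfE : measurable_fun setT (EFin \o f) by exact/measurable_EFinP.
have f0E z : 0 <= (EFin \o f) z by rewrite lee_fin.
exact: measurableT_comp (measurable_fun_fubini_tonelli_F (m2 := mu n j) _ mfE f0E) (mpast n j).
Qed.

Let valid n := [/\ forall j, is_cond_law (P1 n) (K1 n j),
      forall j x, K1 n j x `<< mu n j,
      forall j, is_cond_density (mu n j) (K1 n j) (p1 n j) &
      forall j, measurable_fun setT (p2 n j)].

Let a1 n w := \sum_(j < m n) \int[mu n j]_x
  (((Num.sqrt (p1 n j (past j w, x)) - Num.sqrt (p0 n j (past j w, x)))
    - t n j (past j w, x)) ^+ 2)%:E.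
Let a2 n w := \sum_(j < m n) \int[mu n j]_x
  (((Num.sqrt (p2 n j (past j w, x)) - Num.sqrt (p0 n j (past j w, x)))
    + t n j (past j w, x)) ^+ 2)%:E.
Let ED n w := \sum_(j < m n) \int[K0 n j (past j w)]_v (D n j (past j w, v) ^+ 2)%:E.
Let EY n w := \sum_(j < m n) \int[K0 n j (past j w)]_v (y n j (past j w, v) ^+ 2)%:E.
Let e n j w := fine (\int[K0 n j (past j w)]_v (D n j (past j w, v))%:E).
Let v n j w := fine (\int[K0 n j (past j w)]_v (y n j (past j w, v) ^+ 2)%:E).
Arguments a1 : clear implicits.
Arguments a2 : clear implicits.
Arguments ED : clear implicits.
Arguments EY : clear implicits.
Arguments e : clear implicits.
Arguments v : clear implicits.

Let mp1 n : valid n -> forall j, measurable_fun setT (p1 n j).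
Proof. by move=> [_ _ d _] j; have [] := d j. Qed.

Arguments mp1 : clear implicits.

Let mD n : valid n -> forall j, measurable_fun setT (D n j).
Proof. by move=> V j; apply: measurable_remainder => //; exact: mp1. Qed.

Arguments mD : clear implicits.

Let section_measurable n j x (f : past_space (@X n) j * borel (X j) -> R) :
  measurable_fun setT f -> measurable_fun [set: borel (X j)] (fun z => f (x, z)).
Proof. by move=> mf; exact: measurableT_comp mf (measurable_pair1 x). Qed.

Arguments section_measurable {n j} x {f} _.

Let section_sq n j x (f : past_space (@X n) j * borel (X j) -> R) :
  measurable_fun setT f ->
  measurable_fun [set: borel (X j)] (fun z => (f (x, z) ^+ 2)%:E).
Proof.
move=> mf; apply/measurable_EFinP; apply: measurable_funX.
exact: section_measurable.
Qed.
Arguments section_sq {n j} x {f} _.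

Let measurable_a1 n : valid n -> measurable_fun setT (a1 n).
Proof.
move=> V; apply: emeasurable_sum => j; apply: (measurable_mu_integral (f := fun z =>
  ((Num.sqrt (p1 n j z) - Num.sqrt (p0 n j z) - t n j z) ^+ 2)%R)).
  apply: measurable_funX; apply: measurable_funB => //.
  by apply: measurable_funB; apply: measurable_fun_sqrt => //; exact: mp1.
by move=> z; exact: sqr_ge0.
Qed.

Let measurable_a2 n : valid n -> measurable_fun setT (a2 n).
Proof.
move=> V; apply: emeasurable_sum => j; apply: (measurable_mu_integral (f := fun z =>
  ((Num.sqrt (p2 n j z) - Num.sqrt (p0 n j z) + t n j z) ^+ 2)%R)).
  apply: measurable_funX; apply: measurable_funD => //.
  apply: measurable_funB; apply: measurable_fun_sqrt => //.
  by case: V => _ _ _; exact.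
by move=> z; exact: sqr_ge0.
Qed.

Let a1_ge0 n w : 0 <= a1 n w.
Proof.
by apply: sume_ge0 => j _; apply: integral_ge0 => z _; rewrite lee_fin sqr_ge0.
Qed.

Let a2_ge0 n w : 0 <= a2 n w.
Proof.
by apply: sume_ge0 => j _; apply: integral_ge0 => z _; rewrite lee_fin sqr_ge0.
Qed.

(** The conditional second moments of the remainders are dominated by
    [assumption_A1]. *)
Let ED_le n w : valid n -> ED n w <= a1 n w.
Proof.
move=> V; apply: lee_sum => j _; have [_ _ KE] := dens0 n j.
have pr : K0 n j (past j w) setT = 1 by exact: prob_kernel.
exact: (integral_sqr_remainder_le (section_measurable (past j w) (mp0 n j))
  (section_measurable (past j w) (mp1 n V j)) (section_measurable (past j w) (mt n j))
  (fun z => p00 n j (past j w, z)) pr (dom0 n j (past j w)) (KE (past j w))).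
Qed.

(** [drift_le] summed over the steps, with the singular masses bounded by
    [assumption_A1] at
    the local parameter and at its opposite. *)
Let total_drift_le n w (r : R) : valid n -> (0 < r)%R ->
  (forall j, \int[K0 n j (past j w)]_z (y n j (past j w, z) ^+ 2)%:E < +oo /\
    \int[K0 n j (past j w)]_z (y n j (past j w, z))%:E = 0) ->
  (\sum_(j < m n) `|2 * e n j w + v n j w|)%:E <=
  (3 + r^-1)%:E * a1 n w + r%:E * EY n w + 2%:E * a2 n w.
Proof.
move=> V r0 Yw; rewrite -sumEFin.
have I0 d' (T : measurableType d') (nu : {measure set T -> \bar R}) (f : T -> R) :
    0 <= \int[nu]_z (f z ^+ 2)%:E.
  by apply: integral_ge0 => z _; rewrite lee_fin sqr_ge0.
rewrite !ge0_sume_distrr; try by move=> j _; exact: I0.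
rewrite -!big_split/=; apply: lee_sum => j _.
have [_ _ KE0] := dens0 n j; have [law1 dom1 dens1 mp2] := V.
have [_ q0 KE1] := dens1 j.
have pr : K0 n j (past j w) setT = 1 by exact: prob_kernel.
have q1 : \int[mu n j]_z (p1 n j (past j w, z))%:E = 1.
  by rewrite -KE1//; exact: prob_kernel.
have [Yoo Y0] := Yw j.
pose x := past j w.
have mpx := section_measurable x (mp0 n j).
have mqx := section_measurable x (mp1 n V j).
have mtx := section_measurable x (mt n j).
have p0x z : (0 <= p0 n j (x, z))%R by exact: p00.
have q0x z : (0 <= p1 n j (x, z))%R by exact: q0.
pose ID := \int[K0 n j x]_z (D n j (x, z) ^+ 2)%:E.
pose IY := \int[K0 n j x]_z (y n j (x, z) ^+ 2)%:E.
pose IS := \int[mu n j]_z (singular_part (p0 n j) (p1 n j) (x, z))%:E.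
pose A1 := \int[mu n j]_z
  ((Num.sqrt (p1 n j (x, z)) - Num.sqrt (p0 n j (x, z)) - t n j (x, z)) ^+ 2)%:E.
pose A2' := \int[mu n j]_z
  ((Num.sqrt (p2 n j (x, z)) - Num.sqrt (p0 n j (x, z)) + t n j (x, z)) ^+ 2)%:E.
have h1 : (`|2 * e n j w + v n j w|)%:E <= (1 + r^-1)%:E * ID + r%:E * IY + IS.
  exact: (drift_le mpx mqx mtx p0x q0x pr (dom0 n j x) (KE0 x) q1 r0 Yoo Y0).
have h2 : ID <= A1.
  exact: (integral_sqr_remainder_le mpx mqx mtx p0x pr (dom0 n j x) (KE0 x)).
have h3 : IS <= 2%:E * A1 + 2%:E * A2'.
  exact: (integral_singular_part_le (mu n j) mpx mqx
    (section_measurable x (mp2 j)) mtx p0x q0x).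
apply: (le_trans h1); rewrite -/x -/A1 -/A2' -/IY.
have A10 : 0 <= A1 by exact: I0.
have rV : (0 <= 1 + r^-1)%R by rewrite addr_ge0// invr_ge0 ltW.
rewrite (_ : (3 + r^-1)%:E = (1 + r^-1)%:E + 2%:E); last by rewrite -EFinD; congr (_%:E); lra.
rewrite ge0_muleDl// ?lee_fin//.
apply: (@le_trans _ _ ((1 + r^-1)%:E * A1 + r%:E * IY + (2%:E * A1 + 2%:E * A2'))).
  by apply: leeD => //; apply: leeD2r; exact: lee_wpmul2l.
by rewrite addeACA addeA.
Qed.

Let whp_lenglart (f : forall n (j : 'I_(m n)), past_space (@X n) j * borel (X j) -> \bar R) :
  (\forall n \near \oo, forall j, measurable_fun setT (f n j)) ->
  (forall n j z, 0 <= f n j z) ->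
  (forall b : R, (0 < b)%R -> whp P0 (fun n => [set w |
    \sum_(j < m n) \int[K0 n j (past j w)]_z f n j (past j w, z) <= b%:E])) ->
  forall a : R, (0 < a)%R -> whp P0 (fun n => [set w |
    \sum_(j < m n) f n j (past_now j w) <= a%:E]).
Proof.
move=> mf f0 hf a a0.
have k0 : (0 < a^-1)%R by rewrite invr_gt0.
apply: (whp_domination k0 _ hf).
apply: filterS mf => n mf; split.
- rewrite -[X in measurable X]setTI; apply: emeasurable_fun_infty_c => //.
  by apply: emeasurable_sum => j; exact: measurableT_comp (mf j) (mpast_now n j).
- apply: emeasurable_sum => j.
  exact: (@measurable_integral_past R (m n) (@X n) (sepX (n := n)) (K0 n) j
    (f n j) (mf j) (f0 n j)).
- move=> b b0; rewrite (_ : ~` _ = [set w | a%:E < \sum_(j < m n) f n j (past_now j w)]).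
    exact: (lenglart_past (sepX (n := n)) (law0 n) mf (f0 n) a0 (ltW b0)).
  by apply/seteqP; split => w /=; rewrite ltNge => /negP.
Qed.

Let mdrift n j (f : past_space (@X n) j * borel (X j) -> R) :
  measurable_fun setT f -> measurable_fun setT (fun w =>
    fine (\int[K0 n j (past j w)]_z (f (past j w, z))%:E)).
Proof.
move=> mf; apply: (measurableT_comp (fine_measurable measurableT)) => //.
have mfE : measurable_fun setT (EFin \o f) by exact/measurable_EFinP.
rewrite (_ : (fun w => _) = fun w =>
    \int[K0 n j (past j w)]_z (EFin \o f)^\+ (past j w, z) -
    \int[K0 n j (past j w)]_z (EFin \o f)^\- (past j w, z)).
  apply: emeasurable_funB.
    exact: (@measurable_integral_past R (m n) (@X n) (sepX (n := n)) (K0 n) j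
      _ (measurable_funepos mfE) (fun=> funepos_ge0 _ _)).
  exact: (@measurable_integral_past R (m n) (@X n) (sepX (n := n)) (K0 n) j
    _ (measurable_funeneg mfE) (fun=> funeneg_ge0 _ _)).
apply/funext => w; rewrite integralE; congr (_ - _); apply: eq_integral => z _.
  by rewrite !funeposE.
by rewrite !funenegE.
Qed.

Let whp_martingale (f : forall n (j : 'I_(m n)), past_space (@X n) j * borel (X j) -> R) :
  (\forall n \near \oo, forall j, measurable_fun setT (f n j)) ->
  (forall b : R, (0 < b)%R -> whp P0 (fun n => [set w |
    \sum_(j < m n) \int[K0 n j (past j w)]_z (f n j (past j w, z) ^+ 2)%:E <= b%:E])) ->
  forall a : R, (0 < a)%R -> whp P0 (fun n => [set w |
    (`|\sum_(j < m n) (f n j (past_now j w) -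
      fine (\int[K0 n j (past j w)]_z (f n j (past j w, z))%:E))| <= a)%R]).
Proof.
move=> mf hf a a0.
have k0 : (0 < (a ^+ 2)^-1)%R by rewrite invr_gt0 exprn_gt0.
apply: (whp_domination k0 _ hf).
apply: filterS mf => n mf; split.
- rewrite -[X in measurable X]setTI; apply: measurable_fun_ler => //.
  apply: measurableT_comp => //; apply: measurable_sum => j.
  apply: measurable_funB; last exact: mdrift.
  exact: measurableT_comp (mf j) (mpast_now n j).
- apply: emeasurable_sum => j.
  have f20 z : 0 <= (f n j z ^+ 2)%:E by rewrite lee_fin sqr_ge0.
  exact: (@measurable_integral_past R (m n) (@X n) (sepX (n := n)) (K0 n) j
    _ (msq (mf j)) f20).
- move=> b b0; rewrite (_ : ~` _ = [set w | (a < `|\sum_(j < m n) (f n j (past_now j w) -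
      fine (\int[K0 n j (past j w)]_z (f n j (past j w, z))%:E))|)%R]).
    exact: (martingale_tail_past (sepX (n := n)) (law0 n) mf a0 (ltW b0)).
  by apply/seteqP; split => w /=; rewrite ltNge => /negP.
Qed.

Let whp_a1 (b : R) : (0 < b)%R -> whp P0 (fun n => [set w | a1 n w <= b%:E]).
Proof.
move=> b0; have ma : \forall n \near \oo, measurable_fun setT (a1 n).
  by apply: filterS valid1 => n; exact: measurable_a1.
apply: whpS (whp_of_cvg ma A1p b0); apply: nearW => n w /=.
by rewrite gee0_abs//; exact: a1_ge0.
Qed.

Let whp_a2 (b : R) : (0 < b)%R -> whp P0 (fun n => [set w | a2 n w <= b%:E]).
Proof.
move=> b0; have ma : \forall n \near \oo, measurable_fun setT (a2 n).
  by apply: filterS valid1 => n; exact: measurable_a2.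
apply: whpS (whp_of_cvg ma A1m b0); apply: nearW => n w /=.
by rewrite gee0_abs//; exact: a2_ge0.
Qed.

Let whp_ED (b : R) : (0 < b)%R -> whp P0 (fun n => [set w | ED n w <= b%:E]).
Proof.
move=> b0; apply: whpS (whp_a1 b0); apply: filterS valid1 => n V w /=.
by apply: le_trans; exact: ED_le.
Qed.

Let near_mD : \forall n \near \oo, forall j, measurable_fun setT (D n j).
Proof. by apply: filterS valid1 => n V; exact: mD. Qed.

Let whp_D2 (b : R) : (0 < b)%R ->
  whp P0 (fun n => [set w | (\sum_(j < m n) D n j (past_now j w) ^+ 2 <= b)%R]).
Proof.
move=> b0.
have := @whp_lenglart (fun n j z => (D n j z ^+ 2)%:E) _ _ whp_ED b b0.
move=> h; apply: (whpS _ (h _ _)).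
- by apply: nearW => n w /=; rewrite sumEFin lee_fin.
- by apply: filterS near_mD => n mD' j; exact: msq.
- by move=> n j z; rewrite lee_fin sqr_ge0.
Qed.

Let whp_De (b : R) : (0 < b)%R -> whp P0 (fun n => [set w |
  (`|\sum_(j < m n) (D n j (past_now j w) - e n j w)| <= b)%R]).
Proof. exact: whp_martingale near_mD whp_ED b. Qed.

(** The Lindeberg condition controls the squares of the scores larger than [c];
    the other ones are bounded, and their centred sums form a martingale. *)
Let big_sq (c : R) n j z := (if (c < `|y n j z|)%R then y n j z ^+ 2 else 0)%R.
Let small_sq (c : R) n j z := (if (c < `|y n j z|)%R then 0 else y n j z ^+ 2)%R.
Arguments big_sq : clear implicits.
Arguments small_sq : clear implicits.

Let measurable_gt_y (c : R) n j : measurable_fun setT (fun z => (c < `|y n j z|)%R).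
Proof. by apply: measurable_fun_ltr => //; exact: measurableT_comp. Qed.

Let measurable_big (c : R) n j : measurable_fun setT (big_sq c n j).
Proof.
apply: measurable_fun_ifT; [exact: measurable_gt_y|exact: measurable_funX|exact: measurable_cst].
Qed.

Let measurable_small (c : R) n j : measurable_fun setT (small_sq c n j).
Proof.
apply: measurable_fun_ifT; [exact: measurable_gt_y|exact: measurable_cst|exact: measurable_funX].
Qed.

Arguments measurable_big : clear implicits.
Arguments measurable_small : clear implicits.

Let whp_big (c a : R) : (0 < c)%R -> (0 < a)%R ->
  whp P0 (fun n => [set w | (\sum_(j < m n) big_sq c n j (past_now j w) <= a)%R]).
Proof.
move=> c0 a0.
have h := @whp_lenglart (fun n j z => (big_sq c n j z)%:E) _ _ (fun b => @A3 c b c0) a a0.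
apply: (whpS _ (h _ _)).
- by apply: nearW => n w /=; rewrite sumEFin lee_fin.
- by apply: nearW => n j; apply/measurable_EFinP; exact: measurable_big.
- by move=> n j z; rewrite lee_fin /big_sq; case: ifP => // _; exact: sqr_ge0.
Qed.

(** The truncated squares are at most [c ^+ 2], so their conditional second
    moments add up to at most [c ^+ 2] times the sum of the conditional moments of
    [y ^+ 2], which is tight; a small [c] makes [martingale_tail] effective. *)
Let small_martingale (a d : R) : (0 < a)%R -> (0 < d)%R ->
  exists2 c : R, (0 < c)%R & \forall n \near \oo, exceptional_le P0 d
    [set w : state (@X n) | (`|\sum_(j < m n) (small_sq c n j (past_now j w) -
      fine (\int[K0 n j (past j w)]_z (small_sq c n j (past j w, z))%:E))| <= a)%R].
Proof.
move=> a0 d0; have d20 : (0 < d / 2)%R by rewrite divr_gt0.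
have [M M0 tM] := A4 d20.
(* The value for which [c2 * M / a ^+ 2], the bound of [martingale_tail], is [d / 2]. *)
pose c2 := (d / 2 * a ^+ 2 / M)%R.
have c20 : (0 < c2)%R by rewrite divr_gt0// mulr_gt0// exprn_gt0.
exists (Num.sqrt c2); first by rewrite sqrtr_gt0.
apply: filterS tM => n tM; set c := Num.sqrt c2.
have c2E : (c ^+ 2 = c2)%R by rewrite sqr_sqrtr// ltW.
exists [set w | (a < `|\sum_(j < m n) (small_sq c n j (past_now j w) -
      fine (\int[K0 n j (past j w)]_z (small_sq c n j (past j w, z))%:E))|)%R]; split.
- rewrite -[X in measurable X]setTI; apply: measurable_fun_ltr => //.
  apply: measurableT_comp => //; apply: measurable_sum => j.
  apply: measurable_funB; last by apply: mdrift; exact: measurable_small.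
  exact: measurableT_comp (measurable_small c n j) (mpast_now n j).
- by move=> w /= /negP; rewrite -ltNge.
have b0 : (0 <= c2 * M)%R by rewrite mulr_ge0// ltW.
apply: (le_trans (martingale_tail_past (sepX (n := n)) (law0 n)
  (measurable_small c n) a0 b0)).
rewrite (splitr d) EFinD; apply: leeD.
  by rewrite lee_fin /c2 divfK ?gt_eqF// mulfK// gt_eqF// exprn_gt0.
apply: exceptional_le_measurable tM.
  rewrite -[X in measurable X]setTI; apply: emeasurable_fun_o_infty => //.
  apply: emeasurable_sum => j.
  have f20 z : 0 <= (small_sq c n j z ^+ 2)%:E by rewrite lee_fin sqr_ge0.
  exact: (@measurable_integral_past R (m n) (@X n) (sepX (n := n)) (K0 n) j
    _ (msq (measurable_small c n j)) f20).
move=> w /= h; apply/negP; rewrite -ltNge.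
rewrite -(@lte_pmul2l _ c2%:E)// -EFinM; apply: (lt_le_trans h).
rewrite ge0_sume_distrr; last first.
  by move=> j _; apply: integral_ge0 => z _; rewrite lee_fin sqr_ge0.
apply: lee_sum => j _; rewrite -ge0_integralZl//; last 3 first.
- exact: (@section_sq n j (past j w) (y n j) (my n j)).
- by move=> z _; rewrite lee_fin sqr_ge0.
- by rewrite lee_fin ltW.
apply: ge0_le_integral => //.
- by move=> z _; rewrite lee_fin sqr_ge0.
- exact: (@section_sq n j (past j w) _ (measurable_small c n j)).
- by apply: measurable_funeM; exact: (@section_sq n j (past j w) (y n j) (my n j)).
move=> z _; rewrite -EFinM lee_fin /small_sq; case: ltP => [_|yc].
  by rewrite expr0n/= mulr_ge0// ?sqr_ge0// ltW.
rewrite expr2 ler_wpM2r ?sqr_ge0// -c2E -(real_normK (num_real (y n j _))).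
by rewrite lerXn2r ?nnegrE// sqrtr_ge0.
Qed.

Let near_A2 : \forall n \near \oo, {ae P0 n, forall w, forall j,
  \int[K0 n j (past j w)]_v (y n j (past j w, v) ^+ 2)%:E < +oo /\
  \int[K0 n j (past j w)]_v (y n j (past j w, v))%:E = 0}.
Proof. by apply: filterS A2 => n h; exact: filter_forall. Qed.

(** Law of large numbers for the squared scores: the large ones and their
    compensators are negligible by the Lindeberg condition, the small ones by
    [small_martingale]. *)
Let whp_Y2 (b : R) : (0 < b)%R -> whp P0 (fun n => [set w |
  (`|\sum_(j < m n) y n j (past_now j w) ^+ 2 - \sum_(j < m n) v n j w| <= b)%R]).
Proof.
move=> b0 d d0; have d20 : (0 < d / 2)%R by rewrite divr_gt0.
have b30 : (0 < b / 3)%R by rewrite divr_gt0.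
have [c c0 hc] := small_martingale b30 d20.
have hb : whp P0 (fun n => [set w |
    [/\ (\sum_(j < m n) big_sq c n j (past_now j w) <= b / 3)%R,
        \sum_(j < m n) \int[K0 n j (past j w)]_z (big_sq c n j (past j w, z))%:E <= (b / 3)%:E
      & forall j, \int[K0 n j (past j w)]_v (y n j (past j w, v) ^+ 2)%:E < +oo]]).
  apply: (whpI _ (whp_big c0 b30) (whpI _ (A3 c0 b30) (whp_ae near_A2))); last first.
    by apply: nearW => n w h1 h2; exact: (conj h1 h2).
  by apply: nearW => n w /= h1 [h2 h3]; split => // j; case: (h3 j).
move: hc (hb _ d20); apply: filterS2 => n e1 e2; rewrite (splitr d).
apply: exceptional_leI e1 e2 => w /= hs [hbig hbigK yoo].
have vE j : v n j w = (fine (\int[K0 n j (past j w)]_z (small_sq c n j (past j w, z))%:E) +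
    fine (\int[K0 n j (past j w)]_z (big_sq c n j (past j w, z))%:E))%R.
  have pos (g : past_space (@X n) j * borel (X j) -> R) : (forall z, (0 <= g z)%R) ->
      (forall z, (g z <= y n j z ^+ 2)%R) -> measurable_fun setT g ->
      \int[K0 n j (past j w)]_z (g (past j w, z))%:E \is a fin_num.
    move=> g0 gy mg; rewrite ge0_fin_numE; last by apply: integral_ge0 => z _; rewrite lee_fin.
    apply: le_lt_trans (yoo j); apply: ge0_le_integral => //.
    - by move=> z _; rewrite lee_fin.
    - by apply/measurable_EFinP; exact: section_measurable.
    - exact: ((@section_sq n j (past j w) (y n j) (my n j))).
    - by move=> z _; rewrite lee_fin.
  rewrite -fineD; last 2 first.
  - apply: pos; last exact: measurable_small.
      by move=> z; rewrite /small_sq; case: ifP => // _; exact: sqr_ge0.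
    by move=> z; rewrite /small_sq; case: ifP => // _; exact: sqr_ge0.
  - apply: pos; last exact: measurable_big.
      by move=> z; rewrite /big_sq; case: ifP => // _; exact: sqr_ge0.
    by move=> z; rewrite /big_sq; case: ifP => // _; exact: sqr_ge0.
  congr fine; rewrite -ge0_integralD//; last 4 first.
  - by move=> z _; rewrite lee_fin /small_sq; case: ifP => // _; exact: sqr_ge0.
  - by apply/measurable_EFinP; exact: section_measurable (measurable_small c n j).
  - by move=> z _; rewrite lee_fin /big_sq; case: ifP => // _; exact: sqr_ge0.
  - by apply/measurable_EFinP; exact: section_measurable (measurable_big c n j).
  apply: eq_integral => z _; rewrite -EFinD; congr (_%:E).
  by rewrite /small_sq /big_sq; case: ifP; rewrite ?add0r ?addr0.
have big0 : (0 <= \sum_(j < m n) big_sq c n j (past_now j w))%R.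
  by apply: sumr_ge0 => j _; rewrite /big_sq; case: ifP => // _; exact: sqr_ge0.
have IB0 j : 0 <= \int[K0 n j (past j w)]_z (big_sq c n j (past j w, z))%:E.
  by apply: integral_ge0 => z _; rewrite lee_fin /big_sq; case: ifP => // _; exact: sqr_ge0.
have bigK : (\sum_(j < m n) fine (\int[K0 n j (past j w)]_z (big_sq c n j (past j w, z))%:E) <= b / 3)%R.
  rewrite -lee_fin -sumEFin; apply: le_trans hbigK; apply: lee_sum => j _.
  rewrite fineK// ge0_fin_numE//; apply: le_lt_trans (yoo j).
  apply: ge0_le_integral => //.
  - by move=> z _; rewrite lee_fin /big_sq; case: ifP => // _; exact: sqr_ge0.
  - by apply/measurable_EFinP; exact: section_measurable (measurable_big c n j).
  - exact: ((@section_sq n j (past j w) (y n j) (my n j))).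
  - by move=> z _; rewrite lee_fin /big_sq; case: ifP => // _; exact: sqr_ge0.
have bigK0 : (0 <= \sum_(j < m n) fine (\int[K0 n j (past j w)]_z (big_sq c n j (past j w, z))%:E))%R.
  by apply: sumr_ge0 => j _; exact: fine_ge0.
rewrite (eq_bigr _ (fun j _ => vE j)) big_split/=.
rewrite (_ : \sum_(j < m n) y n j (past_now j w) ^+ 2 =
    \sum_(j < m n) small_sq c n j (past_now j w) + \sum_(j < m n) big_sq c n j (past_now j w))%R; last first.
  rewrite -big_split/=; apply: eq_bigr => j _.
  by rewrite /small_sq /big_sq; case: ifP; rewrite ?add0r ?addr0.
move: hs; rewrite sumrB !ler_norml => /andP[hs1 hs2].
by apply/andP; split; lra.
Qed.

(** Uniform smallness of the root ratios: each is the sum of a remainder, bounded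
    by the sum of all squared remainders, and of a score, which cannot be large
    as the sum of the large squares is small. *)
Let whp_root_ratio (b : R) : (0 < b)%R -> whp P0 (fun n => [set w |
  forall j, (`|root_ratio (p0 n j) (p1 n j) (past_now j w)| <= b)%R]).
Proof.
move=> b0; have b20 : (0 < b / 2)%R by rewrite divr_gt0.
have b220 : (0 < (b / 2) ^+ 2)%R by rewrite exprn_gt0.
have b80 : (0 < (b / 2) ^+ 2 / 2)%R by rewrite divr_gt0.
apply: (whpI _ (whp_D2 b220) (whp_big b20 b80)).
apply: nearW => n w /= hD hB j.
have Dj : (`|D n j (past_now j w)| <= b / 2)%R.
  rewrite -(@ler_pXn2r _ 2%N)// ?nnegrE// ?(ltW b20)// real_normK ?num_real//.
  apply: le_trans hD; rewrite (bigD1 j)//= lerDl; apply: sumr_ge0 => i _.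
  exact: sqr_ge0.
have yj : (`|y n j (past_now j w)| <= b / 2)%R.
  rewrite leNgt; apply/negP => yb.
  have : (big_sq (b / 2) n j (past_now j w) <= (b / 2) ^+ 2 / 2)%R.
    apply: le_trans hB; rewrite (bigD1 j)//= lerDl; apply: sumr_ge0 => i _.
    by rewrite /big_sq; case: ifP => // _; exact: sqr_ge0.
  rewrite /big_sq yb => h.
  have : ((b / 2) ^+ 2 <= y n j (past_now j w) ^+ 2)%R.
    rewrite -(real_normK (num_real (y n j _))).
    by rewrite lerXn2r ?nnegrE// ?(ltW b20)// ltW.
  by move: h b220; lra.
rewrite (_ : root_ratio _ _ _ = D n j (past_now j w) + y n j (past_now j w))%R; last first.
  by rewrite /D /remainder subrK.
by rewrite (le_trans (ler_normD _ _))// (splitr b) lerD.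
Qed.

Theorem log_likelihood_expansion (c : R) : (0 < c)%R -> whp P0 (fun n => [set w |
  `|lne (likelihood_ratio (P1 n) (P0 n) w)
    - (2 * \sum_(j < m n) y n j (past_now j w))%:E
    + (2 * \sum_(j < m n) v n j w)%:E| <= c%:E]).
Proof.
move=> c0; apply: (whp_tight A4) => M M0.
(* Half of [c] pays for the term [2 r M], the other half for [b C], where [C] depends
   on [r] and [M]. *)
pose r := (c / (4 * M))%R.
have r0 : (0 < r)%R by rewrite divr_gt0// mulr_gt0.
have rM : (2 * r * M = c / 2)%R by rewrite /r; field; rewrite gt_eqF.
have rV0 : (0 < r^-1)%R by rewrite invr_gt0.
pose C := (7 + r^-1 + r + 4 * (2 * M + 4))%R.
have C0 : (0 < C)%R by rewrite /C; lra.
pose b := Num.min 2^-1%R (c / (2 * C))%R.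
have b0 : (0 < b)%R by rewrite lt_min invr_gt0 ltr0n/= divr_gt0// mulr_gt0.
have b12 : (b <= 2^-1)%R by rewrite ge_min lexx.
have b1 : (b <= 1)%R by lra.
have bC : (b * C <= c / 2)%R.
  rewrite -ler_pdivlMr// (_ : (c / 2 / C = c / (2 * C))%R); last by field; rewrite gt_eqF.
  by rewrite ge_min lexx orbT.
(* [total_drift_le] then bounds the drift by [b / 2 + r M + b / 2]. *)
pose ba := (b / (2 * (3 + r^-1)))%R.
have ba0 : (0 < ba)%R by rewrite divr_gt0// mulr_gt0//; lra.
have b40 : (0 < b / 4)%R by rewrite divr_gt0.
have hLR : whp P0 (fun n => [set w |
    likelihood_ratio (P1 n) (P0 n) w =
    (\prod_(j < m n) (1 + root_ratio (p0 n j) (p1 n j) (past_now j w)) ^+ 2)%:E]).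
  apply: whp_ae; apply: filterS valid1 => n [law1 dom1 dens1 _].
  have [_ +] := likelihood_ratio_prod (sepX (n := n)) (law0 n) law1 (dom0 n) dom1
    (dens0 n) dens1.
  by apply: filterS => w [].
have valid_whp : whp P0 (fun n => [set w | valid n]).
  by apply: whp_ae; apply: filterS valid1 => n V; exact: filterE.
have H1 := whp_and (whp_De b0) (whp_D2 b0).
have H2 := whp_and H1 (whp_Y2 b0).
have H3 := whp_and H2 (whp_a1 ba0).
have H4 := whp_and H3 (whp_a2 b40).
have H5 := whp_and H4 (whp_root_ratio b0).
have H6 := whp_and H5 (whp_ae near_A2).
have H7 := whp_and H6 valid_whp.
apply: (whpI _ H7 hLR); apply: nearW => n w /=.
move=> [[[[[[[hDe hD2] hY2] ha1] ha2] hz] yoo] V] -> EYM.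
have z0 j : (0 < 1 + root_ratio (p0 n j) (p1 n j) (past_now j w))%R.
  by have := le_trans (hz j) b12; rewrite ler_norml => /andP[]; lra.
have [prod0 lnprod] := ln_prod_sqr z0.
have -> : lne (\prod_(j < m n) (1 + root_ratio (p0 n j) (p1 n j) (past_now j w)) ^+ 2)%:E
    = (\sum_(j < m n) 2 * ln (1 + root_ratio (p0 n j) (p1 n j) (past_now j w)))%:E.
  by rewrite /= leNgt prod0/= lnprod.
rewrite -EFinB -EFinD abse_EFin lee_fin.
have EYv : EY n w = (\sum_(j < m n) v n j w)%:E.
  rewrite -sumEFin; apply: eq_bigr => j _; rewrite fineK// ge0_fin_numE.
    by case: (yoo j).
  by apply: integral_ge0 => z _; rewrite lee_fin sqr_ge0.
have vM : (\sum_(j < m n) v n j w <= M)%R by rewrite -lee_fin -EYv.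
have drift : (\sum_(j < m n) `|2 * e n j w + v n j w| <= b + r * M)%R.
  rewrite -lee_fin; apply: (le_trans (total_drift_le V r0 yoo)).
  have h1 : (3 + r^-1)%:E * a1 n w <= (b / 2)%:E.
    apply: (@le_trans _ _ ((3 + r^-1)%:E * ba%:E)).
      by apply: lee_wpmul2l => //; rewrite lee_fin; lra.
    rewrite -EFinM lee_fin /ba le_eqVlt; apply/orP; left; apply/eqP; field.
    by apply/andP; split; rewrite gt_eqF//; nra.
  have h2 : r%:E * EY n w <= (r * M)%:E.
    by rewrite [leRHS]EFinM; apply: lee_wpmul2l; [rewrite lee_fin ltW|exact: EYM].
  have h3 : 2%:E * a2 n w <= (b / 2)%:E.
    apply: (@le_trans _ _ (2%:E * (b / 4)%:E)).
      by apply: lee_wpmul2l => //; exact: ha2.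
    by rewrite -EFinM lee_fin; lra.
  apply: (le_trans (leeD (leeD h1 h2) h3)).
  by rewrite -!EFinD lee_fin; lra.
have := @log_ratio_expansion R (m n)
  (fun j => root_ratio (p0 n j) (p1 n j) (past_now j w)) (fun j => y n j (past_now j w))
  (fun j => e n j w) (fun j => v n j w) b M r b0 b12 b1 (ltW M0) r0 hDe hD2 hY2 drift hz vM.
move=> h; apply: (le_trans h); rewrite -/C rM; lra.
Qed.

End expansion.

(** * Linear algebra and quadratic forms *)

Section linear_algebra_facts.
Context {R : realType} {d : nat}.
Implicit Types (x y g h : 'cV[R]_d) (A B : 'M[R]_d).

Lemma dotvE x y : dotv x y = \sum_i x i 0 * y i 0.
Proof. by rewrite /dotv mxE; apply: eq_bigr => i _; rewrite mxE. Qed.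

Lemma dotv_tr A x y : dotv x (A^T *m y) = dotv (A *m x) y.
Proof. by rewrite /dotv trmx_mul mulmxA. Qed.

Lemma dotvDr x y g : dotv x (y + g) = dotv x y + dotv x g.
Proof. by rewrite /dotv mulmxDr mxE. Qed.

Lemma dotvDl x y g : dotv (x + y) g = dotv x g + dotv y g.
Proof. by rewrite /dotv linearD/= mulmxDl mxE. Qed.

Lemma dotvZr x y (c : R) : dotv x (c *: y) = c * dotv x y.
Proof. by rewrite /dotv -scalemxAr mxE. Qed.

Lemma dotvZl x y (c : R) : dotv (c *: x) y = c * dotv x y.
Proof. by rewrite /dotv linearZ/= -scalemxAl mxE. Qed.

Lemma dotv0r x : dotv x 0 = 0.
Proof. by rewrite /dotv mulmx0 mxE. Qed.

Lemma dotv_sumr (I : finType) x (f : I -> 'cV[R]_d) :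
  dotv x (\sum_i f i) = \sum_i dotv x (f i).
Proof. by rewrite /dotv mulmx_sumr summxE. Qed.

Lemma dotv_mulmx g A : dotv g (A *m g) = \sum_i \sum_k g i 0 * g k 0 * A i k.
Proof.
rewrite dotvE; apply: eq_bigr => i _; rewrite mxE mulr_sumr.
by apply: eq_bigr => k _; ring.
Qed.

Lemma dotv_sqr g x : dotv g x ^+ 2 = \sum_i \sum_k g i 0 * g k 0 * (x i 0 * x k 0).
Proof.
rewrite dotvE expr2 mulr_suml; apply: eq_bigr => i _; rewrite mulr_sumr.
by apply: eq_bigr => k _; ring.
Qed.

Lemma enorm_sqr x : enorm x ^+ 2 = \sum_i x i 0 ^+ 2.
Proof. by rewrite sqr_sqrtr// sumr_ge0// => i _; exact: sqr_ge0. Qed.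

Lemma enorm_ge0 x : 0 <= enorm x.
Proof. exact: sqrtr_ge0. Qed.

Lemma sqr_coord_le x i : x i 0 ^+ 2 <= enorm x ^+ 2.
Proof.
rewrite enorm_sqr (bigD1 i)//= lerDl sumr_ge0// => j _; exact: sqr_ge0.
Qed.

Lemma coord_le_enorm x i : `|x i 0| <= enorm x.
Proof.
rewrite -(@ler_pXn2r _ 2%N)// ?nnegrE ?enorm_ge0// real_normK ?num_real//.
exact: sqr_coord_le.
Qed.

Lemma enormZ (c : R) x : 0 <= c -> enorm (c *: x) = c * enorm x.
Proof.
move=> c0; rewrite /enorm -{2}(ger0_norm c0) -sqrtr_sqr -sqrtrM ?sqr_ge0//.
by congr Num.sqrt; rewrite mulr_sumr; apply: eq_bigr => i _; rewrite mxE exprMn.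
Qed.

(** The operator norm bounds [A] on the unit ball only; dividing by
    [enorm x + 1] instead of [enorm x] avoids the case [x = 0]. *)
Lemma enorm_mulmx_le A x : enorm (A *m x) <= op_norm A * (enorm x + 1).
Proof.
have s0 : 0 < enorm x + 1 by rewrite ltr_wpDl ?enorm_ge0.
pose u := (enorm x + 1)^-1 *: x.
have u1 : enorm u <= 1.
  rewrite /u enormZ; last by rewrite invr_ge0 ltW.
  by rewrite mulrC ler_pdivrMr// mul1r lerDl.
have xu : x = (enorm x + 1) *: u by rewrite /u scalerA divff ?gt_eqF// scale1r.
have -> : enorm (A *m x) = (enorm x + 1) * enorm (A *m u).
  by rewrite {1}xu -scalemxAr enormZ// ltW.
rewrite mulrC; apply: ler_wpM2r; first exact: ltW.
apply: ub_le_sup; last by exists u.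
exists (Num.sqrt (\sum_i (\sum_k `|A i k|) ^+ 2)) => _ [v /= v1 <-].
apply: ler_wsqrtr; apply: ler_sum => i _.
rewrite -(real_normK (num_real ((A *m v) i 0))) lerXn2r ?nnegrE ?sumr_ge0//.
rewrite mxE; apply: (le_trans (ler_norm_sum _ _ _)); apply: ler_sum => k _.
by rewrite normrM ler_piMr//; apply: le_trans v1; exact: coord_le_enorm.
Qed.

(** If [x] is isotropic then, with [y = A *m x], the form is affine plus quadratic
    along [x + s *: y], and being nonnegative for small negative [s] it forces
    [y] to vanish. *)
Lemma nonneg_def_unit_pos_def A : symmetric_mx A -> nonneg_def A ->
  A \in unitmx -> pos_def A.
Proof.
move=> symA nnA uA x x0; rewrite lt_neqAle nnA andbT eq_sym; apply/eqP => xAx.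
have Ax0 : A *m x = 0.
  pose y := A *m x.
  have Ay z : dotv x (A *m z) = dotv y z by rewrite -dotv_tr symA.
  have key (s : R) : 0 <= 2 * s * dotv y y + s ^+ 2 * dotv y (A *m y).
    have := nnA (x + s *: y).
    rewrite mulmxDr -scalemxAr dotvDl !dotvDr !dotvZl !dotvZr xAx Ay -/y.
    by rewrite add0r; move=> h; apply: le_trans h _; rewrite le_eqVlt; apply/orP; left; apply/eqP; ring.
  have yy0 : 0 <= dotv y y by rewrite dotvE sumr_ge0// => i _; rewrite -expr2 sqr_ge0.
  have yAy0 : 0 <= dotv y (A *m y) by exact: nnA.
  have b0 : 0 < dotv y (A *m y) + 1 by rewrite ltr_wpDl.
  have : dotv y y = 0.
    apply/eqP; rewrite eq_le yy0 andbT leNgt; apply/negP => yy.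
    (* A negative step small enough for the linear term to win. *)
    have := key (- (dotv y y / (dotv y (A *m y) + 1))).
    apply/negP; rewrite -ltNge; set a := dotv y y in yy *.
    set b := dotv y (A *m y) in yAy0 b0 *.
    have -> : 2 * - (a / (b + 1)) * a + (- (a / (b + 1))) ^+ 2 * b =
        - (a ^+ 2 * (b + 2) / (b + 1) ^+ 2) by field; rewrite gt_eqF.
    by rewrite oppr_lt0 divr_gt0 ?exprn_gt0// mulr_gt0 ?exprn_gt0//; lra.
  rewrite dotvE => /eqP; rewrite psumr_eq0; last by move=> i _; rewrite -expr2 sqr_ge0.
  move=> /allP yi; apply/matrixP => i k; rewrite ord1 !mxE.
  by have := yi i (mem_index_enum _); rewrite /= -expr2 sqrf_eq0 /y !mxE => /eqP.
by move: x0; rewrite -(mulKmx uA x) Ax0 mulmx0 eqxx.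
Qed.

End linear_algebra_facts.

Section second_moment_form.
Context dY (Y : measurableType dY) (R : realType) (d : nat).
Variables (k : {measure set Y -> \bar R}) (eta : Y -> 'cV[R]_d).
Hypothesis k1 : k [set: Y] = 1%E.
Hypothesis meta : forall i, measurable_fun [set: Y] (fun v => eta v i 0).
Hypothesis etaoo : (\int[k]_v (enorm (eta v) ^+ 2)%:E < +oo)%E.
Local Open Scope ereal_scope.

Let measurable_enorm2 : measurable_fun [set: Y] (fun v => (enorm (eta v) ^+ 2)%:E).
Proof.
apply/measurable_EFinP; under eq_fun do rewrite enorm_sqr.
by apply: measurable_sum => i; exact: measurable_funX.
Qed.

Let integrable_enorm2 : k.-integrable [set: Y] (fun v => (enorm (eta v) ^+ 2)%:E).
Proof.
apply/integrableP; split => //.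
by under eq_integral do rewrite /= ger0_norm ?sqr_ge0//.
Qed.

Lemma integrable_coord_prod i l :
  k.-integrable [set: Y] (fun v => (eta v i 0 * eta v l 0)%:E).
Proof.
apply: (le_integrable measurableT _ _ integrable_enorm2) => //.
  by apply/measurable_EFinP; exact: measurable_funM.
move=> v _ /=; rewrite lee_fin normrM [leRHS]ger0_norm ?sqr_ge0//.
have hi := coord_le_enorm (eta v) i; have hl := coord_le_enorm (eta v) l.
by rewrite expr2 ler_pM.
Qed.

Lemma integrable_coord i : k.-integrable [set: Y] (fun v => (eta v i 0)%:E).
Proof.
apply: (square_integrable k1) => //; apply: le_lt_trans etaoo.
apply: ge0_le_integral => //.
- by move=> v _; rewrite lee_fin sqr_ge0.
- by apply/measurable_EFinP; exact: measurable_funX.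
- by move=> v _; rewrite lee_fin sqr_coord_le.
Qed.

(** Second moments of the linear forms are read off the matrix of second moments,
    all the entries being integrable by the bound on [enorm]. *)
Lemma integral_dotv_sqr (g : 'cV[R]_d) (M : 'M[R]_d) :
  (forall i l, M i l = fine (\int[k]_v (eta v i 0 * eta v l 0)%:E)) ->
  \int[k]_v (dotv g (eta v) ^+ 2)%:E = (dotv g (M *m g))%:E.
Proof.
move=> ME; rewrite dotv_mulmx.
transitivity (\int[k]_v \sum_i \sum_l
    ((g i 0 * g l 0)%:E * (eta v i 0 * eta v l 0)%:E)).
  apply: eq_integral => v _; rewrite dotv_sqr -sumEFin; apply: eq_bigr => i _.
  by rewrite -sumEFin; apply: eq_bigr => l _; rewrite -EFinM.
have ii i l : k.-integrable [set: Y]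
    (fun v => (g i 0 * g l 0)%:E * (eta v i 0 * eta v l 0)%:E).
  apply: integrableZl => //; exact: integrable_coord_prod.
rewrite integral_sum//; last by move=> i; exact: integrable_sum.
rewrite -sumEFin; apply: eq_bigr => i _; rewrite integral_sum//.
rewrite -sumEFin; apply: eq_bigr => l _.
rewrite integralZl//; last exact: integrable_coord_prod.
rewrite ME [RHS]EFinM fineK//.
exact: (integrable_fin_num measurableT (integrable_coord_prod i l)).
Qed.

Lemma integral_dotv_eq0 (g : 'cV[R]_d) :
  (forall i, \int[k]_v (eta v i 0)%:E = 0) -> \int[k]_v (dotv g (eta v))%:E = 0.
Proof.
move=> eta0.
transitivity (\int[k]_v \sum_i ((g i 0)%:E * (eta v i 0)%:E)).
  by apply: eq_integral => v _; rewrite dotvE -sumEFin; apply: eq_bigr.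
have ii i : k.-integrable [set: Y] (fun v => (g i 0)%:E * (eta v i 0)%:E).
  by apply: integrableZl => //; exact: integrable_coord.
rewrite integral_sum// big1// => i _.
by rewrite integralZl ?eta0 ?mule0//; exact: integrable_coord.
Qed.

End second_moment_form.

Section matrix_continuity.
Context {R : realType}.

Lemma continuous_sum_fun (T : topologicalType) (I : Type) (s : seq I)
    (f : I -> T -> R) : (forall i, continuous (f i)) ->
  continuous (fun x => \sum_(i <- s) f i x).
Proof.
move=> cf; elim: s => [|i s IH] x.
  by under eq_fun do rewrite big_nil; exact: cvg_cst.
by under eq_fun do rewrite big_cons; apply: cvgD; [exact: cf|exact: IH].
Qed.

Lemma continuous_prod_fun (T : topologicalType) (I : Type) (s : seq I)
    (f : I -> T -> R) : (forall i, continuous (f i)) ->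
  continuous (fun x => \prod_(i <- s) f i x).
Proof.
move=> cf; elim: s => [|i s IH] x.
  by under eq_fun do rewrite big_nil; exact: cvg_cst.
by under eq_fun do rewrite big_cons; apply: cvgM; [exact: cf|exact: IH].
Qed.

Lemma det_continuous n : continuous (fun A : 'M[R]_n => \det A).
Proof.
have cP (s : {perm 'I_n}) : continuous (fun A : 'M[R]_n => \prod_i A i (s i)).
  apply: (continuous_prod_fun (f := fun i (A : 'M[R]_n) => A i (s i))) => i.
  exact: mx_coord_continuous.
apply: (continuous_sum_fun (f := fun (s : {perm 'I_n}) (A : 'M[R]_n) =>
  (-1) ^+ s * \prod_i A i (s i))) => s A.
have cc : continuous ((fun=> (-1) ^+ s) : 'M[R]_n -> R) by exact: cst_continuous.
exact: (continuousM (cc A) (cP s A)).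
Qed.

Lemma quadratic_form_continuous n (h : 'cV[R]_n) :
  continuous (fun A : 'M[R]_n => dotv h (A *m h)).
Proof.
under eq_fun do rewrite dotv_mulmx.
apply: (continuous_sum_fun (f := fun i (A : 'M[R]_n) =>
  \sum_k h i 0 * h k 0 * A i k)) => i.
apply: (continuous_sum_fun (f := fun k (A : 'M[R]_n) => h i 0 * h k 0 * A i k)) => k A.
have cc : continuous ((fun=> h i 0 * h k 0) : 'M[R]_n -> R) by exact: cst_continuous.
exact: (continuousM (cc A) (@mx_coord_continuous R n n i k A)).
Qed.

End matrix_continuity.

Lemma measurable_dotv dS (S : measurableType dS) (R : realType) d (h : 'cV[R]_d)
    (v : S -> 'cV[R]_d) : measurable_fun [set: S] (v : S -> borel 'cV[R]_d) ->
  measurable_fun [set: S] (fun w => dotv h (v w)).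
Proof.
move=> /measurable_fun_mx mv; under eq_fun do rewrite dotvE.
by apply: measurable_sum => i; apply: measurable_funM => //; exact: mv.
Qed.

Lemma measurable_dotv_mulmx dS (S : measurableType dS) (R : realType) d (h : 'cV[R]_d)
    (A : 'M[R]_d) (v : S -> 'cV[R]_d) :
  measurable_fun [set: S] (v : S -> borel 'cV[R]_d) ->
  measurable_fun [set: S] (fun w => dotv h (A *m v w)).
Proof.
move=> mv; rewrite (_ : (fun w => _) = fun w => dotv (A^T *m h) (v w)); last first.
  by apply/funext => w; rewrite -dotv_tr trmxK.
exact: measurable_dotv.
Qed.

Lemma measurable_quadratic_form dS (S : measurableType dS) (R : realType) d
    (h : 'cV[R]_d) (A : S -> 'M[R]_d) :
  measurable_fun [set: S] (A : S -> borel 'M[R]_d) ->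
  measurable_fun [set: S] (fun w => dotv h (A w *m h)).
Proof.
move=> mA; apply/measurable_fun_borelR.
exact: measurable_continuous_comp (@quadratic_form_continuous R d h) mA.
Qed.

Lemma measurable_quadratic_expansion dS (S : measurableType dS) (R : realType) d
    (h : 'cV[R]_d) (L : S -> \bar R) (v : S -> 'cV[R]_d) (A : S -> 'M[R]_d) :
  measurable_fun [set: S] L ->
  measurable_fun [set: S] (v : S -> borel 'cV[R]_d) ->
  measurable_fun [set: S] (A : S -> borel 'M[R]_d) ->
  measurable_fun [set: S] (fun w =>
    L w - (dotv h (v w))%:E + (2^-1 * dotv h (A w *m h))%:E)%E.
Proof.
move=> mL mv mA; apply: emeasurable_funD; first apply: emeasurable_funB => //.
- by apply/measurable_EFinP; exact: measurable_dotv.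
- by apply/measurable_EFinP; apply: measurable_funM => //; exact: measurable_quadratic_form.
Qed.

(** * Consequences of convergence in law *)

Section weak_limit.
Context {R : realType} {disp : nat -> measure_display}
  {S : forall n, measurableType (disp n)} {d : nat}.
Variable P : forall n, probability (S n) R.
Context {dO} {Omega : measurableType dO}.
Variables (V : forall n, S n -> 'cV[R]_d) (Tn : forall n, S n -> 'M[R]_d).
Arguments V : clear implicits.
Arguments Tn : clear implicits.
Variables (Q : probability Omega R) (T : Omega -> 'M[R]_d) (Z : Omega -> 'cV[R]_d).
Hypothesis mTn : forall n, measurable_fun [set: S n] (Tn n : S n -> borel 'M[R]_d).
Hypothesis mT : measurable_fun [set: Omega] (T : Omega -> borel 'M[R]_d).
Hypothesis VT : cvg_in_law P (fun n w => (V n w, Tn n w)) Q (fun w => (Z w, T w)).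

Let mcont dd (U : measurableType dd) (A : U -> 'M[R]_d) (f : 'M[R]_d -> R) :
  continuous f -> measurable_fun [set: U] (A : U -> borel 'M[R]_d) ->
  measurable_fun [set: U] (fun w => f (A w)).
Proof.
by move=> cf mA; apply/measurable_fun_borelR; exact: measurable_continuous_comp mA.
Qed.

(** The integrals of [f k (T w)] tend to 0 by dominated convergence; fix [k] for
    which it is small and pass to the limit in [n] for this continuous bounded
    function. *)
Lemma weak_limit_small (f : nat -> 'M[R]_d -> R) :
  (forall k, continuous (f k)) -> (forall k A, 0 <= f k A <= 1) ->
  {ae Q, forall w, (fun k => f k (T w)) @ \oo --> (0 : R)} ->
  forall e : R, 0 < e -> exists k, \forall n \near \oo,
    (\int[P n]_w (f k (Tn n w))%:E <= e%:E)%E.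
Proof.
move=> cf f01 f0 e e0.
have f_ge0 k A : 0 <= f k A by have /andP[] := f01 k A.
have f_le1 k A : f k A <= 1 by have /andP[] := f01 k A.
have mfT k : measurable_fun [set: Omega] (fun w => f k (T w)) by exact: mcont.
have dct := @dominated_convergence _ Omega R Q setT measurableT
  (fun k w => (f k (T w))%:E) (cst 0%E) (cst 1%E)
  (fun k => (measurable_EFinP _ _).2 (mfT k)) (measurable_cst _).
have cf0 : \forall w \ae Q, setT w -> (fun k => (f k (T w))%:E) @ \oo --> (cst 0%E w : \bar R).
  by apply: filterS f0 => w fw _; apply: cvg_EFin => //; exact: nearW.
have i1 : Q.-integrable setT (cst 1%E).
  by apply: (integrable_cst_prob _ 1); exact: probability_setT.
have b1 : \forall w \ae Q, forall k, setT w -> (`|(f k (T w))%:E| <= cst 1 w)%E.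
  by apply: filterE => w k _; rewrite /= lee_fin ger0_norm.
have [_ _] := dct cf0 i1 b1.
rewrite integral0 => /fine_cvgP[_ /cvgrPdist_lt/(_ e e0)].
move=> [k _ /(_ k (leqnn k))] /=; rewrite sub0r normrN.
have intQ0 : (0 <= \int[Q]_w (f k (T w))%:E)%E by apply: integral_ge0 => w _; rewrite lee_fin.
have intQ : (\int[Q]_w (f k (T w))%:E)%E \is a fin_num.
  rewrite ge0_fin_numE//; apply: (@le_lt_trans _ _ (\int[Q]_w 1)%E).
    apply: ge0_le_integral => //; try (by move=> w _; rewrite lee_fin).
    exact/measurable_EFinP.
  by rewrite integral_cst_prob ?ltry//; exact: probability_setT.
rewrite ger0_norm ?fine_ge0// => Qe.
have cvgk : (fun n => \int[P n]_w (f k (Tn n w))%:E)%E @ \oo --> (\int[Q]_w (f k (T w))%:E)%E.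
  apply: (VT (f := fun z : 'cV[R]_d * 'M[R]_d => f k z.2)).
    by move=> z; apply: continuous_comp; [exact: cvg_snd|exact: cf].
  by exists 1 => z; rewrite ger0_norm.
exists k; move: cvgk; rewrite -(fineK intQ) => /fine_cvgP[fin /cvgr_lt/(_ _ Qe)].
move: fin; apply: filterS2 => n finn /= /ltW; rewrite -lee_fin fineK//.
Qed.

Let markov_event n (f : 'M[R]_d -> R) (F : set (S n)) :
  continuous f -> (forall A, 0 <= f A) -> measurable F ->
  (forall w, F w -> 1 <= f (Tn n w)) ->
  (P n F <= \int[P n]_w (f (Tn n w))%:E)%E.
Proof.
move=> cf f0 mF Ff; rewrite -[X in P n X]setIT -integral_indic//.
apply: ge0_le_integral => //; try (by move=> w _; rewrite lee_fin).
- by apply/measurable_EFinP; exact: measurable_indic.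
- by apply/measurable_EFinP; exact: mcont.
- move=> w _; rewrite lee_fin indicE; case: (boolP (w \in F)) => [/set_mem/Ff//|_].
  exact: f0.
Qed.

Let min1 (x : R) := Num.min 1 x.

Let min1_continuous (f : 'M[R]_d -> R) : continuous f ->
  continuous (fun A => min1 (f A)).
Proof.
move=> cf A; apply: (@continuous_min R _ (cst 1) f A).
  exact: cst_continuous.
exact: cf.
Qed.

(** [weak_limit_small] with the truncations [min 1 (phi / k.+1)], which are 1 on
    the event that [phi] exceeds [k.+1]. *)
Lemma tight_continuous (phi : 'M[R]_d -> R) : continuous phi ->
  (forall A, 0 <= phi A) -> tight P (fun n w => (phi (Tn n w))%:E).
Proof.
move=> cphi phi0 e e0.
pose f (k : nat) A := min1 (phi A / k.+1%:R).
have cf k : continuous (f k).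
  apply: min1_continuous => A.
  by apply: (continuousM (cphi A)); exact: cst_continuous.
have f01 k A : 0 <= f k A <= 1.
  by rewrite /f /min1 le_min ler01 divr_ge0//= ge_min lexx.
have f0 : {ae Q, forall w, (fun k => f k (T w)) @ \oo --> (0 : R)}.
  apply: filterE => w.
  apply: (@squeeze_cvgr _ _ _ _ (cst 0) (fun k => phi (T w) * k.+1%:R^-1)).
  - apply: nearW => k; have /andP[-> _] := f01 k (T w).
    by rewrite /f /min1 ge_min lexx orbT.
  - exact: cvg_cst.
  - rewrite -[X in _ --> X](mulr0 (phi (T w))); apply: cvgM; first exact: cvg_cst.
    exact: cvg_harmonic.
have [k hk] := weak_limit_small cf f01 f0 e0.
exists k.+1%:R => //; apply: filterS hk => n hk.
exists [set w | k.+1%:R < phi (Tn n w)]; split.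
- rewrite -[X in measurable X]setTI; apply: measurable_fun_ltr => //.
  exact: mcont.
- by move=> w /= /negP; rewrite lee_fin -ltNge.
- apply: le_trans hk; apply: markov_event => //.
  + by move=> A; have /andP[] := f01 k A.
  + rewrite -[X in measurable X]setTI; apply: measurable_fun_ltr => //.
    exact: mcont.
  + move=> w /= h; rewrite /f /min1 le_min lexx/= ler_pdivlMr// mul1r ltW//.
Qed.

(** [weak_limit_small] with [1 - min 1 (k |det|)], which is 1 where the determinant
    vanishes and tends to 0 elsewhere. *)
Lemma det_eq0_small : {ae Q, forall w, \det (T w) != 0} ->
  forall e : R, 0 < e -> \forall n \near \oo,
    (P n [set w | (\det (Tn n w) = 0)%R] <= e%:E)%E.
Proof.
move=> detT e e0.
pose f (k : nat) A := 1 - min1 (`|\det (A : 'M[R]_d)| * k%:R).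
have cf k : continuous (f k).
  have c1 : continuous ((fun=> 1) : 'M[R]_d -> R) by exact: cst_continuous.
  have ck : continuous ((fun=> k%:R) : 'M[R]_d -> R) by exact: cst_continuous.
  have c2 : continuous (fun A : 'M[R]_d => `|\det A|).
    by move=> A; apply: continuous_comp; [exact: det_continuous|exact: norm_continuous].
  have c3 : continuous (fun A : 'M[R]_d => `|\det A| * k%:R).
    by move=> A; exact: (continuousM (c2 A) (ck A)).
  by move=> A; exact: (continuousB (c1 A) (min1_continuous c3 (x := A))).
have f01 k A : 0 <= f k A <= 1.
  rewrite /f /min1 subr_ge0 ge_min lexx/= gerBl le_min ler01/=.
  by rewrite mulr_ge0.
have f0 : {ae Q, forall w, (fun k => f k (T w)) @ \oo --> (0 : R)}.
  apply: filterS detT => w dw; apply: cvg_near_cst.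
  near=> k; rewrite /f /min1 min_l ?subrr//.
  rewrite -ler_pdivrMl ?normr_gt0// mulr1.
  by near: k; exact: nbhs_infty_ger.
have [k hk] := weak_limit_small cf f01 f0 e0.
apply: filterS hk => n; apply: le_trans; apply: markov_event => //.
- by move=> A; have /andP[] := f01 k A.
- have mdet : measurable_fun setT (fun w => \det (Tn n w)) by apply: mcont => //; exact: det_continuous.
  by have := mdet measurableT [set 0] (measurable_set1 0); rewrite setTI.
- by move=> w /= dw; rewrite /f dw normr0 mul0r /min1 min_r// subr0.
Unshelve. all: by end_near. Qed.

End weak_limit.

Lemma measurable_lne (R : realType) d (S : measurableType d) (L : S -> \bar R) :
  measurable_fun [set: S] L -> measurable_fun [set: S] (fun w => lne (L w)).
Proof.
move=> mL.
rewrite (_ : (fun w => _) = fun w => if (L w <= 0)%E then -oo%E else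
    if (+oo <= L w)%E then +oo%E else (ln (fine (L w)))%:E); last first.
  apply/funext => w; rewrite /lne; case: (L w) => [r| |]//.
  by rewrite leNye.
apply: measurable_fun_ifT.
- by apply: (measurable_fun_bool true); exact: measurable_lee.
- exact: measurable_cst.
- apply: measurable_fun_ifT.
  + by apply: (measurable_fun_bool true); exact: measurable_lee.
  + exact: measurable_cst.
  + apply/measurable_EFinP; apply: (measurableT_comp (@measurable_ln R)).
    exact: (measurableT_comp (fine_measurable measurableT)).
Qed.

(** For fixed [h], the local parameters converge to [alpha0]. *)
Lemma open_local_parameter (R : realType) d (Theta : set 'cV[R]_d)
    (alpha0 h : 'cV[R]_d) (eps : nat -> 'M[R]_d) :
  open Theta -> Theta alpha0 -> (fun n => op_norm (eps n)) @ \oo --> (0 : R) ->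
  \forall n \near \oo, Theta (alpha0 + eps n *m h).
Proof.
move=> oT Ta eps0.
have /nbhs_ballP[r /= r0 rT] : nbhs alpha0 Theta by exact: open_nbhs_nbhs.
have c0 : (fun n => op_norm (eps n) * (enorm h + 1)) @ \oo --> (0 : R).
  by rewrite -[X in _ --> X](mul0r (enorm h + 1)); apply: cvgMl.
move/cvgr_lt : c0 => /(_ _ r0); apply: filterS => n ltr; apply: rT.
split => // i k; rewrite ord1 /ball/= mxE opprD addrA subrr sub0r normrN.
apply: le_lt_trans (coord_le_enorm _ i) _.
exact: le_lt_trans (enorm_mulmx_le _ _) ltr.
Qed.

Section modification.
Context {R : realType} {disp : nat -> measure_display}
  {S : forall n, measurableType (disp n)}.
Variable P : forall n, probability (S n) R.
Variable F : forall n, set (S n).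
Arguments F : clear implicits.
Hypothesis mF : forall n, measurable (F n).
Hypothesis PF : forall e : R, 0 < e -> \forall n \near \oo, (P n (F n) <= e%:E)%E.

Lemma whp_setC : whp P (fun n => ~` F n).
Proof.
move=> e e0; move: (PF e0); apply: filterS => n Pe.
by exists (F n); split; rewrite ?setCK.
Qed.

Lemma cvg_to0_in_prob_modification (Z Z' : forall n, S n -> \bar R) :
  (\forall n \near \oo, measurable_fun [set: S n] (Z n)) ->
  (\forall n \near \oo, measurable_fun [set: S n] (Z' n)) ->
  (forall n w, ~ F n w -> Z n w = Z' n w) ->
  cvg_to0_in_prob P Z -> cvg_to0_in_prob P Z'.
Proof.
move=> mZ mZ' ZZ' cZ; apply: cvg_of_whp => // e e0.
apply: (whpI _ (whp_of_cvg mZ cZ e0) whp_setC).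
by apply: nearW => n w /= Ze nF; rewrite -ZZ'.
Qed.

(** The integrals of a test function bounded by [M] differ by at most [2 M] times
    the probability of [F n]. The test functions are only required to be
    measurable after composition, since the target of interest is a product of
    matrix spaces. *)
Lemma cvg_in_law_modification (E : topologicalType) (Z Z' : forall n, S n -> E)
    {dO} {Omega : measurableType dO} (Q : probability Omega R) (Z0 : Omega -> E) :
  (forall n (f : E -> R), continuous f ->
    measurable_fun [set: S n] (fun w => f (Z n w))) ->
  (forall n (f : E -> R), continuous f ->
    measurable_fun [set: S n] (fun w => f (Z' n w))) ->
  (forall n w, ~ F n w -> Z n w = Z' n w) ->
  cvg_in_law P Z Q Z0 -> cvg_in_law P Z' Q Z0.
Proof.
move=> mZ mZ' ZZ' cZ f cf [M' fM']; pose M := `|M'|.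
have fM x : `|f x| <= M by apply: le_trans (fM' x) (ler_norm _).
have M0 : 0 <= M by exact: normr_ge0.
have intf (Y : forall n, S n -> E) n : measurable_fun [set: S n] (fun w => f (Y n w)) ->
    (P n).-integrable [set: S n] (EFin \o (fun w => f (Y n w))).
  move=> mY.
  apply: (le_integrable measurableT _ _ (integrable_cst_prob (probability_setT (P n)) M)).
    exact/measurable_EFinP.
  by move=> w _; rewrite /= lee_fin (ger0_norm M0).
have {}mZ n := mZ n f cf; have {}mZ' n := mZ' n f cf.
pose a n := (\int[P n]_w (f (Z n w))%:E)%E.
pose b n := (\int[P n]_w (f (Z' n w))%:E)%E.
have fina n : a n \is a fin_num by apply: (integrable_fin_num _ (intf Z n (mZ n))).
have finb n : b n \is a fin_num by apply: (integrable_fin_num _ (intf Z' n (mZ' n))).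
have ba n : (`|b n - a n| <= (2 * M)%:E * P n (F n))%E.
  rewrite /a /b -integralB_EFin//; [|exact: (intf Z')|exact: (intf Z)].
  apply: (le_trans (le_abse_integral _ _ _)) => //.
    by apply/measurable_EFinP; apply: measurable_funB.
  rewrite -(setIT (F n)) -integral_indic// -ge0_integralZl//; last 2 first.
    by apply/measurable_EFinP; exact: measurable_indic.
    by rewrite lee_fin mulr_ge0.
  apply: ge0_le_integral => //;
      try (by move=> w _; rewrite -EFinM lee_fin mulr_ge0// mulr_ge0).
  - by apply/measurable_EFinP; apply: measurableT_comp => //; apply: measurable_funB.
  - by apply/measurable_EFinP; apply: measurable_funM => //; exact: measurable_indic.
  - move=> w _; rewrite -EFinM lee_fin indicE.
    have [|/negP nF] := boolP (w \in F n).
      by move=> _; rewrite mulr1 mulrDl mul1r (le_trans (ler_normB _ _))// lerD.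
    by rewrite mulr0 ZZ' ?subrr ?normr0// => Fw; apply: nF; rewrite inE.
have cba : (fun n => b n - a n)%E @ \oo --> 0%E.
  apply/fine_cvgP; split.
    by apply: nearW => n; rewrite fin_numB finb fina.
  apply/cvgrPdist_le => e e0.
  have e1 : 0 < e / (2 * M + 1) by rewrite divr_gt0// ltr_wpDl// mulr_ge0.
  move: (PF e1); apply: filterS => n Pn /=; rewrite sub0r normrN.
  have finba : (b n - a n)%E \is a fin_num by rewrite fin_numB finb fina.
  rewrite -lee_fin -abse_EFin fineK; last exact: finba.
  apply: (le_trans (ba n)).
  apply: (@le_trans _ _ ((2 * M)%:E * (e / (2 * M + 1))%:E)%E).
    by apply: lee_wpmul2l => //; rewrite lee_fin mulr_ge0.
  have M1 : 0 < 2 * M + 1 by rewrite ltr_wpDl// mulr_ge0.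
  rewrite -EFinM lee_fin mulrCA; apply: ler_piMr; first exact: ltW.
  by rewrite ler_pdivrMr// mul1r lerDl.
have bE : b = (a \+ (fun n => b n - a n))%E.
  by apply/funext => n /=; rewrite addeC subeK.
change (b @ \oo --> (\int[Q]_w (f (Z0 w))%:E)%E); rewrite bE.
rewrite -[X in _ --> X]adde0; apply: cvgeD => //; first by rewrite fin_num_adde_defl.
exact: cZ (ex_intro _ M fM).
Qed.

End modification.

Section regularization.
Context {R : realType} {d : nat}.

(** Positive definite for every symmetric nonnegative definite argument, and equal
    to the argument unless the latter is singular. *)
Definition regularize (A : 'M[R]_d) : 'M[R]_d := if \det A == 0 then 1%:M else A.

Lemma regularize_id A : \det A <> 0 -> regularize A = A.
Proof. by rewrite /regularize => /eqP/negbTE ->. Qed.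

Lemma measurable_regularize dS (S : measurableType dS) (A : S -> 'M[R]_d) :
  measurable_fun [set: S] (A : S -> borel 'M[R]_d) ->
  measurable_fun [set: S] ((fun w => regularize (A w)) : S -> borel 'M[R]_d).
Proof.
move=> mA; apply/measurable_fun_mx => i k.
rewrite (_ : (fun w => _) = fun w => if \det (A w) == 0 then (1%:M : 'M[R]_d) i k else A w i k); last first.
  by apply/funext => w; rewrite /regularize; case: ifP.
apply: measurable_fun_ifT; last by have /measurable_fun_mx := mA; exact.
  apply: measurable_fun_eqr; last exact: measurable_cst.
  by apply/measurable_fun_borelR; apply: measurable_continuous_comp mA; exact: det_continuous.
exact: measurable_cst.
Qed.

Lemma pos_def1 : pos_def (1%:M : 'M[R]_d).
Proof.
move=> x x0; rewrite mul1mx lt_neqAle dotvE.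
have s0 : 0 <= \sum_i x i 0 * x i 0 by apply: sumr_ge0 => i _; rewrite -expr2 sqr_ge0.
rewrite s0 andbT eq_sym psumr_eq0; last by move=> i _; rewrite -expr2 sqr_ge0.
apply: contra x0 => /allP xi; apply/eqP/matrixP => i k; rewrite ord1 mxE.
by have := xi i (mem_index_enum _); rewrite /= -expr2 sqrf_eq0 => /eqP.
Qed.

Lemma pos_def_nonneg (A : 'M[R]_d) : pos_def A -> nonneg_def A.
Proof.
by move=> pA x; have [->|/pA/ltW//] := eqVneq x 0; rewrite mulmx0 dotv0r.
Qed.

Lemma pos_def_det (A : 'M[R]_d) : pos_def A -> \det A != 0.
Proof.
move=> pA; rewrite -unitfE -[_ \is a _]unitmxE -unitmx_tr -row_free_unit -kermx_eq0.
apply/eqP/row_matrixP => i; rewrite row0; apply/eqP/negPn/negP => r0.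
have rA : row i (kermx A^T) *m A^T = 0 by rewrite -row_mul mulmx_ker row0.
have rT0 : (row i (kermx A^T))^T != 0.
  by rewrite -trmx0 (inj_eq (@trmx_inj _ _ _)).
have := pA _ rT0.
rewrite (_ : A *m (row i (kermx A^T))^T = 0); last first.
  by apply: trmx_inj; rewrite trmx_mul trmxK rA trmx0.
by rewrite dotv0r ltxx.
Qed.

Lemma symmetric_regularize A : symmetric_mx A -> symmetric_mx (regularize A).
Proof. by rewrite /regularize; case: ifP => // _ _; exact: trmx1. Qed.

Lemma pos_def_regularize A : symmetric_mx A -> nonneg_def A -> pos_def (regularize A).
Proof.
rewrite /regularize; case: ifP => [_ _ _|dA sA nA]; first exact: pos_def1.
by apply: nonneg_def_unit_pos_def => //; rewrite unitmxE unitfE dA.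
Qed.

End regularization.

(** * Conditional moments of the score *)

Section score_moments.
Context {R : realType} {d m : nat} (X : 'I_m -> completeMetricType R).
Hypothesis sepX : forall j, separable (X j).
Variables (P : probability (state X) R)
  (K : forall j, R.-pker (past_space X j) ~> (borel (X j))).
Hypothesis PK : forall j, is_cond_law P (K j).
Variables (p : forall j, past_space X j * borel (X j) -> R)
  (xidot : forall j, past_space X j * borel (X j) -> 'cV[R]_d).
Arguments p : clear implicits.
Arguments xidot : clear implicits.
Hypothesis mp : forall j, measurable_fun setT (p j).
Hypothesis mxidot : forall j, measurable_fun setT (xidot j : _ -> borel 'cV[R]_d).
Arguments mp : clear implicits.
Arguments mxidot : clear implicits.

(** The variable [eta_j], as a function of the past and of the present
    observation; its moments can then be computed under the conditional laws. *)
Definition score_fun j (z : past_space X j * borel (X j)) : 'cV[R]_d :=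
  if p j z == 0 then 0 else (Num.sqrt (p j z))^-1 *: xidot j z.
Arguments score_fun : clear implicits.

Let eta j := score (p j) (xidot j).
Arguments eta : clear implicits.

Lemma score_fun_entry j z i :
  score_fun j z i 0 = rel_score (p j) (fun z => xidot j z i 0) z.
Proof.
by rewrite /score_fun /rel_score; case: ifP => _; rewrite mxE// mulrC.
Qed.

Lemma measurable_score_fun_entry j i :
  measurable_fun setT (fun z => score_fun j z i 0).
Proof.
rewrite (_ : (fun z => _) = rel_score (p j) (fun z => xidot j z i 0)); last first.
  by apply/funext => z; exact: score_fun_entry.
apply: measurable_rel_score; first exact: mp.
by have /measurable_fun_mx := mxidot j; exact.
Qed.

(** The factor 2 comes from the derivative of the square root. *)
Lemma dotv_score_fun j (h : 'cV[R]_d) (e : 'M[R]_d) z :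
  dotv h (e^T *m score_fun j z) =
  2 * rel_score (p j) (fun z => 2^-1 * dotv h (e^T *m xidot j z)) z.
Proof.
rewrite /score_fun /rel_score; case: ifP => _; first by rewrite mulmx0 dotv0r mulr0.
rewrite -scalemxAr dotvZr.
by set a := dotv _ _; set b := Num.sqrt _; rewrite mulrA mulrA divff// mul1r mulrC.
Qed.

Let measurable_coord_prod j i k :
  measurable_fun setT (fun z => (score_fun j z i 0 * score_fun j z k 0)%:E).
Proof.
by apply/measurable_EFinP; apply: measurable_funM; exact: measurable_score_fun_entry.
Qed.
Arguments measurable_coord_prod : clear implicits.

Let measurable_sqnorm j : measurable_fun setT (fun z => (enorm (score_fun j z) ^+ 2)%:E).
Proof.
apply/measurable_EFinP.
rewrite (_ : (fun z => _) = fun z => (\sum_i score_fun j z i 0 ^+ 2)%R); last first.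
  by apply/funext => z; rewrite enorm_sqr.
by apply: measurable_sum => i; apply: measurable_funX; exact: measurable_score_fun_entry.
Qed.
Arguments measurable_sqnorm : clear implicits.

Local Open Scope ereal_scope.

Lemma score_cond_exp_kernel :
  {ae P, forall w, forall j,
    [/\ cond_sqnorm P j (eta j) w =
          \int[K j (past j w)]_v (enorm (score_fun j (past j w, v)) ^+ 2)%:E,
      forall i, cond_exp P (past_algebra j) (fun w => (eta j w i 0)%:E) w =
          \int[K j (past j w)]_v (score_fun j (past j w, v) i 0)%:E &
      forall i k, cond_exp P (past_algebra j)
            (fun w => (eta j w i 0 * eta j w k 0)%:E) w =
          \int[K j (past j w)]_v
            (score_fun j (past j w, v) i 0 * score_fun j (past j w, v) k 0)%:E]}.
Proof.
apply: filter_forall => j.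
have h1 := cond_exp_past sepX PK (measurable_sqnorm j).
have h2 : {ae P, forall w, forall i, cond_exp P (past_algebra j) (fun w => (eta j w i 0)%:E) w =
          \int[K j (past j w)]_v (score_fun j (past j w, v) i 0)%:E}.
  apply: filter_forall => i.
  apply: (cond_exp_past sepX PK (f := fun z => (score_fun j z i 0)%:E)).
  by apply/measurable_EFinP; exact: measurable_score_fun_entry.
have h3 : {ae P, forall w, forall i k, cond_exp P (past_algebra j)
            (fun w => (eta j w i 0 * eta j w k 0)%:E) w =
          \int[K j (past j w)]_v
            (score_fun j (past j w, v) i 0 * score_fun j (past j w, v) k 0)%:E}.
  apply: filter_forall => i; apply: filter_forall => k.
  exact: (cond_exp_past sepX PK (measurable_coord_prod j i k)).
by move: h1 h2 h3; apply: filterS3 => w h1 h2 h3; split.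
Qed.

(** Conditional expectations are measurable whatever the function, being either a
    version chosen among measurable ones or 0. *)
Lemma measurable_cond_second_moment j :
  measurable_fun setT (cond_second_moment P j (eta j) : _ -> borel 'M[R]_d).
Proof.
apply/measurable_fun_mx => i k.
rewrite (_ : (fun w => _) = fun w => if cond_sqnorm P j (eta j) w < +oo then
    fine (cond_exp P (past_algebra j) (fun w' => (eta j w' i 0 * eta j w' k 0)%:E) w)
    else 0%R); last first.
  by apply/funext => w; rewrite /cond_second_moment; case: ifP => _; rewrite mxE.
apply: measurable_fun_ifT.
- by apply: (measurable_fun_bool true); apply: measurable_lte => //; exact: measurable_cond_exp_past.
- apply: (measurableT_comp (fine_measurable measurableT)); exact: measurable_cond_exp_past.
- exact: measurable_cst.
Qed.

Lemma symmetric_cond_second_moment j w : symmetric_mx (cond_second_moment P j (eta j) w).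
Proof.
rewrite /symmetric_mx /cond_second_moment; case: ifP => _; last exact: trmx0.
apply/matrixP => i k; rewrite !mxE; congr (fine (cond_exp _ _ _ _)).
by apply/funext => w'; rewrite mulrC.
Qed.

Let section_entry j (x : past_space X j) i :
  measurable_fun [set: borel (X j)] (fun v => score_fun j (x, v) i 0%R).
Proof.
exact: measurableT_comp (@measurable_score_fun_entry j i) (measurable_pair1 x).
Qed.

Let prob1 j x : K j x setT = 1. Proof. exact: prob_kernel. Qed.

Lemma cond_second_moment_form :
  {ae P, forall w, forall j, (cond_sqnorm P j (eta j) w < +oo) ->
    forall g, \int[K j (past j w)]_v (dotv g (score_fun j (past j w, v)) ^+ 2)%:E =
      (dotv g (cond_second_moment P j (eta j) w *m g))%:E}.
Proof.
move: score_cond_exp_kernel; apply: filterS => w hw j fin g.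
have [h1 _ h3] := hw j.
apply: (integral_dotv_sqr (eta := fun v => score_fun j (past j w, v))) => //.
- by move: fin; rewrite h1.
- by move=> i l; rewrite /cond_second_moment fin mxE h3.
Qed.

(** The form at [g] is the conditional mean of [dotv g eta ^+ 2] where the
    conditional second moment of [eta] is finite, and 0 elsewhere. *)
Lemma cond_second_moment_nonneg :
  {ae P, forall w, forall j, nonneg_def (cond_second_moment P j (eta j) w)}.
Proof.
move: cond_second_moment_form; apply: filterS => w hw j g.
have [fin|nfin] := boolP (cond_sqnorm P j (eta j) w < +oo).
  by rewrite -lee_fin -hw//; apply: integral_ge0 => v _; rewrite lee_fin sqr_ge0.
by rewrite /cond_second_moment (negbTE nfin) mul0mx dotv0r.
Qed.

Lemma measurable_central_sequence (e : 'M[R]_d) :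
  measurable_fun setT (central_sequence e eta : _ -> borel 'cV[R]_d).
Proof.
apply/measurable_fun_mx => i k.
rewrite (_ : (fun w => _) = fun w => \sum_l (e l i * \sum_j eta j w l k))%R; last first.
  apply/funext => w; rewrite /central_sequence mxE; apply: eq_bigr => l _.
  by rewrite summxE mxE.
apply: measurable_sum => l; apply: measurable_funM => //.
apply: measurable_sum => j; rewrite ord1.
exact: measurableT_comp (@measurable_score_fun_entry j l) (measurable_past_now sepX (j := j)).
Qed.

Lemma measurable_information (e : 'M[R]_d) :
  measurable_fun setT (information P e eta : _ -> borel 'M[R]_d).
Proof.
apply/measurable_fun_mx => i k.
rewrite (_ : (fun w => _) = fun w => \sum_l
  (\sum_l' e l' i * \sum_j cond_second_moment P j (eta j) w l' l) * e l k)%R; last first.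
  apply/funext => w; rewrite /information mxE; apply: eq_bigr => l _; congr (_ * _)%R.
  by rewrite mxE; apply: eq_bigr => l' _; rewrite summxE mxE.
apply: measurable_sum => l; apply: measurable_funM => //.
apply: measurable_sum => l'; apply: measurable_funM => //.
apply: measurable_sum => j.
by have /measurable_fun_mx := measurable_cond_second_moment j; exact.
Qed.

Lemma symmetric_information (e : 'M[R]_d) w : symmetric_mx (information P e eta w).
Proof.
rewrite /symmetric_mx /information !trmx_mul trmxK mulmxA; congr (_ *m _ *m _).
rewrite linear_sum; apply: eq_bigr => j _; exact: symmetric_cond_second_moment.
Qed.

Lemma dotv_information (e : 'M[R]_d) (h : 'cV[R]_d) w :
  dotv h (information P e eta w *m h) =
  (\sum_j dotv (e *m h) (cond_second_moment P j (eta j) w *m (e *m h)))%R.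
Proof.
by rewrite /information -!mulmxA dotv_tr mulmx_suml dotv_sumr.
Qed.

Lemma nonneg_information (e : 'M[R]_d) :
  {ae P, forall w, nonneg_def (information P e eta w)}.
Proof.
move: cond_second_moment_nonneg; apply: filterS => w hw h.
by rewrite dotv_information sumr_ge0// => j _; exact: hw.
Qed.

Lemma information_form (e : 'M[R]_d) (h : 'cV[R]_d) :
  (forall j, {ae P, forall w, cond_sqnorm P j (eta j) w < +oo}) ->
  {ae P, forall w, (dotv h (information P e eta w *m h))%:E =
    \sum_j \int[K j (past j w)]_v
      (dotv h (e^T *m score_fun j (past j w, v)) ^+ 2)%:E}.
Proof.
move=> fin; have {}fin : {ae P, forall w, forall j, cond_sqnorm P j (eta j) w < +oo}.
  by apply: filter_forall.
move: fin cond_second_moment_form; apply: filterS2 => w fin hw.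
rewrite dotv_information -sumEFin; apply: eq_bigr => j _.
rewrite -hw ?fin//; apply: eq_integral => v _; by rewrite dotv_tr.
Qed.

Lemma score_form_finite (e : 'M[R]_d) (h : 'cV[R]_d) j :
  {ae P, forall w, cond_sqnorm P j (eta j) w < +oo} ->
  {ae P, forall w, forall i, cond_exp P (past_algebra j) (fun w => (eta j w i 0)%:E) w = 0} ->
  {ae P, forall w,
    \int[K j (past j w)]_v (dotv h (e^T *m score_fun j (past j w, v)) ^+ 2)%:E < +oo /\
    \int[K j (past j w)]_v (dotv h (e^T *m score_fun j (past j w, v)))%:E = 0}.
Proof.
move=> fin ctr; near=> w.
have fw : cond_sqnorm P j (eta j) w < +oo by near: w.
have cw : forall i, cond_exp P (past_algebra j) (fun w => (eta j w i 0)%:E) w = 0 by near: w.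
have form : forall j, (cond_sqnorm P j (eta j) w < +oo) ->
    forall g, \int[K j (past j w)]_v (dotv g (score_fun j (past j w, v)) ^+ 2)%:E =
      (dotv g (cond_second_moment P j (eta j) w *m g))%:E.
  by near: w; exact: cond_second_moment_form.
have kern : forall j,
    [/\ cond_sqnorm P j (eta j) w =
          \int[K j (past j w)]_v (enorm (score_fun j (past j w, v)) ^+ 2)%:E,
      forall i, cond_exp P (past_algebra j) (fun w => (eta j w i 0)%:E) w =
          \int[K j (past j w)]_v (score_fun j (past j w, v) i 0)%:E &
      forall i k, cond_exp P (past_algebra j)
            (fun w => (eta j w i 0 * eta j w k 0)%:E) w =
          \int[K j (past j w)]_v
            (score_fun j (past j w, v) i 0 * score_fun j (past j w, v) k 0)%:E].
  by near: w; exact: score_cond_exp_kernel.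
have [k1 k2 _] := kern j.
under eq_integral do rewrite dotv_tr.
under [X in _ /\ X = _]eq_integral do rewrite dotv_tr.
split; first by rewrite form// ltry.
apply: (integral_dotv_eq0 (eta := fun v => score_fun j (past j w, v))) => //.
- by move: fw; rewrite k1.
- by move=> i; rewrite -k2.
Unshelve. all: by end_near. Qed.

End score_moments.

(** * Local asymptotic mixed normality *)

Section local_asymptotics.
Context {R : realType} {d : nat}.
Variables (Theta : set 'cV[R]_d) (alpha0 : 'cV[R]_d) (m : nat -> nat).
Variable X : forall n, 'I_(m n) -> completeMetricType R.
Arguments X : clear implicits.
Variable P : forall n, 'cV[R]_d -> probability (state (X n)) R.
Variable mu : forall n (j : 'I_(m n)),
      {sigma_finite_measure set (borel (X n j)) -> \bar R}.
Variable K : forall n, 'cV[R]_d -> forall j : 'I_(m n),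
      R.-pker (past_space (X n) j) ~> (borel (X n j)).
Variable p : forall n, 'cV[R]_d ->
      forall j : 'I_(m n), past_space (X n) j * borel (X n j) -> R.
Variable eps : nat -> 'M[R]_d.
Variable xidot : forall n (j : 'I_(m n)),
      past_space (X n) j * borel (X n j) -> 'cV[R]_d.
Arguments P : clear implicits.
Arguments mu : clear implicits.
Arguments K : clear implicits.
Arguments p : clear implicits.
Arguments xidot : clear implicits.
Hypothesis oTheta : open Theta.
Hypothesis Ta : Theta alpha0.
Hypothesis sepX : forall n j, separable (X n j).
Hypothesis lawK : forall n alpha j, Theta alpha -> is_cond_law (P n alpha) (K n alpha j).
Hypothesis domK : forall n alpha j x, Theta alpha -> K n alpha j x `<< mu n j.
Hypothesis densp : forall n alpha j, Theta alpha ->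
    is_cond_density (mu n j) (K n alpha j) (p n alpha j).
Hypothesis eps0 : (fun n => op_norm (eps n)) @ \oo --> (0 : R).
Hypothesis mxidot : forall n j,
  measurable_fun [set: past_space (X n) j * borel (X n j)]
    (xidot n j : _ -> borel 'cV[R]_d).
Arguments sepX : clear implicits.
Arguments mxidot : clear implicits.

Let P0 n := P n alpha0.
Let eta n (j : 'I_(m n)) := score (p n alpha0 j) (xidot n j).
Arguments eta : clear implicits.
Hypothesis A1 : assumption_A1 P0 mu p alpha0 eps xidot.
Hypothesis A2 : assumption_A2 P0 eta.
Hypothesis A3 : assumption_A3 P0 eta eps.
Context {dO} {Omega : measurableType dO}.
Variables (Q : probability Omega R) (T : Omega -> 'M[R]_d) (W : Omega -> 'cV[R]_d).
Hypothesis A4 : assumption_A4 P0 eta eps Q T W.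

Let mp n j : measurable_fun setT (p n alpha0 j).
Proof. by have [] := @densp n alpha0 j Ta. Qed.
Arguments mp : clear implicits.

Let s n j := score_fun (p n alpha0) (xidot n) (j := j).
Arguments s : clear implicits.

Lemma measurable_log_likelihood h : \forall n \near \oo,
  measurable_fun [set: state (X n)] (fun w =>
   lne (likelihood_ratio (P n (alpha0 + eps n *m h)) (P0 n) w)).
Proof.
have := open_local_parameter h oTheta Ta eps0; apply: filterS => n Th.
have [[mL _ _] _] := @likelihood_ratio_prod R (m n) (X n) (sepX n)
  (P n alpha0) (P n (alpha0 + eps n *m h)) (K n alpha0) (K n (alpha0 + eps n *m h))
  (mu n) (p n alpha0) (p n (alpha0 + eps n *m h))
  (fun j => @lawK n alpha0 j Ta) (fun j => @lawK n _ j Th)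
  (fun j x => @domK n alpha0 j x Ta) (fun j x => @domK n _ j x Th)
  (fun j => @densp n alpha0 j Ta) (fun j => @densp n _ j Th).
exact: measurable_lne.
Qed.

Let t h n j z := 2^-1 * dotv h ((eps n)^T *m xidot n j z).
Arguments t : clear implicits.

Let mt h n j : measurable_fun setT (t h n j).
Proof.
by apply: measurable_funM => //; apply: measurable_dotv_mulmx; exact: mxidot.
Qed.
Arguments mt : clear implicits.

Let relE h n j z : rel_score (p n alpha0 j) (t h n j) z =
  dotv (2^-1 *: h) ((eps n)^T *m s n j z).
Proof.
by rewrite dotvZl dotv_score_fun mulrA mulVf// mul1r.
Qed.

Let relfE h n j : rel_score (p n alpha0 j) (t h n j) =
  fun z => dotv (2^-1 *: h) ((eps n)^T *m s n j z).
Proof. by apply/funext => z; exact: relE. Qed.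

Let finite_moments : \forall n \near \oo, forall j : 'I_(m n),
  {ae P0 n, forall w, (cond_sqnorm (P0 n) j (eta n j) w < +oo)%E} /\
  {ae P0 n, forall w, forall i : 'I_d,
    cond_exp (P0 n) (past_algebra j) (fun w' => (eta n j w' i 0)%:E) w = 0%E}.
Proof. by have [n0 h] := A2; exists n0. Qed.

Let rel_moments h : \forall n \near \oo, forall j, {ae P0 n, forall w,
  (\int[K n alpha0 j (past j w)]_v
    (rel_score (p n alpha0 j) (t h n j) (past j w, v) ^+ 2)%:E < +oo)%E /\
  (\int[K n alpha0 j (past j w)]_v
    (rel_score (p n alpha0 j) (t h n j) (past j w, v))%:E = 0)%E}.
Proof.
apply: filterS finite_moments => n hn j; have [h1 h2] := hn j.
rewrite relfE; exact: (score_form_finite (sepX n) (fun j => @lawK n alpha0 j Ta)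
  (mp n) (mxidot n) _ _ h1 h2).
Qed.
Arguments rel_moments : clear implicits.

Let information_rel h : \forall n \near \oo, {ae P0 n, forall w,
  (dotv (2^-1 *: h) (information (P0 n) (eps n) (eta n) w *m (2^-1 *: h)))%:E =
  (\sum_(j < m n) \int[K n alpha0 j (past j w)]_v
    (rel_score (p n alpha0 j) (t h n j) (past j w, v) ^+ 2)%:E)%E}.
Proof.
apply: filterS finite_moments => n hn.
have fin j : {ae P0 n, forall w, (cond_sqnorm (P0 n) j (eta n j) w < +oo)%E} by have [] := hn j.
have := information_form (sepX n) (fun j => @lawK n alpha0 j Ta) (mp n) (mxidot n) (eps n)
  (2^-1 *: h) fin.
by apply: filterS => w ->; apply: eq_bigr => j _; rewrite relfE.
Qed.
Arguments information_rel : clear implicits.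

(** The Lindeberg condition at the direction [2^-1 *: h], with the conditional
    expectations replaced by integrals against the conditional laws. *)
Let rel_lindeberg h (e b : R) : 0 < e -> 0 < b ->
  whp P0 (fun n => [set w | (\sum_(j < m n) \int[K n alpha0 j (past j w)]_v
    (if (e < `|rel_score (p n alpha0 j) (t h n j) (past j w, v)|)%R
     then rel_score (p n alpha0 j) (t h n j) (past j w, v) ^+ 2 else 0)%:E <= b%:E)%E]).
Proof.
move=> e0 b0.
have mZ : \forall n \near \oo, measurable_fun [set: state (X n)] (fun w =>
      \sum_(j < m n) cond_exp (P0 n) (past_algebra j) (fun w' =>
        (let y := `|dotv (2^-1 *: h) ((eps n)^T *m eta n j w')| in
         if e < y then y ^+ 2 else 0)%:E) w)%E.
  by apply: nearW => n; apply: emeasurable_sum => j; exact: measurable_cond_exp_past.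
have small := whp_of_cvg mZ (A3 (2^-1 *: h) e0) b0.
pose F n j z : \bar R := (let y := `|dotv (2^-1 *: h) ((eps n)^T *m s n j z)| in
         if e < y then y ^+ 2 else 0)%:E.
have mF n j : measurable_fun setT (F n j).
  have my : measurable_fun setT (rel_score (p n alpha0 j) (t h n j)).
    by apply: measurable_rel_score; [exact: mp|exact: mt].
  rewrite relfE in my; apply/measurable_EFinP.
  have mny := measurableT_comp (@normr_measurable R setT) my.
  apply: measurable_fun_ifT; [exact: measurable_fun_ltr|exact: measurable_funX|exact: measurable_cst].
have kern : \forall n \near \oo, {ae P0 n, forall w, forall j,
    cond_exp (P0 n) (past_algebra j) (fun w => F n j (past_now j w)) w =
    (\int[K n alpha0 j (past j w)]_v F n j (past j w, v))%E}.
  apply: nearW => n; apply: filter_forall => j.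
  exact: (cond_exp_past (sepX n) (fun j => @lawK n alpha0 j Ta) (mF n j)).
apply: (whpI _ small (whp_ae kern)); apply: nearW => n w /= + kw.
apply: le_trans; apply: le_trans (lee_abs _); apply: lee_sum => j _.
rewrite [leRHS]kw le_eqVlt; apply/orP; left; apply/eqP; apply: eq_integral => v _.
by rewrite relE /F /=; case: ifP => // _; rewrite real_normK ?num_real.
Qed.

(** The sum of the conditional second moments is a quadratic form in the
    information matrix, which converges in law. *)
Let rel_tight h : tight P0 (fun n w => \sum_(j < m n)
  \int[K n alpha0 j (past j w)]_v
    (rel_score (p n alpha0 j) (t h n j) (past j w, v) ^+ 2)%:E)%E.
Proof.
have [_ _ [mT _ _ _ lim]] := A4.
have mI n := measurable_information (sepX n) (P n alpha0) (p n alpha0) (xidot n) (eps n).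
have cphi : continuous (fun A : 'M[R]_d => `|dotv (2^-1 *: h) (A *m (2^-1 *: h))|).
  move=> A; apply: (@continuous_comp _ _ _ (fun A : 'M[R]_d =>
    dotv (2^-1 *: h) (A *m (2^-1 *: h))) (fun x : R => `|x|)).
    exact: quadratic_form_continuous.
  exact: norm_continuous.
have := tight_continuous mI mT lim cphi (fun A => normr_ge0 _).
apply: tight_ae_le; apply: filterS (information_rel h) => n.
by apply: filterS => w <-; rewrite lee_fin ler_norm.
Qed.
Arguments rel_tight : clear implicits.

(** [log_likelihood_expansion] with [p2] the densities at the opposite local
    parameter; the sums of the [y] and of their conditional second moments are
    then identified with the central sequence and the information. *)
Theorem local_expansion h : cvg_to0_in_prob P0 (fun n w =>
   lne (likelihood_ratio (P n (alpha0 + eps n *m h)) (P0 n) w)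
      - (dotv h (central_sequence (eps n) (eta n) w))%:E
      + (2^-1 * dotv h (information (P0 n) (eps n) (eta n) w *m h))%:E)%E.
Proof.
apply: cvg_of_whp.
  apply: filterS (measurable_log_likelihood h) => n mL.
  apply: measurable_quadratic_expansion => //; first exact: measurable_central_sequence.
  exact: measurable_information.
move=> c c0.
have Th := open_local_parameter h oTheta Ta eps0.
have Tmh := open_local_parameter (- h) oTheta Ta eps0.
have valid : \forall n \near \oo,
  [/\ forall j, is_cond_law (P n (alpha0 + eps n *m h)) (K n (alpha0 + eps n *m h) j),
      forall j x, K n (alpha0 + eps n *m h) j x `<< mu n j,
      forall j, is_cond_density (mu n j) (K n (alpha0 + eps n *m h) j)
        (p n (alpha0 + eps n *m h) j) &
      forall j, measurable_fun setT (p n (alpha0 + eps n *m - h) j)].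
  move: Th Tmh; apply: filterS2 => n Th Tmh; split.
  - by move=> j; exact: lawK.
  - by move=> j x; exact: domK.
  - by move=> j; exact: densp.
  - by move=> j; have [] := @densp n _ j Tmh.
(* [assumption_A1] at [- h], where the linear term changes sign. *)
have A1m : cvg_to0_in_prob P0 (fun n w => \sum_(j < m n) \int[mu n j]_x
  (((Num.sqrt (p n (alpha0 + eps n *m - h) j (past j w, x))
     - Num.sqrt (p n alpha0 j (past j w, x))) + t h n j (past j w, x)) ^+ 2)%:E)%E.
  move=> e e0; apply: cvg_trans (A1 (- h) e0); apply: near_eq_cvg.
  apply: nearW => n; congr (P0 n _); apply/funext => w /=.
  congr (is_true (_ < `|_|)%E); apply: eq_bigr => j _; apply: eq_integral => x _.
  by rewrite /t -scaleN1r dotvZl mulN1r mulrN opprK.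
have := @log_likelihood_expansion R m X sepX P0
  (fun n => P n (alpha0 + eps n *m h)) mu (fun n => K n alpha0)
  (fun n => K n (alpha0 + eps n *m h)) (fun n => p n alpha0)
  (fun n => p n (alpha0 + eps n *m h)) (fun n => p n (alpha0 + eps n *m - h)) (t h)
  (fun n j => @lawK n alpha0 j Ta) (fun n j x => @domK n alpha0 j x Ta)
  (fun n j => @densp n alpha0 j Ta) valid (mt h) (A1 h) A1m (rel_moments h)
  (@rel_lindeberg h) (rel_tight h) c c0.
move=> expansion.
have finite : \forall n \near \oo, {ae P0 n, forall w, forall j,
    (\int[K n alpha0 j (past j w)]_v
      (rel_score (p n alpha0 j) (t h n j) (past j w, v) ^+ 2)%:E < +oo)%E}.
  apply: filterS (rel_moments h) => n hn; apply: filter_forall => j.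
  by apply: filterS (hn j) => w [].
have agree := whp_and (whp_ae (information_rel h)) (whp_ae finite).
apply: (whpI _ expansion agree); apply: nearW => n w /= + [infoE finE].
have -> : (2 * \sum_(j < m n) rel_score (p n alpha0 j) (t h n j) (past_now j w) =
    dotv h (central_sequence (eps n) (eta n) w))%R.
  rewrite /central_sequence mulmx_sumr dotv_sumr mulr_sumr; apply: eq_bigr => j _.
  by rewrite [RHS]dotv_score_fun.
have -> : (2 * \sum_(j < m n) fine (\int[K n alpha0 j (past j w)]_v
      (rel_score (p n alpha0 j) (t h n j) (past j w, v) ^+ 2)%:E) =
    2^-1 * dotv h (information (P0 n) (eps n) (eta n) w *m h))%R.
  rewrite (_ : \sum_(j < m n) _ = fine (dotv (2^-1 *: h)
    (information (P0 n) (eps n) (eta n) w *m (2^-1 *: h)))%:E); last first.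
    rewrite infoE -sum_fine// => j _.
    rewrite ge0_fin_numE//; apply: integral_ge0 => v _; by rewrite lee_fin sqr_ge0.
  rewrite /= -scalemxAr dotvZl dotvZr; lra.
by [].
Qed.

End local_asymptotics.

Theorem theorem2p1 (R : realType) (d : nat)
    (Theta : set 'cV[R]_d) (alpha0 : 'cV[R]_d) (m : nat -> nat)
    (X : forall n, 'I_(m n) -> completeMetricType R)
    (P : forall n, 'cV[R]_d -> probability (state (@X n)) R)
    (mu : forall n (j : 'I_(m n)),
      {sigma_finite_measure set (borel (X n j)) -> \bar R})
    (K : forall n, 'cV[R]_d -> forall j : 'I_(m n),
      R.-pker (past_space (@X n) j) ~> (borel (X n j)))
    (p : forall n, 'cV[R]_d -> forall j : 'I_(m n),
      past_space (@X n) j * borel (X n j) -> R)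
    (eps : nat -> 'M[R]_d)
    (xidot : forall n (j : 'I_(m n)),
      past_space (@X n) j * borel (X n j) -> 'cV[R]_d)
    (dO : measure_display) (Omega : measurableType dO)
    (Q : probability Omega R) (T : Omega -> 'M[R]_d) (W : Omega -> 'cV[R]_d) :
  open Theta -> Theta alpha0 ->
  (forall n, (0 < m n)%N) ->
  (forall n j, separable (X n j)) ->
  (forall n alpha j, Theta alpha -> is_cond_law (P n alpha) (K n alpha j)) ->
  (forall n alpha j x, Theta alpha -> K n alpha j x `<< mu n j) ->
  (forall n alpha j, Theta alpha ->
    is_cond_density (mu n j) (K n alpha j) (p n alpha j)) ->
  (forall n, eps n \in unitmx) ->
  (fun n => op_norm (eps n)) @ \oo --> (0 : R) ->
  (forall n j, measurable_fun [set: past_space (@X n) j * borel (X n j)]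
    (xidot n j : _ -> borel 'cV[R]_d)) ->
  let P0 n := P n alpha0 in
  let eta n (j : 'I_(m n)) := score (p n alpha0 j) (xidot n j) in
  assumption_A1 P0 mu p alpha0 eps xidot ->
  assumption_A2 P0 eta ->
  assumption_A3 P0 eta eps ->
  assumption_A4 P0 eta eps Q T W ->
  condition_L P alpha0 eps
    (fun n => central_sequence (eps n) (eta n))
    (fun n => information (P0 n) (eps n) (eta n)) Q T W
  /\
  ({ae Q, forall w, pos_def (T w)} ->
   (forall n, symmetric_mx (eps n) /\ pos_def (eps n)) ->
   LAMN P alpha0).
Proof.
move=> oTheta Ta m_gt0 sepX lawK domK densp eps_unit eps0 mxidot P0 eta A1 A2 A3 A4.
have mp n j : measurable_fun setT (p n alpha0 j) by have [] := densp n alpha0 j Ta.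
have [symT nnT limA4] := A4.
have [mT mW W_normal W_indep lim] := limA4.
have mV n := measurable_central_sequence (sepX n) (mp n) (mxidot n) (eps n).
have mI n := measurable_information (sepX n) (P0 n) (p n alpha0) (xidot n) (eps n).
have symI n w := symmetric_information (P0 n) (p n alpha0) (xidot n) (eps n) w.
have nnI n := nonneg_information (sepX n) (fun j => lawK n alpha0 j Ta) (mp n)
  (mxidot n) (eps n).
have expansion := local_expansion oTheta Ta sepX lawK domK densp eps0 mxidot
  A1 A2 A3 A4.
have mLR h := measurable_log_likelihood oTheta Ta sepX lawK domK densp eps0 h.
split.
  split => //.
  by apply: filterS nnT => w nnw; split.
move=> pdT pd_eps.
have detT : {ae Q, forall w, \det (T w) != 0}.
  by apply: filterS pdT => w; exact: pos_def_det.
pose F n : set (state (X n)) := [set w | \det (information (P0 n) (eps n) (eta n) w) = 0].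
have mF n : measurable (F n).
  have mdet : measurable_fun setT (fun w => \det (information (P0 n) (eps n) (eta n) w)).
    apply/measurable_fun_borelR.
    exact: (measurable_continuous_comp (@det_continuous R d) (mI n)).
  by have := mdet measurableT [set 0] (measurable_set1 0); rewrite setTI.
have PF := det_eq0_small mI mT lim detT.
pose In n w := regularize (information (P0 n) (eps n) (eta n) w).
have mIn n : measurable_fun setT (In n : _ -> borel 'M[R]_d) by exact: measurable_regularize.
have InE n w : ~ F n w -> In n w = information (P0 n) (eps n) (eta n) w.
  by move=> nF; exact: regularize_id.
have pd_In n : {ae P0 n, forall w, pos_def (In n w)}.
  by apply: filterS (nnI n) => w nnw; exact: pos_def_regularize.
exists eps, (fun n => central_sequence (eps n) (eta n)), In, dO, Omega, Q, T, W.
split => //; split => //.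
- by move=> n w; apply: symmetric_regularize.
- by move=> n; apply: filterS (pd_In n) => w; exact: pos_def_nonneg.
- move=> h; apply: (cvg_to0_in_prob_modification mF PF _ _ _ (expansion h)).
  + by apply: filterS (mLR h) => n mL; exact: measurable_quadratic_expansion.
  + by apply: filterS (mLR h) => n mL; exact: measurable_quadratic_expansion.
  + by move=> n w nF; rewrite InE.
- by apply: filterS nnT => w nnw; split.
- split => //; apply: (cvg_in_law_modification mF PF _ _ _ lim).
  + by move=> n f cf; apply: measurable_continuous_mx_pair.
  + by move=> n f cf; apply: measurable_continuous_mx_pair.
  + by move=> n w nF; rewrite InE.
Qed.
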